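(* Let $\mathcal S$ be the universal cover of $Sp(2n,\mathbb R)$ with the bi-invariant partial order induced by the normal cone of elements generated by non-negative quadratic Hamiltonians (see context), and let $(Z,d)$ be the metric space associated to this partially ordered group. Then $(Z,d)$ is isometric to $\mathbb R$ with its standard metric. More precisely, the map $X\mapsto \log\tilde\mu(X)$ on the set $\mathcal S^+$ of dominants descends to an isometry $Z\to\mathbb R$, where $\tilde\mu$ is the homogenized Maslov quasimorphism.
   Context: Partially ordered groups: let $\mathcal D$ be a group and $\mathcal C\subset\mathcal D$ a normal cone, i.e. $f,g\in\mathcal C\Rightarrow fg\in\mathcal C$; $f\in\mathcal C,h\in\mathcal D\Rightarrow hfh^{-1}\in\mathcal C$; $1\in\mathcal C$. Write $f\ge g$ iff $fg^{-1}\in\mathcal C$; when this relation is antisymmetric it is a bi-invariant partial order. A dominant is $f\in\mathcal C\setminus\{1\}$ such that for every $g\in\mathcal D$ there is $n\in\mathbb N$ with $f^n\ge g$. For a dominant $f$ and $g\in\mathcal D$, $\gamma_n(f,g)=\inf\{p\in\mathbb Z: f^p\ge g^n\}$ and the relative growth is $\gamma(f,g)=\lim_{n\to\infty}\gamma_n(f,g)/n$. On the set $\mathcal C^+$ of dominants put $K(f,g)=\max\{\log\gamma(f,g),\log\gamma(g,f)\}$, a pseudo-distance; $Z=\mathcal C^+/\!\sim$ where $f\sim g$ iff $K(f,g)=0$, and $d$ is the metric induced by $K$. Symplectic setting: $J=\begin{pmatrix}0&-I\\ I&0\end{pmatrix}$ on $\mathbb R^{2n}$. $\mathcal S$ is the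 universal cover of $Sp(2n,\mathbb R)$ based at the identity: its elements are homotopy classes (rel endpoints) of paths $X:[0,1]\to Sp(2n,\mathbb R)$ with $X(0)=I$. Such a path satisfies $\dot X(t)X(t)^{-1}=JH(t)$ for a symmetric matrix $H(t)$ (the Hamiltonian of the path). The cone consists of elements representable by a path with $H(t)$ positive semidefinite for all $t$; the set $\mathcal S^+$ of dominants consists of the elements representable by a path with $H(t)$ positive definite for all $t$. (It is known, by Olshanskii, that this cone gives a genuine partial order.) Maslov quasimorphism: identify $U(n)$ with $Sp(2n,\mathbb R)\cap O(2n)$ via $A+iB\mapsto\begin{pmatrix}A&-B\\ B&A\end{pmatrix}$. For $X\in\mathcal S$ represented by $\Psi(t)$, take the polar decomposition $\Psi(t)=U(t)P(t)$ with $U(t)$ unitary and $P(t)$ symmetric positive definite, choose continuous $\theta(t)$ with $\det_{\mathbb C}U(t)=e^{i\theta(t)}$, and set $\mu(X)=\theta(1)-\theta(0)$. $\mu$ is a quasimorphism, i.e. $|\mu(fg)-\mu(f)-\mu(g)|\le C$ for some constant $C$ and all $f,g$; its homogenization is $\tilde\mu(X)=\lim_{k\to\infty}\mu(X^k)/k$. *)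

(* Defs.v *)
From HB Require Import structures.
From mathcomp Require Import all_boot all_order all_algebra.
From mathcomp Require Import all_classical all_reals all_analysis.
From mathcomp Require Import complex.
Set Implicit Arguments. Unset Strict Implicit. Unset Printing Implicit Defensive.
Import Order.TTheory GRing.Theory Num.Theory numFieldNormedType.Exports.
Local Open Scope ring_scope.
Local Open Scope classical_set_scope.

Section SymplecticUniversalCover.
Variables (R : realType) (n : nat).

(* real 2n x 2n matrices, written with size n + n so blocks are available *)
Definition Mat := 'M[R]_(n + n).

Definition Jmat : Mat := block_mx 0 (- 1%:M) 1%:M 0.

Definition symplectic (M : Mat) : Prop := M^T *m Jmat *m M = Jmat.

Definition I01 : set R := `[0, 1].

Definition is_path (X : R -> Mat) : Prop :=
  X 0 = 1%:M /\
  (forall t, I01 t -> symplectic (X t)) /\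
  (forall i j, {within I01, continuous (fun t => X t i j)}).

Definition homotopic (X Y : R -> Mat) : Prop :=
  exists F : R -> R -> Mat,
    (forall i j, {within I01 `*` I01, continuous (fun p => F p.1 p.2 i j)}) /\
    (forall s t, I01 s -> I01 t -> symplectic (F s t)) /\
    (forall s, I01 s -> F s 0 = 1%:M /\ F s 1 = X 1) /\
    (forall t, I01 t -> F 0 t = X t /\ F 1 t = Y t).

(* group operations of the universal cover on representing paths
   (pointwise product is homotopic to concatenation) *)
Definition pmul (X Y : R -> Mat) : R -> Mat := fun t => X t *m Y t.
Definition pinv (X : R -> Mat) : R -> Mat := fun t => invmx (X t).
Definition ppow (X : R -> Mat) (p : int) : R -> Mat :=
  match p with
  | Posz k => fun t => X t ^+ k
  | Negz k => fun t => invmx (X t ^+ k.+1)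
  end.
Definition pone : R -> Mat := fun _ => 1%:M.

Definition psd (H : Mat) : Prop :=
  H^T = H /\ forall v : 'cV[R]_(n + n), 0 <= (v^T *m H *m v) 0 0.

(* a differentiable path whose Hamiltonian H(t) (dX/dt X^-1 = J H) is psd *)
Definition psd_hamiltonian_path (Y : R -> Mat) : Prop :=
  is_path Y /\
  exists D : R -> Mat,
    forall t, I01 t ->
      (forall i j, is_derive t 1 (fun s => Y s i j) (D t i j)) /\
      psd (- (Jmat *m D t *m invmx (Y t))).

Definition in_cone (X : R -> Mat) : Prop :=
  is_path X /\ exists Y, psd_hamiltonian_path Y /\ homotopic X Y.

Definition ge (f g : R -> Mat) : Prop := in_cone (pmul f (pinv g)).

Definition dominant (f : R -> Mat) : Prop :=
  is_path f /\ in_cone f /\ ~ homotopic f pone /\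
  forall g, is_path g -> exists m : nat, ge (ppow f m) g.

Definition gamma_n (f g : R -> Mat) (k : nat) : R :=
  inf ((fun p : int => (p%:~R : R)) @` [set p : int | ge (ppow f p) (ppow g k)]).

Definition gamma (f g : R -> Mat) : R := limn (fun k : nat => gamma_n f g k / k%:R).

Definition Kdist (f g : R -> Mat) : R := Num.max (ln (gamma f g)) (ln (gamma g f)).

(* complex determinant of U = [[A, -B], [B, A]], i.e. det_C (A + iB) *)
Definition detC (U : Mat) : R[i] :=
  \det (\matrix_(i < n, j < n) Complex (ulsubmx U i j) (dlsubmx U i j)).

Definition is_maslov (X : R -> Mat) (m : R) : Prop :=
  exists (U P : R -> Mat) (theta : R -> R),
    {within I01, continuous theta} /\
    (forall t, I01 t ->
       X t = U t *m P t /\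
       (U t)^T *m U t = 1%:M /\
       symplectic (U t) /\
       (P t)^T = P t /\
       (forall v : 'cV[R]_(n + n), v != 0 -> 0 < (v^T *m P t *m v) 0 0) /\
       detC (U t) = Complex (cos (theta t)) (sin (theta t))) /\
    m = theta 1 - theta 0.

Definition maslov (X : R -> Mat) : R := xget 0 [set m | is_maslov X m].

Definition maslov_hom (X : R -> Mat) : R :=
  limn (fun k : nat => maslov (ppow X k) / k%:R).

End SymplecticUniversalCover.

(* Main.v *)
Require Import Defs.
From HB Require Import structures.
From mathcomp Require Import all_boot all_order all_algebra.
From mathcomp Require Import all_classical all_reals all_analysis.
From mathcomp Require Import perm complex.
From mathcomp Require Import ring lra.
Set Implicit Arguments. Unset Strict Implicit. Unset Printing Implicit Defensive.
Import Order.TTheory GRing.Theory Num.Theory numFieldNormedType.Exports.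
Local Open Scope ring_scope.
Local Open Scope classical_set_scope.

(** Let R_a be the rotation path t |-> exp (t a J); R_(k pi) is central up to homotopy.
    Every path X is sandwiched, R_(q pi) <= X <= R_((q + 6) pi) for some integer q: in the polar
    form X = U P the positive part satisfies P = Q J Q^-1 J^-1 with Q = sqrt P, hence lies between
    R_(-pi/2) and R_(pi/2); and the unitary part is homotopic to V exp (t diag (i a_j)) V^* for
    suitable real angles a_j.  The latter is propagated along U by Cayley charts
    {-exp (i phi) is not an eigenvalue}: two charts differ by a loop diag (exp (2 pi i k_j t)), whose
    class only depends on the sum of the k_j.
    The Maslov map mu is the variation of the argument of the complex determinant of X - J X J.
    It is nondecreasing along paths with nonnegative Hamiltonian H, its derivative being
    tr (H (1 + X^-T X^-1)^-1), so mu >= 0 on the cone; together with mu (X R_a) = mu X + n a and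
    mu (X^-1) = - mu X, the sandwich yields that mu is a quasimorphism and that mu X >= 6 n pi
    forces X into the cone.  Therefore gamma (f, g) = mu~ g / mu~ f. *)

(* mathcomp-classical also defines [pinv]. *)
Local Notation pinv := Defs.pinv.

(** * Continuity of matrix-valued maps *)

(** The obstacle is to turn a numerical lower bound on mu into an actual nonnegative path. The
    sandwich supplies it: mu X >= 6 n pi forces the lower index q to be nonnegative, whence X >=
    R_(q pi) >= 1. Multiples of pi are used because exp (pi J) = -1 is scalar, so these rotations
    move across any path and the inequalities can be multiplied. Conversely, mu >= 0 on the cone is
    proved with the polynomial X - J X J, so that the polar factor, which involves a square root,
    never has to be differentiated. The two implications miss each other by a constant only: f^p >=
    g^k holds once p mu~ f - k mu~ g is large and fails once it is very negative, and the gap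
    disappears when gamma_k is divided by k. Positivity of mu~ on dominants comes from the order:
    some power of a dominant lies above a large rotation. *)

Section MatrixContinuity.
Variables (R : realType) (T : topologicalType).
Implicit Types (p q r : nat) (f g : T -> R).

Lemma ctsC (c : R) : continuous (fun _ : T => c).
Proof. by move=> x; exact: cvg_cst. Qed.

Lemma ctsD f g : continuous f -> continuous g -> continuous (fun x => f x + g x).
Proof. by move=> cf cg x; apply: cvgD; [exact: cf | exact: cg]. Qed.

Lemma ctsN f : continuous f -> continuous (fun x => - f x).
Proof. by move=> cf x; apply: cvgN; exact: cf. Qed.

Lemma ctsB f g : continuous f -> continuous g -> continuous (fun x => f x - g x).
Proof. by move=> cf cg x; apply: cvgB; [exact: cf | exact: cg]. Qed.

Lemma ctsM f g : continuous f -> continuous g -> continuous (fun x => f x * g x).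
Proof. by move=> cf cg x; apply: cvgM; [exact: cf | exact: cg]. Qed.

Lemma ctsV f : (forall x, f x != 0) -> continuous f -> continuous (fun x => (f x)^-1).
Proof. by move=> f0 cf x; apply: cvgV; [exact: f0 | exact: cf]. Qed.

(** Continuity is kept entrywise, as in [is_path] and [homotopic]. *)
Definition cmx p q (M : T -> 'M[R]_(p, q)) : Prop :=
  forall i j, continuous (fun x => M x i j).

Lemma continuous_bigsum (I : Type) (s : seq I) (P : pred I) (f : I -> T -> R) :
  (forall i, P i -> continuous (f i)) ->
  continuous (fun x => \sum_(i <- s | P i) f i x).
Proof.
move=> cf; elim: s => [|i s IH].
  rewrite [X in continuous X](_ : _ = cst 0); first exact: ctsC.
  by apply/funext => y; rewrite big_nil.
rewrite [X in continuous X](_ : _ = fun y =>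
  (if P i then f i y else 0) + \sum_(j <- s | P j) f j y); last first.
  by apply/funext => y; rewrite big_cons; case: ifP => //; rewrite add0r.
apply: (ctsD (f := fun y => if P i then f i y else 0)) => //.
by case Pi: (P i); [exact: cf | exact: ctsC].
Qed.

Lemma continuous_bigprod (I : Type) (s : seq I) (f : I -> T -> R) :
  (forall i, continuous (f i)) ->
  continuous (fun x => \prod_(i <- s) f i x).
Proof.
move=> cf; elim: s => [|i s IH].
  rewrite [X in continuous X](_ : _ = cst 1); first exact: ctsC.
  by apply/funext => y; rewrite big_nil.
rewrite [X in continuous X](_ : _ = fun y =>
  f i y * \prod_(j <- s) f j y); last first.
  by apply/funext => y; rewrite big_cons.
exact: ctsM.
Qed.

Lemma cmx_cst p q (A : 'M[R]_(p, q)) : cmx (fun=> A).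
Proof. by move=> i j; exact: ctsC. Qed.

Lemma cmxM p q r (A : T -> 'M[R]_(p, q)) (B : T -> 'M[R]_(q, r)) :
  cmx A -> cmx B -> cmx (fun x => A x *m B x).
Proof.
move=> cA cB i j.
rewrite [X in continuous X](_ : _ = fun x => \sum_k A x i k * B x k j); last first.
  by apply/funext => x; rewrite mxE.
by apply: continuous_bigsum => k _; exact: ctsM.
Qed.

Lemma cmxD p q (A B : T -> 'M[R]_(p, q)) :
  cmx A -> cmx B -> cmx (fun x => A x + B x).
Proof.
move=> cA cB i j; under eq_fun do rewrite mxE.
exact: ctsD.
Qed.

Lemma cmxN p q (A : T -> 'M[R]_(p, q)) : cmx A -> cmx (fun x => - A x).
Proof.
by move=> cA i j; under eq_fun do rewrite mxE; exact: ctsN.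
Qed.

Lemma cmxB p q (A B : T -> 'M[R]_(p, q)) :
  cmx A -> cmx B -> cmx (fun x => A x - B x).
Proof. by move=> cA cB; apply: cmxD => //; exact: cmxN. Qed.

Lemma cmxT p q (A : T -> 'M[R]_(p, q)) : cmx A -> cmx (fun x => (A x)^T).
Proof. by move=> cA i j x; under eq_fun do rewrite mxE; exact: cA. Qed.

Lemma cmxZ p q (c : T -> R) (A : T -> 'M[R]_(p, q)) :
  continuous c -> cmx A -> cmx (fun x => c x *: A x).
Proof.
move=> cc cA i j; under eq_fun do rewrite mxE.
exact: ctsM.
Qed.

Lemma continuous_det p (A : T -> 'M[R]_p) : cmx A -> continuous (fun x => \det (A x)).
Proof.
move=> cA; rewrite /determinant; apply: continuous_bigsum => s _.
apply: ctsM; first exact: ctsC.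
by apply: continuous_bigprod => i; exact: cA.
Qed.

Lemma cmx_inv p (A : T -> 'M[R]_p) : (forall x, A x \in unitmx) -> cmx A ->
  cmx (fun x => invmx (A x)).
Proof.
move=> uA cA.
rewrite [X in cmx X](_ : _ = fun x => (\det (A x))^-1 *: \adj (A x)); last first.
  by apply/funext => x; rewrite /invmx uA.
apply: cmxZ => [|i j].
  apply: ctsV; last exact: continuous_det.
  by move=> x; have := uA x; rewrite unitmxE unitfE.
under eq_fun do rewrite mxE /cofactor.
apply: ctsM; first exact: ctsC.
apply: (continuous_det (A := fun y => row' j (col' i (A y)))) => k l.
by under eq_fun do rewrite !mxE; exact: cA.
Qed.

Lemma cmx_block p1 p2 q1 q2 (A : T -> 'M[R]_(p1, q1)) (B : T -> 'M[R]_(p1, q2))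
    (C : T -> 'M[R]_(p2, q1)) (D : T -> 'M[R]_(p2, q2)) :
  cmx A -> cmx B -> cmx C -> cmx D ->
  cmx (fun x => block_mx (A x) (B x) (C x) (D x)).
Proof.
move=> cA cB cC cD i j.
case: (split_ordP i) => i' ->; case: (split_ordP j) => j' ->.
- by under eq_fun do rewrite block_mxEul; exact: cA.
- by under eq_fun do rewrite block_mxEur; exact: cB.
- by under eq_fun do rewrite block_mxEdl; exact: cC.
- by under eq_fun do rewrite block_mxEdr; exact: cD.
Qed.

End MatrixContinuity.

Lemma cmx_comp (R : realType) (S T : topologicalType) p q (h : S -> T) (M : T -> 'M[R]_(p, q)) :
  continuous h -> cmx M -> cmx (M \o h).
Proof.
move=> ch cM i j x.
by apply: (@continuous_comp _ _ _ h (fun y => M y i j)); [exact: ch | exact: cM].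
Qed.

Section Clamp.
Variable R : realType.
Implicit Types t : R.

(* Precomposing with [clamp] turns continuity within [0, 1] into continuity on the whole line. *)
Definition clamp t : R := Num.min (Num.max t 0) 1.

Lemma clamp_in t : 0 <= clamp t <= 1.
Proof.
by rewrite /clamp le_min le_max ge_min !lexx !orbT ler01.
Qed.

Lemma clampI01 t : I01 (clamp t).
Proof. by rewrite /I01 /= in_itv /= clamp_in. Qed.

Lemma clamp_id t : 0 <= t <= 1 -> clamp t = t.
Proof.
by rewrite /clamp => /andP[t0 t1]; rewrite (max_l t0) (min_l t1).
Qed.

Lemma clamp0 : clamp 0 = 0. Proof. by rewrite clamp_id // lexx ler01. Qed.

Lemma clamp1 : clamp 1 = 1. Proof. by rewrite clamp_id // lexx ler01. Qed.

Lemma clamp_clamp t : clamp (clamp t) = clamp t.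
Proof. exact: clamp_id (clamp_in t). Qed.

Lemma clamp_continuous : continuous clamp.
Proof.
move=> t; apply: (@continuous_min _ _ (fun t => Num.max t 0) (fun=> 1)).
  apply: (@continuous_max _ _ id (fun=> 0)); [exact: cvg_id | exact: cvg_cst].
exact: cvg_cst.
Qed.

End Clamp.

(** Applied with [h] built from [clamp], this removes all subspace topologies from the later
    arguments. *)
Lemma continuous_comp_into (S T U : topologicalType) (A : set T) (h : S -> T)
    (f : T -> U) :
  {within A, continuous f} -> continuous h -> (forall x, A (h x)) ->
  continuous (f \o h).
Proof.
move=> /subspace_continuousP cf ch Ah x.
apply: (@cvg_comp _ _ _ h f _ (within A (nbhs (h x)))); last exact: cf.
move=> V /= /(ch x) => VV; rewrite /nbhs /=; near=> y.
by have : ([set y | A y -> V y] (h y)) by [near: y; exact: VV]; apply; exact: Ah.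
Unshelve. all: by end_near. Qed.

(** * Symplectic matrices and homotopy of paths *)

Lemma invmx_mul (R : comUnitRingType) m (A B : 'M[R]_m) :
  A \in unitmx -> B \in unitmx -> invmx (A *m B) = invmx B *m invmx A.
Proof.
move=> uA uB; have uAB : A *m B \in unitmx by rewrite unitmx_mul uA.
apply: (can_inj (mulKmx uAB)).
by rewrite mulmxV // -mulmxA (mulmxA B) mulmxV // mul1mx mulmxV.
Qed.

Section SymplecticMatrices.
Variables (R : realType) (n : nat).
Local Notation M2 := 'M[R]_(n + n).
Local Notation J := (Jmat R n).
Implicit Types (A B : M2).

Lemma JmatK : J *m J = - 1%:M.
Proof.
rewrite /Jmat mulmx_block !mul0mx !mulmx0 !mulmx1 !mul1mx addr0 !add0r addr0.
by rewrite (scalar_mx_block n n) opp_block_mx !oppr0.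
Qed.

Lemma trmx_Jmat : J^T = - J.
Proof.
rewrite /Jmat tr_block_mx !trmx0 linearN /= trmx1 opp_block_mx !oppr0 opprK.
by [].
Qed.

Lemma symplecticM A B : symplectic A -> symplectic B -> symplectic (A *m B).
Proof.
rewrite /symplectic => sA sB.
by rewrite trmx_mul -!mulmxA (mulmxA J) (mulmxA A^T) (mulmxA A^T) sA mulmxA.
Qed.

Lemma symplectic_mulVmx A : symplectic A -> - (J *m A^T *m J) *m A = 1%:M.
Proof.
by move=> sA; rewrite mulNmx -!mulmxA (mulmxA A^T) sA JmatK opprK.
Qed.

Lemma symplectic_unitmx A : symplectic A -> A \in unitmx.
Proof. by move=> /symplectic_mulVmx /mulmx1_unit[]. Qed.

Lemma symplectic_invmx A : symplectic A -> invmx A = - (J *m A^T *m J).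
Proof.
move=> sA; rewrite -[RHS]mulmx1 -(mulmxV (symplectic_unitmx sA)) mulmxA.
by rewrite symplectic_mulVmx // mul1mx.
Qed.

Lemma symplecticV A : symplectic A -> symplectic (invmx A).
Proof.
move=> sA; have uA := symplectic_unitmx sA.
rewrite /symplectic -{1}sA !mulmxA -trmx_mul mulmxV // trmx1 mul1mx.
by rewrite -mulmxA mulmxV // mulmx1.
Qed.

Lemma symplecticT A : symplectic A -> symplectic A^T.
Proof.
move=> sA; have uA := symplectic_unitmx sA; rewrite /symplectic trmxK.
have := symplectic_mulVmx sA.
move=> /mulmx1C; rewrite mulmxN !mulmxA => /(congr1 (fun B => B *m J)).
by rewrite mul1mx mulNmx -(mulmxA _ J J) JmatK mulmxN opprK mulmx1.
Qed.

(** Moving J across A turns conjugations of J D X^-1 into congruences, which preserve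
    semidefiniteness. *)
Lemma mul_symplectic_J A : symplectic A -> J *m A = (invmx A)^T *m J.
Proof.
move=> sA; rewrite -{2}sA !mulmxA -trmx_mul mulmxV ?symplectic_unitmx //.
by rewrite trmx1 mul1mx.
Qed.

End SymplecticMatrices.

Section Paths.
Variables (R : realType) (n : nat).
Local Notation M2 := 'M[R]_(n + n).
Local Notation J := (Jmat R n).
Implicit Types (X Y Z : R -> M2).

Lemma is_pathI X : X 0 = 1%:M -> (forall t, symplectic (X t)) -> cmx X -> is_path X.
Proof.
move=> X0 sX cX; split => //; split => // i j.
exact: continuous_subspaceT.
Qed.

Lemma is_path_clamp X : is_path X ->
  [/\ X (clamp 0) = 1%:M, forall t, symplectic (X (clamp t)) & cmx (X \o @clamp R)].
Proof.
move=> [X0 [sX cX]]; split; first by rewrite clamp0.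
  by move=> t; apply: sX; exact: clampI01.
move=> i j; apply: (@continuous_comp_into R R R (@I01 R) (@clamp R) (fun t => X t i j)).
- exact: cX.
- exact: clamp_continuous.
- exact: clampI01.
Qed.

(** Homotopies are built here, and unpacked in [homotopicE], as maps on the whole plane, which can
    be reparametrized freely. *)
Lemma homotopicI X Y (F : R -> R -> M2) :
  cmx (fun p : R * R => F p.1 p.2) -> (forall s t, symplectic (F s t)) ->
  (forall s, F s 0 = 1%:M) -> (forall s, F s 1 = X 1) ->
  (forall t, 0 <= t <= 1 -> F 0 t = X t) -> (forall t, 0 <= t <= 1 -> F 1 t = Y t) ->
  homotopic X Y.
Proof.
move=> cF sF F0 F1 FX FY; exists F; split => [i j|]; first exact: continuous_subspaceT.
by split => //; split => // t; rewrite /I01 /= in_itv /= => tI; split; [exact: FX | exact: FY].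
Qed.

Lemma continuous_fst2 : continuous (fst : R * R -> R).
Proof. by move=> p; exact: cvg_fst. Qed.

Lemma continuous_snd2 : continuous (snd : R * R -> R).
Proof. by move=> p; exact: cvg_snd. Qed.

Lemma continuous_pair (T : topologicalType) (f g : T -> R) :
  continuous f -> continuous g -> continuous (fun x => (f x, g x)).
Proof. by move=> cf cg x; exact: (cvg_pair (cf x) (cg x)). Qed.

Lemma homotopicE X Y : homotopic X Y ->
  exists F : R -> R -> M2, [/\ cmx (fun p : R * R => F p.1 p.2),
  (forall s t, symplectic (F s t)), (forall s, F s 0 = 1%:M), (forall s, F s 1 = X 1) &
  (forall t, 0 <= t <= 1 -> F 0 t = X t /\ F 1 t = Y t)].
Proof.
move=> [F [cF [sF [F01 FXY]]]]; exists (fun s t => F (clamp s) (clamp t)); split.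
- move=> i j.
  apply: (@continuous_comp_into _ _ _ _
    (fun p : R * R => (clamp p.1, clamp p.2)) _ (cF i j)).
    apply: continuous_pair => p.
      by apply: continuous_comp; [exact: continuous_fst2 | exact: clamp_continuous].
    by apply: continuous_comp; [exact: continuous_snd2 | exact: clamp_continuous].
  by move=> p; split; exact: clampI01.
- by move=> s t; apply: sF; exact: clampI01.
- by move=> s; rewrite clamp0; have [] := F01 _ (clampI01 s).
- by move=> s; rewrite clamp1; have [] := F01 _ (clampI01 s).
- move=> t t01; rewrite clamp0 clamp1 (clamp_id t01).
  by apply: FXY; rewrite /I01 /= in_itv.
Qed.

Lemma cmx_comp2 (T : topologicalType) (F : R -> R -> M2) (f g : T -> R) :
  cmx (fun p : R * R => F p.1 p.2) -> continuous f -> continuous g ->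
  cmx (fun x => F (f x) (g x)).
Proof. by move=> cF cf cg; exact: (cmx_comp (continuous_pair cf cg) cF). Qed.

Lemma homotopic_refl X : is_path X -> homotopic X X.
Proof.
move=> /is_path_clamp[X0 sX cX]; apply: (@homotopicI _ _ (fun _ t => X (clamp t))) => //.
- exact: (cmx_comp continuous_snd2 cX).
- by rewrite clamp1.
- by move=> t /clamp_id ->.
- by move=> t /clamp_id ->.
Qed.

Lemma homotopic_end X Y : homotopic X Y -> X 1 = Y 1.
Proof.
move=> /homotopicE[F [_ _ _ F1 FXY]].
have i1 : 0 <= (1 : R) <= 1 by rewrite lexx ler01.
by have [_ <-] := FXY 1 i1; rewrite F1.
Qed.

Lemma homotopic_sym X Y : homotopic X Y -> homotopic Y X.
Proof.
move=> XY; have [F [cF sF F0 F1 FXY]] := homotopicE XY.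
apply: (@homotopicI _ _ (fun s t => F (1 - s) t)) => //.
- apply: (cmx_comp2 cF); last exact: continuous_snd2.
  by apply: ctsB; [exact: ctsC | exact: continuous_fst2].
- by move=> s; rewrite F1 (homotopic_end XY).
- by move=> t /FXY[]; rewrite subr0.
- by move=> t /FXY[]; rewrite subrr.
Qed.

Lemma homotopic_path X Y : homotopic X Y -> is_path X.
Proof.
move=> /homotopicE[F [cF sF F0 F1 FXY]].
have I01P t : I01 t -> 0 <= t <= 1 by rewrite /I01 /= in_itv.
have i0 : 0 <= (0 : R) <= 1 by rewrite lexx ler01.
split; first by have [<-] := FXY 0 i0; rewrite F0.
split => [t /I01P /FXY[<- _]//|i j].
apply: (@subspace_eq_continuous _ _ _ (fun t => F 0 t i j)).
  by move=> t /set_mem /I01P tI /=; have [-> _] := FXY t tI.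
apply: continuous_subspaceT.
have cid : continuous (id : R -> R) by move=> t; exact: cvg_id.
exact: (cmx_comp2 cF (@ctsC _ _ 0) cid).
Qed.

(* [F * Y^-1 * G] is a homotopy from X to Z: the group structure spares the subdivision of [0, 1]. *)
Lemma homotopic_trans Y X Z : homotopic X Y -> homotopic Y Z -> homotopic X Z.
Proof.
move=> XY YZ; have /is_path_clamp[Y0 sY cY] := homotopic_path YZ.
have [F [cF sF F0 F1 FXY]] := homotopicE XY.
have [G [cG sG G0 G1 GYZ]] := homotopicE YZ.
have uY t := symplectic_unitmx (sY t).
apply: (@homotopicI _ _ (fun s t => F s t *m invmx (Y (clamp t)) *m G s t)).
- apply: cmxM => //; apply: cmxM => //; apply: cmx_inv => //.
  exact: (cmx_comp continuous_snd2 cY).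
- by move=> s t; apply: symplecticM => //; apply: symplecticM => //; exact: symplecticV.
- by move=> s; rewrite F0 G0 Y0 invmx1 !mulmx1.
- by move=> s; rewrite F1 G1 clamp1 -mulmxA mulVmx ?mulmx1 // -(clamp1 R).
- move=> t t01; have [-> _] := FXY t t01; have [-> _] := GYZ t t01.
  by rewrite clamp_id // -mulmxA mulVmx ?mulmx1 // -(clamp_id t01).
- move=> t t01; have [_ ->] := FXY t t01; have [_ ->] := GYZ t t01.
  by rewrite clamp_id // mulmxV ?mul1mx // -(clamp_id t01).
Qed.

Lemma homotopic_pmul X X' Y Y' : homotopic X X' -> homotopic Y Y' ->
  homotopic (pmul X Y) (pmul X' Y').
Proof.
move=> /homotopicE[F [cF sF F0 F1 FX]] /homotopicE[G [cG sG G0 G1 GY]].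
apply: (@homotopicI _ _ (fun s t => F s t *m G s t)).
- exact: cmxM.
- by move=> s t; exact: symplecticM.
- by move=> s; rewrite F0 G0 mulmx1.
- by move=> s; rewrite F1 G1.
- by move=> t t01; have [-> _] := FX t t01; have [-> _] := GY t t01.
- by move=> t t01; have [_ ->] := FX t t01; have [_ ->] := GY t t01.
Qed.

Lemma homotopic_pinv X X' : homotopic X X' -> homotopic (pinv X) (pinv X').
Proof.
move=> /homotopicE[F [cF sF F0 F1 FX]].
apply: (@homotopicI _ _ (fun s t => invmx (F s t))).
- by apply: cmx_inv => // p; exact: symplectic_unitmx.
- by move=> s t; exact: symplecticV.
- by move=> s; rewrite F0 invmx1.
- by move=> s; rewrite F1.
- by move=> t t01; have [-> _] := FX t t01.
- by move=> t t01; have [_ ->] := FX t t01.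
Qed.

Lemma homotopic_clamp X : is_path X -> homotopic X (X \o @clamp R).
Proof.
move=> /is_path_clamp[X0 sX cX]; apply: (@homotopicI _ _ (fun _ t => X (clamp t))) => //.
- exact: (cmx_comp continuous_snd2 cX).
- by rewrite clamp1.
- by move=> t /clamp_id ->.
Qed.

Lemma homotopic_eq X Y : is_path X -> (forall t, 0 <= t <= 1 -> X t = Y t) -> homotopic X Y.
Proof.
move=> /is_path_clamp[X0 sX cX] XY; apply: (@homotopicI _ _ (fun _ t => X (clamp t))) => //.
- exact: (cmx_comp continuous_snd2 cX).
- by rewrite clamp1.
- by move=> t /clamp_id ->.
- by move=> t t01; rewrite (clamp_id t01) XY.
Qed.

Lemma is_path_eq X Y : is_path X -> (forall t, 0 <= t <= 1 -> X t = Y t) -> is_path Y.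
Proof. by move=> pX /(homotopic_eq pX) /homotopic_sym /homotopic_path. Qed.

Lemma is_path_pmul X Y : is_path X -> is_path Y -> is_path (pmul X Y).
Proof.
move=> /homotopic_refl hX /homotopic_refl hY.
exact: homotopic_path (homotopic_pmul hX hY).
Qed.

Lemma is_path_pinv X : is_path X -> is_path (pinv X).
Proof. by move=> /homotopic_refl /homotopic_pinv /homotopic_path. Qed.

Lemma is_path_unit X t : is_path X -> 0 <= t <= 1 -> X t \in unitmx.
Proof.
by move=> [_ [sX _]] t01; apply: symplectic_unitmx; apply: sX; rewrite /I01 /= in_itv.
Qed.

Lemma is_path_symplectic X t : is_path X -> 0 <= t <= 1 -> symplectic (X t).
Proof. by move=> [_ [sX _]] t01; apply: sX; rewrite /I01 /= in_itv. Qed.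

Lemma continuous_slide : continuous (fun p : R * R => clamp (p.2 + p.1 * (1 - p.2))).
Proof.
move=> p; apply: (@continuous_comp _ _ _ (fun p : R * R => p.2 + p.1 * (1 - p.2)) (@clamp R)).
  have c1 := continuous_fst2; have c2 := continuous_snd2.
  apply: ctsD => //; apply: ctsM => //; apply: ctsB => //; exact: ctsC.
exact: clamp_continuous.
Qed.

(* Slide [Z t] to [Z 1]. *)
Lemma homotopic_conj X Z : is_path X -> is_path Z ->
  homotopic (pmul (pmul Z X) (pinv Z)) (fun t => Z 1 *m X t *m invmx (Z 1)).
Proof.
move=> /is_path_clamp[X0 sX cX] /is_path_clamp[Z0 sZ cZ].
pose c (p : R * R) := clamp (p.2 + p.1 * (1 - p.2)).
apply: (@homotopicI _ _ (fun s t => Z (c (s, t)) *m X (clamp t) *m invmx (Z (c (s, t))))).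
- have cZc : cmx (fun p : R * R => Z (c (p.1, p.2))).
    rewrite [X in cmx X](_ : _ = (Z \o @clamp R) \o c); last first.
      by apply/funext => -[s t] /=; rewrite /c /= clamp_clamp.
    exact: (cmx_comp continuous_slide cZ).
  have uZc p : Z (c (p.1, p.2)) \in unitmx by exact: symplectic_unitmx (sZ _).
  apply: cmxM; last exact: (cmx_inv uZc cZc).
  exact: (cmxM cZc (cmx_comp continuous_snd2 cX)).
- by move=> s t; exact: (symplecticM (symplecticM (sZ _) (sX _)) (symplecticV (sZ _))).
(* At t = 0 the conjugating matrix still varies with s, but it acts on X 0 = 1; at t = 1 it is
   already Z 1. *)
- by move=> s; rewrite X0 mulmx1 mulmxV // (symplectic_unitmx (sZ _)).
- by move=> s; rewrite /pmul /pinv /c /= subrr mulr0 addr0 clamp1.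
- by move=> t t01; rewrite /pmul /pinv /c /= mul0r addr0 clamp_id.
- by move=> t t01; rewrite /c /= mul1r addrC subrK clamp1 clamp_id.
Qed.

End Paths.

(** * The cone of nonnegative paths *)

Section MatrixDerivatives.
Variables (R : realType).
Implicit Types (t : R).

Definition dmx p q (Y : R -> 'M[R]_(p, q)) t (D : 'M[R]_(p, q)) : Prop :=
  forall i j, is_derive t 1 (fun s => Y s i j) (D i j).

Lemma dmx_cst p q (A : 'M[R]_(p, q)) t : dmx (fun=> A) t 0.
Proof. by move=> i j; rewrite mxE; exact: is_derive_cst. Qed.

Lemma is_derive_mul (f g : R -> R) (t df dg : R) :
  is_derive t 1 f df -> is_derive t 1 g dg ->
  is_derive t 1 (fun s => f s * g s) (df * g t + f t * dg).
Proof.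
move=> hf hg; by apply: is_derive_eq; rewrite addrC [_ *: df]mulrC.
Qed.

Lemma is_derive_add (f g : R -> R) (t df dg : R) :
  is_derive t 1 f df -> is_derive t 1 g dg ->
  is_derive t 1 (fun s => f s + g s) (df + dg).
Proof. by move=> hf hg; exact: (is_deriveD hf hg). Qed.

Lemma is_derive_bigsum (I : Type) (s : seq I) (f : I -> R -> R) (df : I -> R) t :
  (forall i, is_derive t 1 (f i) (df i)) ->
  is_derive t 1 (fun x => \sum_(i <- s) f i x) (\sum_(i <- s) df i).
Proof.
move=> hf; elim: s => [|i s IH].
  by rewrite big_nil; under eq_fun do rewrite big_nil; exact: is_derive_cst.
by rewrite big_cons; under eq_fun do rewrite big_cons; exact: is_derive_add.
Qed.

Lemma dmxM p q r (A : R -> 'M[R]_(p, q)) (B : R -> 'M[R]_(q, r)) t DA DB :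
  dmx A t DA -> dmx B t DB ->
  dmx (fun s => A s *m B s) t (DA *m B t + A t *m DB).
Proof.
move=> dA dB i j; rewrite !mxE -big_split /=; under eq_fun do rewrite mxE.
by apply: is_derive_bigsum => k; exact: is_derive_mul.
Qed.

Lemma dmxD p q (A B : R -> 'M[R]_(p, q)) t DA DB :
  dmx A t DA -> dmx B t DB -> dmx (fun s => A s + B s) t (DA + DB).
Proof.
move=> dA dB i j; rewrite !mxE; under eq_fun do rewrite mxE.
exact: is_derive_add.
Qed.

End MatrixDerivatives.

Section Cone.
Variables (R : realType) (n : nat).
Local Notation M2 := 'M[R]_(n + n).
Local Notation J := (Jmat R n).
Implicit Types (X Y Z : R -> M2) (H : M2).

Lemma psdD H H' : psd H -> psd H' -> psd (H + H').
Proof.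
move=> [sH pH] [sH' pH']; split; first by rewrite linearD /= sH sH'.
by move=> v; rewrite mulmxDr mulmxDl mxE addr_ge0.
Qed.

Lemma psd_congr H (A : M2) : psd H -> psd (A^T *m H *m A).
Proof.
move=> [sH pH]; split; first by rewrite !trmx_mul trmxK sH mulmxA.
by move=> v; have := pH (A *m v); rewrite trmx_mul !mulmxA.
Qed.

(** The Hamiltonian of a product is H_X + X^-T H_Y X^-1, a sum of a semidefinite matrix and a
    congruent of another. *)
Lemma psd_hamiltonian_pmul X Y : psd_hamiltonian_path X -> psd_hamiltonian_path Y ->
  psd_hamiltonian_path (pmul X Y).
Proof.
move=> [pX [DX hX]] [pY [DY hY]]; split; first exact: is_path_pmul.
exists (fun t => DX t *m Y t + X t *m DY t) => t tI.
have [dX HX] := hX t tI; have [dY HY] := hY t tI.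
have t01 : 0 <= t <= 1 by move: tI; rewrite /I01 /= in_itv.
have sX := is_path_symplectic pX t01; have uX := symplectic_unitmx sX.
have uY := is_path_unit pY t01.
split; first exact: dmxM.
have -> : - (J *m (DX t *m Y t + X t *m DY t) *m invmx (pmul X Y t)) =
  - (J *m DX t *m invmx (X t)) +
  (invmx (X t))^T *m (- (J *m DY t *m invmx (Y t))) *m invmx (X t).
  rewrite /pmul invmx_mul // mulmxDr mulmxDl opprD; congr (_ + _).
    by congr (- _); rewrite -!mulmxA; congr (_ *m (_ *m _)); rewrite mulmxA mulmxV ?mul1mx.
  by rewrite mulmxN mulNmx; congr (- _); rewrite !mulmxA (mul_symplectic_J sX).
by apply: psdD => //; exact: psd_congr.
Qed.

Lemma psd_hamiltonian_conj X (A : M2) : symplectic A -> psd_hamiltonian_path X ->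
  psd_hamiltonian_path (fun t => A *m X t *m invmx A).
Proof.
move=> sA [pX [DX hX]]; have uA := symplectic_unitmx sA.
have /is_path_clamp[X0 sX cX] := pX.
split.
  apply: (@is_path_eq _ _ (fun t => A *m X (clamp t) *m invmx A)).
    apply: is_pathI.
    - by rewrite X0 mulmx1 mulmxV.
    - by move=> t; exact: (symplecticM (symplecticM sA (sX t)) (symplecticV sA)).
    - by apply: cmxM; [apply: cmxM; [exact: cmx_cst | exact: cX] | exact: cmx_cst].
  by move=> t /clamp_id ->.
exists (fun t => A *m DX t *m invmx A) => t tI.
have [dX HX] := hX t tI.
have t01 : 0 <= t <= 1 by move: tI; rewrite /I01 /= in_itv.
have uX := is_path_unit pX t01.
split.
  have := dmxM (dmxM (dmx_cst A t) dX) (dmx_cst (invmx A) t).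
  by rewrite mul0mx add0r mulmx0 addr0.
have -> : - (J *m (A *m DX t *m invmx A) *m invmx (A *m X t *m invmx A)) =
  (invmx A)^T *m (- (J *m DX t *m invmx (X t))) *m invmx A.
  rewrite !invmx_mul ?unitmx_mul ?uA ?unitmx_inv // invmxK.
  rewrite mulmxN mulNmx; congr (- _).
  by rewrite !mulmxA (mulmxKV uA) (mul_symplectic_J sA).
exact: psd_congr.
Qed.

Lemma in_coneI X : psd_hamiltonian_path X -> in_cone X.
Proof. by move=> hX; have [pX _] := hX; split => //; exists X; split => //; exact: homotopic_refl. Qed.

Lemma in_cone_homotopic Y X : homotopic X Y -> in_cone Y -> in_cone X.
Proof.
move=> XY [pY [Z [hZ YZ]]]; split; first exact: homotopic_path XY.
by exists Z; split => //; exact: homotopic_trans XY YZ.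
Qed.

Lemma in_cone_pmul X Y : in_cone X -> in_cone Y -> in_cone (pmul X Y).
Proof.
move=> [pX [X' [hX XX']]] [pY [Y' [hY YY']]].
apply: (in_cone_homotopic (homotopic_pmul XX' YY')).
by apply: in_coneI; exact: psd_hamiltonian_pmul.
Qed.

(** A moving Z would contribute to the Hamiltonian with no control of sign; [homotopic_conj] freezes
    it at its endpoint, where conjugation is a congruence of the Hamiltonian. *)
Lemma in_cone_conj X Z : in_cone X -> is_path Z -> in_cone (pmul (pmul Z X) (pinv Z)).
Proof.
move=> [pX [X' [hX XX']]] pZ; have pX' : is_path X' by case: hX.
have hZ := homotopic_refl pZ.
apply: (in_cone_homotopic (homotopic_pmul (homotopic_pmul hZ XX') (homotopic_pinv hZ))).
apply: (in_cone_homotopic (homotopic_conj pX' pZ)); apply: in_coneI.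
apply: psd_hamiltonian_conj => //.
by apply: (is_path_symplectic pZ); rewrite ler01 lexx.
Qed.

End Cone.

(** * Complex structure *)

Section ComplexStructure.
Variables (R : realType) (n : nat).
Local Notation M2 := 'M[R]_(n + n).
Local Notation MC := 'M[R[i]]_n.
Local Notation J := (Jmat R n).
Local Notation toC := (map_mx (real_complex R)).
Implicit Types (M N U V : M2) (A B : MC).

Definition commJ M : Prop := M *m J = J *m M.

(** Only the first block column is read, which determines M when M commutes with J; [rlm] is then
    the inverse. *)
Definition cxm M : MC := \matrix_(i < n, j < n) Complex (ulsubmx M i j) (dlsubmx M i j).

Definition rlm A : M2 :=
  block_mx (map_mx (@complex.Re R) A) (- map_mx (@complex.Im R) A)
           (map_mx (@complex.Im R) A) (map_mx (@complex.Re R) A).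

Definition adj A : MC := map_mx (@conjc R) A^T.

Lemma detCE M : detC M = \det (cxm M).
Proof. by []. Qed.

Lemma cxmE M : cxm M = toC (ulsubmx M) + 'i%C *: toC (dlsubmx M).
Proof.
apply/matrixP => i j; rewrite !mxE; apply/eqP; rewrite eq_complex /=.
by apply/andP; split; apply/eqP; ring.
Qed.

Lemma commJP M : commJ M ->
  M = block_mx (ulsubmx M) (- dlsubmx M) (dlsubmx M) (ulsubmx M).
Proof.
rewrite /commJ /Jmat -{1 2}(submxK M) !mulmx_block.
rewrite !(mulmx0, mul0mx, mulmx1, mul1mx, mulNmx, mulmxN, add0r, addr0).
move=> /eq_block_mx[e1 e2 e3 e4].
by rewrite -{1}(submxK M) e1 -e3.
Qed.

Lemma rlm_commJ A : commJ (rlm A).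
Proof.
rewrite /commJ /Jmat /rlm !mulmx_block.
by rewrite !(mulmx0, mul0mx, mulmx1, mul1mx, mulNmx, mulmxN, add0r, addr0).
Qed.

Lemma rlmK A : cxm (rlm A) = A.
Proof.
apply/matrixP => i j; rewrite mxE /rlm block_mxKul block_mxKdl !mxE.
by case: (A i j).
Qed.

Lemma cxmK M : commJ M -> rlm (cxm M) = M.
Proof.
move=> /commJP MJ; rewrite [RHS]MJ /rlm.
have -> : map_mx (@complex.Re R) (cxm M) = ulsubmx M by apply/matrixP => i j; rewrite !mxE.
by have -> : map_mx (@complex.Im R) (cxm M) = dlsubmx M by apply/matrixP => i j; rewrite !mxE.
Qed.

(** The first block column of M N is M applied to that of N, so complex linearity of the left factor
    suffices. *)
Lemma cxmM M N : commJ M -> cxm (M *m N) = cxm M *m cxm N.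
Proof.
move=> /commJP MJ; rewrite !cxmE.
set a := ulsubmx M in MJ *; set b := dlsubmx M in MJ *.
have -> : M *m N = block_mx a (- b) b a *m
    block_mx (ulsubmx N) (ursubmx N) (dlsubmx N) (drsubmx N) by rewrite -MJ submxK.
rewrite mulmx_block block_mxKul block_mxKdl.
rewrite !map_mxD !map_mxM map_mxN mulmxDl !mulmxDr.
rewrite -!scalemxAl -!scalemxAr scalerA -expr2 sqr_i scaleN1r scalerDr mulNmx.
rewrite -!addrA; apply: (congr1 (+%R _)).
by rewrite addrC -addrA addrCA.
Qed.

Lemma rlmM A B : rlm (A *m B) = rlm A *m rlm B.
Proof.
have cAB : commJ (rlm A *m rlm B).
  by rewrite /commJ -mulmxA rlm_commJ !mulmxA rlm_commJ.
by rewrite -(cxmK cAB) cxmM ?rlmK //; exact: rlm_commJ.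
Qed.

Lemma commJ1 : commJ 1%:M.
Proof. by rewrite /commJ mulmx1 mul1mx. Qed.

Lemma cxm1 : cxm 1%:M = 1%:M.
Proof.
apply/matrixP => i j; rewrite mxE !(scalar_mx_block n n) block_mxKul block_mxKdl !mxE.
by case: (i == j).
Qed.

Lemma rlm1 : rlm 1%:M = 1%:M.
Proof. by rewrite -cxm1 cxmK //; exact: commJ1. Qed.

Lemma rlm_adj A : rlm (adj A) = (rlm A)^T.
Proof.
rewrite /rlm tr_block_mx; congr block_mx; apply/matrixP => i j; rewrite !mxE.
- by case: (A j i).
- by case: (A j i) => x y /=; rewrite opprK.
- by case: (A j i).
- by case: (A j i).
Qed.

Lemma commJT M : commJ M -> commJ M^T.
Proof.
move=> /(congr1 trmx); rewrite !trmx_mul trmx_Jmat mulNmx mulmxN.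
by move=> /oppr_inj.
Qed.

Lemma commJM M N : commJ M -> commJ N -> commJ (M *m N).
Proof. by rewrite /commJ => cM cN; rewrite -mulmxA cN !mulmxA cM. Qed.

Lemma commJD M N : commJ M -> commJ N -> commJ (M + N).
Proof. by rewrite /commJ => cM cN; rewrite mulmxDl mulmxDr cM cN. Qed.

Lemma commJN M : commJ M -> commJ (- M).
Proof. by rewrite /commJ => cM; rewrite mulmxN mulNmx cM. Qed.

Lemma commJZ (c : R) M : commJ M -> commJ (c *: M).
Proof. by rewrite /commJ => cM; rewrite -scalemxAr -scalemxAl cM. Qed.

Lemma commJV M : commJ M -> commJ (invmx M).
Proof.
move=> cM; case: (boolP (M \in unitmx)) => uM; last by rewrite /invmx (negbTE uM).
by rewrite /commJ -[RHS](mulKmx uM) (mulmxA M) cM -mulmxA mulmxV // mulmx1.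
Qed.

Lemma cxmT M : commJ M -> cxm M^T = adj (cxm M).
Proof.
by move=> cM; rewrite -[in LHS](cxmK cM) -rlm_adj rlmK.
Qed.

Lemma detC1 : detC (1%:M : M2) = 1.
Proof. by rewrite detCE cxm1 det1. Qed.

Lemma detCM M N : commJ M -> detC (M *m N) = detC M * detC N.
Proof. by move=> cM; rewrite !detCE cxmM // det_mulmx. Qed.

Lemma detCT M : commJ M -> detC M^T = (detC M)^*%C.
Proof.
by move=> cM; rewrite !detCE cxmT // /adj -map_trmx det_tr det_map_mx.
Qed.

Definition unitary U : Prop := U^T *m U = 1%:M /\ commJ U.

Lemma unitaryVr U : unitary U -> U *m U^T = 1%:M.
Proof. by move=> [/mulmx1C]. Qed.

Lemma unitary1 : unitary 1%:M.
Proof. by split; [rewrite trmx1 mul1mx | exact: commJ1]. Qed.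

(** Among orthogonal, symplectic and J-linear, any two imply the third; this lemma and the next give
    the two instances used. *)
Lemma unitary_symplectic U : unitary U -> symplectic U.
Proof. by move=> [oU cU]; rewrite /symplectic -mulmxA -cU mulmxA oU mul1mx. Qed.

Lemma symplectic_unitary U : U^T *m U = 1%:M -> symplectic U -> unitary U.
Proof.
move=> oU sU; split => //; rewrite /commJ -{1}sU !mulmxA.
by rewrite (mulmx1C oU) mul1mx.
Qed.

Lemma unitaryM U V : unitary U -> unitary V -> unitary (U *m V).
Proof.
move=> [oU cU] [oV cV]; split; last exact: commJM.
by rewrite trmx_mul -mulmxA (mulmxA U^T) oU mul1mx.
Qed.

Lemma unitary_unitmx U : unitary U -> U \in unitmx.
Proof. by move=> /unitary_symplectic /symplectic_unitmx. Qed.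

Lemma unitary_invmx U : unitary U -> invmx U = U^T.
Proof.
move=> uU; rewrite -[RHS]mulmx1 -(mulmxV (unitary_unitmx uU)) mulmxA.
by case: uU => -> _; rewrite mul1mx.
Qed.

Lemma rlm_unitary A : adj A *m A = 1%:M -> unitary (rlm A).
Proof.
by move=> uA; split; [rewrite -rlm_adj -rlmM uA rlm1 | exact: rlm_commJ].
Qed.

Definition cis (x : R) : R[i] := Complex (cos x) (sin x).

Lemma cisD x y : cis (x + y) = cis x * cis y.
Proof.
rewrite /cis cosD sinD; apply/eqP; rewrite eq_complex /= eqxx /= addrC.
by rewrite [cos x * _]mulrC.
Qed.

Lemma cis0 : cis 0 = 1.
Proof. by rewrite /cis cos0 sin0. Qed.

Lemma cisNr x : cis x * (cis x)^*%C = 1.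
Proof.
apply/eqP; rewrite eq_complex /=; apply/andP; split; apply/eqP.
  by rewrite -[RHS](cos2Dsin2 x); ring.
by ring.
Qed.

Lemma cisN x : cis (- x) = (cis x)^*%C.
Proof. by rewrite /cis cosN sinN. Qed.

Lemma cis_surj (z : R[i]) : z * z^*%C = 1 -> exists x, z = cis x.
Proof.
case: z => a b /eqP; rewrite eq_complex /= => /andP[/eqP e _].
have {}e : a ^+ 2 + b ^+ 2 = 1 by rewrite -e; ring.
have a1 : -1 <= a <= 1 by apply/andP; split; nra.
have b2 : b ^+ 2 = 1 - a ^+ 2 by rewrite -e; ring.
have [b0|b0] := leP 0 b.
  exists (acos a); rewrite /cis acosK ?in_itv //= sin_acos //.
  by rewrite -b2 sqrtr_sqr ger0_norm.
exists (- acos a); rewrite /cis cosN sinN acosK ?in_itv //= sin_acos //.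
by rewrite -b2 sqrtr_sqr ltr0_norm // opprK.
Qed.

Definition torus (psi : 'I_n -> R) : M2 :=
  rlm (diag_mx (\row_j cis (psi j))).

Lemma torusD psi phi : torus (fun j => psi j + phi j) = torus psi *m torus phi.
Proof.
rewrite /torus -rlmM mulmx_diag; congr rlm; congr diag_mx.
by apply/matrixP => i j; rewrite !mxE cisD.
Qed.

Lemma torus0 : torus (fun=> 0) = 1%:M.
Proof.
rewrite /torus -[RHS]rlm1; congr rlm; apply/matrixP => i j.
by rewrite !mxE cis0.
Qed.

Lemma torus_unitary psi : unitary (torus psi).
Proof.
apply: rlm_unitary; rewrite /adj tr_diag_mx map_diag_mx mulmx_diag.
apply/matrixP => i j; rewrite !mxE mulrC cisNr.
by case: eqP.
Qed.

Lemma detC_torus psi : detC (torus psi) = cis (\sum_j psi j).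
Proof.
rewrite detCE rlmK det_diag; elim/big_rec2: _ => [|j y x _ ->]; first by rewrite cis0.
by rewrite mxE cisD.
Qed.

End ComplexStructure.

(** * Spectral theory *)

Section Spectral.
Variables (R : realType).
Local Notation toC := (map_mx (real_complex R)).

Lemma adjE n (A : 'M[R[i]]_n) : adj A = map_mx Num.conj A^T.
Proof. by []. Qed.

Lemma unitarymx_adj n (P : 'M[R[i]]_n) : P \is unitarymx -> adj P *m P = 1%:M.
Proof. by move=> /unitarymxP; rewrite adjE => /mulmx1C. Qed.

Lemma adjM n (A B : 'M[R[i]]_n) : adj (A *m B) = adj B *m adj A.
Proof. by rewrite /adj trmx_mul map_mxM. Qed.

Lemma adjK n (A : 'M[R[i]]_n) : adj (adj A) = A.
Proof. by apply/matrixP => i j; rewrite !mxE conjcK. Qed.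

(** Complex spectral theorem for the normal matrix [cxm U]. The angles are chosen matrix by matrix,
    with no continuity along a path; the Cayley charts make up for this. *)
Lemma unitary_diag n (U : 'M[R]_(n + n)) : unitary U ->
  exists V psi, unitary V /\ U = V *m torus psi *m V^T.
Proof.
move=> [oU cU]; set A := cxm U.
have aA : adj A *m A = 1%:M by rewrite /A -cxmT // -cxmM ?oU ?cxm1 //; exact: commJT.
have : A \is normalmx by apply/normalmxP; rewrite -!adjE aA (mulmx1C aA).
move=> /orthomx_spectralP; set P := spectralmx A; set d := spectral_diag A => eA.
have uP : P \is unitarymx := spectral_unitarymx A.
have PP := unitarymx_adj uP.
move: eA; rewrite (invmx_unitary uP) -adjE => eA.
have : adj (diag_mx d) *m diag_mx d = 1%:M.
  have -> : diag_mx d = P *m A *m adj P.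
    by rewrite eA !mulmxA (mulmx1C PP) mul1mx -mulmxA (mulmx1C PP) mulmx1.
  rewrite !adjM adjK !mulmxA -(mulmxA _ (adj P) P) PP mulmx1 -(mulmxA _ _ A) aA mulmx1.
  by rewrite (mulmx1C PP).
rewrite /adj tr_diag_mx map_diag_mx mulmx_diag => /matrixP dd.
have /choice[psi psiP] : forall j : 'I_n, exists x, d 0 j = cis x.
  move=> j; apply: cis_surj; have := dd j j.
  by rewrite !mxE eqxx mulr1n mulrC.
exists (rlm (adj P)), psi; split; first by apply: rlm_unitary; rewrite adjK (mulmx1C PP).
have de : d = \row_j cis (psi j) by apply/rowP => j; rewrite mxE psiP.
by rewrite -rlm_adj adjK /torus -!rlmM -de -eA (cxmK cU).
Qed.

(** Newton interpolation, one node at a time. It lets a function of a real symmetric matrix be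
    realized as a real polynomial in it, although the diagonalization is complex. *)
Lemma interpolation (s : seq R) (f : R -> R) :
  exists p : {poly R}, forall x, x \in s -> p.[x] = f x.
Proof.
elim: s => [|x s [p pP]]; first by exists 0.
case xs : (x \in s).
  by exists p => y; rewrite inE => /orP[/eqP ->|]; exact: pP.
pose q := \prod_(y <- s) ('X - y%:P).
have qx : q.[x] != 0.
  by rewrite -[_ == 0]/(root q x) root_prod_XsubC xs.
exists (p + ((f x - p.[x]) / q.[x])%:P * q) => y; rewrite inE => /orP[/eqP ->|ys].
  by rewrite !hornerE divfK // addrC subrK.
have /eqP q0 : root q y by rewrite root_prod_XsubC.
by rewrite !hornerE q0 mulr0 addr0 pP.
Qed.

Definition spd m (A : 'M[R]_m) : Prop :=
  A^T = A /\ forall v : 'cV[R]_m, v != 0 -> 0 < (v^T *m A *m v) 0 0.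

Definition polymx m (p : {poly R}) (A : 'M[R]_m) : 'M[R]_m :=
  \sum_(k < size p) p`_k *: A ^+ k.

Lemma polymx_tr m p (A : 'M[R]_m) : A^T = A -> (polymx p A)^T = polymx p A.
Proof.
move=> sA; rewrite /polymx linear_sum; apply: eq_bigr => k _; rewrite linearZ /=.
congr (_ *: _); elim: (val k) => [|l IH]; first by rewrite expr0 trmx1.
by rewrite {1}exprS -mulmxE trmx_mul IH sA exprSr.
Qed.

Lemma polymx_comm m p (A B : 'M[R]_m) : A *m B = B *m A ->
  polymx p A *m B = B *m polymx p A.
Proof.
move=> cAB; rewrite /polymx mulmx_suml mulmx_sumr; apply: eq_bigr => k _.
rewrite -scalemxAl -scalemxAr; congr (_ *: _).
elim: (val k) => [|l IH]; first by rewrite expr0 mul1mx mulmx1.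
by rewrite exprS -mulmxE -mulmxA IH !mulmxA cAB.
Qed.

Lemma conj_diagM (F : comNzRingType) m (P P' : 'M[F]_m) (a b : 'rV_m) :
  P *m P' = 1%:M ->
  P' *m diag_mx a *m P *m (P' *m diag_mx b *m P) =
  P' *m diag_mx (\row_j (a 0 j * b 0 j)) *m P.
Proof.
by move=> PP; rewrite !mulmxA -(mulmxA _ P P') PP mulmx1 -(mulmxA _ (diag_mx a)) mulmx_diag.
Qed.

Lemma dotE m (v : 'cV[R]_m) : (v^T *m v) 0 0 = \sum_k v k 0 ^+ 2.
Proof. by rewrite mxE; apply: eq_bigr => k _; rewrite mxE expr2. Qed.

Lemma dot_ge0 m (v : 'cV[R]_m) : 0 <= (v^T *m v) 0 0.
Proof. by rewrite dotE sumr_ge0 // => k _; rewrite sqr_ge0. Qed.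

Lemma dot_gt0 m (v : 'cV[R]_m) : v != 0 -> 0 < (v^T *m v) 0 0.
Proof.
move=> v0; rewrite lt_neqAle eq_sym dot_ge0 andbT.
apply: contra v0; rewrite dotE psumr_eq0 => [/allP z|k _]; last exact: sqr_ge0.
apply/eqP/matrixP => k l; rewrite ord1 mxE.
by have := z k (mem_index_enum _); rewrite sqrf_eq0 => /eqP.
Qed.

(** A kernel vector would make the quadratic form vanish. The form of the statement also covers 1 -
    K with K skew-symmetric. *)
Lemma posdef_unitmx m (A : 'M[R]_m) :
  (forall v : 'cV[R]_m, v != 0 -> 0 < (v^T *m A *m v) 0 0) -> A \in unitmx.
Proof.
move=> pA; rewrite -row_free_unit -kermx_eq0; apply/eqP/row_matrixP => i.
rewrite row0; apply/eqP; apply/negP => /negP r0.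
have : (row i (kermx A))^T != 0 by rewrite -trmx0 (inj_eq trmx_inj).
move=> /pA; rewrite trmxK.
have -> : row i (kermx A) *m A = 0 by rewrite -row_mul mulmx_ker row0.
by rewrite mul0mx mxE ltxx.
Qed.

Lemma spd_unitmx m (A : 'M[R]_m) : spd A -> A \in unitmx.
Proof. by move=> [_ pA]; exact: posdef_unitmx. Qed.

Lemma diag_mxX m (d : 'rV[R[i]]_m) k :
  diag_mx d ^+ k = diag_mx (\row_j d 0 j ^+ k).
Proof.
elim: k => [|k IH].
  by rewrite expr0; apply/matrixP => i j; rewrite !mxE expr0.
rewrite exprS -mulmxE IH mulmx_diag; congr diag_mx.
by apply/matrixP => i j; rewrite !mxE exprS.
Qed.

(* Over [R[i]] a real symmetric matrix is unitarily diagonal with a nonnegative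
   spectrum; a real interpolation polynomial of the fourth root then yields a real root. *)
Lemma spd_sqrt m (A : 'M[R]_m) : spd A -> exists Q : 'M[R]_m,
  [/\ spd Q, Q *m Q = A & forall B, A *m B = B *m A -> Q *m B = B *m Q].
Proof.
move=> pA; have [sA posA] := pA; have uA := spd_unitmx pA.
pose AC := toC A.
have aAC : adj AC = AC by apply/matrixP => i j; rewrite !mxE conjc_real -{1}sA mxE.
have : AC \is normalmx by apply/normalmxP; rewrite -!adjE aAC.
move=> /orthomx_spectralP; set P := spectralmx AC; set d := spectral_diag AC => eA.
have uP : P \is unitarymx := spectral_unitarymx AC.
have PP := unitarymx_adj uP.
move: eA; rewrite (invmx_unitary uP) -adjE => eA.
have dE : diag_mx d = P *m AC *m adj P.
  by rewrite eA !mulmxA (mulmx1C PP) mul1mx -mulmxA (mulmx1C PP) mulmx1.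
have /choice[r rP] : forall j : 'I_m, exists r : R, 0 <= r /\ d 0 j = (r%:C)%C.
  move=> j.
  (* If x + i y is the j-th row of P, then d_j = x A x^T + y A y^T, the cross terms cancelling
     because A is symmetric. *)
  pose x := map_mx (@complex.Re R) (row j P); pose y := map_mx (@complex.Im R) (row j P).
  have sxy (u v : 'rV[R]_m) : (u *m A *m v^T) 0 0 = (v *m A *m u^T) 0 0.
    have -> : v *m A *m u^T = (u *m A *m v^T)^T by rewrite !trmx_mul trmxK sA mulmxA.
    by rewrite [RHS]mxE.
  have psdA (u : 'rV[R]_m) : 0 <= (u *m A *m u^T) 0 0.
    have [->|u0] := eqVneq u 0; first by rewrite !mul0mx mxE.
    apply: ltW; have := posA u^T; rewrite trmxK; apply.
    by rewrite -trmx0 (inj_eq trmx_inj).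
  exists ((x *m A *m x^T) 0 0 + (y *m A *m y^T) 0 0); split; first exact: addr_ge0.
  have -> : d 0 j = (diag_mx d) j j by rewrite mxE eqxx mulr1n.
  have rowP : row j P = toC x + 'i%C *: toC y.
    by apply/matrixP => a b; rewrite !mxE [LHS]complexE.
  have conjP : map_mx (@conjc R) (row j P) = toC x - 'i%C *: toC y.
    apply/matrixP => a b; rewrite !mxE; case: (P j b) => u w.
    by apply/eqP; rewrite eq_complex /=; apply/andP; split; apply/eqP; ring.
  have -> : diag_mx d j j = (row j P *m AC *m (map_mx (@conjc R) (row j P))^T) 0 0.
    rewrite dE mxE [RHS]mxE; apply: eq_bigr => k _.
    by rewrite -row_mul [in RHS]mxE; congr (_ * _); rewrite !mxE.
  have E (u v : 'rV[R]_m) : toC u *m AC *m (toC v)^T = toC (u *m A *m v^T).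
    by rewrite !map_mxM map_trmx.
  rewrite conjP rowP mulmxDl linearB linearZ /= mulmxBr !mulmxDl.
  rewrite -!scalemxAr -!scalemxAl scalerA -expr2 sqr_i !E.
  have := sxy y x.
  generalize (x *m A *m x^T) (y *m A *m x^T) (x *m A *m y^T) (y *m A *m y^T).
  move=> a b c e bc; rewrite !mxE bc; apply/eqP; rewrite eq_complex /=.
  by apply/andP; split; apply/eqP; ring.
(* A symmetric fourth root S suffices: S S is positive definite because v^T S S v = |S v|^2. Being a
   polynomial in A, S commutes with whatever commutes with A. *)
have [p pP] := interpolation (codom r) (fun t => Num.sqrt (Num.sqrt t)).
pose S := polymx p A; pose s := \row_j ((Num.sqrt (Num.sqrt (r j)))%:C)%C.
have SC : toC S = adj P *m diag_mx s *m P.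
  have AX k : toC (A ^+ k) = adj P *m (diag_mx d ^+ k) *m P.
    elim: k => [|k IH]; first by rewrite !expr0 mulmx1 PP map_mx1.
    rewrite !exprS -!mulmxE map_mxM IH -/AC {1}eA !mulmxA.
    by rewrite -(mulmxA _ P (adj P)) (mulmx1C PP) mulmx1.
  rewrite /S /polymx raddf_sum /=.
  under eq_bigr do rewrite map_mxZ AX diag_mxX scalemxAl scalemxAr.
  rewrite -mulmx_suml -mulmx_sumr; congr (_ *m _ *m _).
  apply/matrixP => i j; rewrite summxE !mxE.
  case: eqP => [->|ij]; last first.
    by rewrite mulr0n big1 // => k _; rewrite !mxE (introF eqP ij) mulr0n mulr0.
  rewrite mulr1n -pP ?codom_f // horner_coef rmorph_sum; apply: eq_bigr => k _.
  by rewrite !mxE eqxx mulr1n; have [_ ->] := rP j; rewrite rmorphM rmorphXn.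
have S4 : S *m S *m (S *m S) = A.
  apply: (map_mx_inj (f := real_complex R)).
  rewrite !map_mxM SC -/AC eA.
  rewrite !(conj_diagM _ _ (mulmx1C PP)).
  have -> : \row_j ((\row_j (s 0 j * s 0 j)) 0 j * (\row_j (s 0 j * s 0 j)) 0 j) = d.
    apply/rowP => j; rewrite !mxE; have [r0 ->] := rP j.
    by rewrite -!rmorphM -!expr2 !sqr_sqrtr ?sqrtr_ge0.
  reflexivity.
have sS : S^T = S by exact: polymx_tr.
have uS : S \in unitmx.
  by move: uA; rewrite -S4 !unitmx_mul => /andP[/andP[]].
exists (S *m S); split => //.
  split => [|v v0]; first by rewrite trmx_mul sS.
  have Sv0 : S *m v != 0.
    by apply: contra v0 => /eqP /(congr1 (mulmx (invmx S))); rewrite mulKmx // mulmx0 => ->.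
  have -> : v^T *m (S *m S) *m v = (S *m v)^T *m (S *m v) by rewrite trmx_mul sS !mulmxA.
  exact: dot_gt0.
move=> B cB; have cS := polymx_comm p cB.
by rewrite -mulmxA cS !mulmxA cS.
Qed.

End Spectral.

(** * Square roots and polar decomposition *)

Section SquareRoot.
Variables (R : realType).

Definition sqsum p q (M : 'M[R]_(p, q)) : R := \sum_i \sum_j M i j ^+ 2.

Lemma sqsum_ge0 p q (M : 'M[R]_(p, q)) : 0 <= sqsum M.
Proof. by apply: sumr_ge0 => i _; apply: sumr_ge0 => j _; exact: sqr_ge0. Qed.

Lemma sqr_le_sqsum p q (M : 'M[R]_(p, q)) i j : M i j ^+ 2 <= sqsum M.
Proof.
rewrite /sqsum (bigD1 i) //= (bigD1 j) //= -addrA lerDl.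
by rewrite addr_ge0 // sumr_ge0 // => k _; rewrite ?sqr_ge0 // sumr_ge0 // => l _; exact: sqr_ge0.
Qed.

(** Lagrange's identity: twice the defect is the sum of the squares of a_i b_j - a_j b_i. *)
Lemma cauchy_schwarz m (a b : 'I_m -> R) :
  (\sum_i a i * b i) ^+ 2 <= (\sum_i a i ^+ 2) * (\sum_i b i ^+ 2).
Proof.
have : 0 <= \sum_i \sum_j (a i * b j - a j * b i) ^+ 2.
  by apply: sumr_ge0 => i _; apply: sumr_ge0 => j _; exact: sqr_ge0.
have -> : \sum_i \sum_j (a i * b j - a j * b i) ^+ 2 =
  (\sum_i a i ^+ 2) * (\sum_i b i ^+ 2) *+ 2 - (\sum_i a i * b i) ^+ 2 *+ 2.
  transitivity (\sum_i \sum_j (a i ^+ 2 * b j ^+ 2) + \sum_i \sum_j (b i ^+ 2 * a j ^+ 2)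
     - (\sum_i \sum_j (a i * b i) * (a j * b j)) *+ 2).
    rewrite -sumrMnl -!big_split /= -sumrB; apply: eq_bigr => i _.
    by rewrite -sumrMnl -!big_split /= -sumrB; apply: eq_bigr => j _; ring.
  by rewrite -!big_distrlr /=; ring.
by rewrite subr_ge0 lerMn2r.
Qed.

Lemma dot_mulmx_le p q (M : 'M[R]_(p, q)) (w : 'cV[R]_q) :
  ((M *m w)^T *m (M *m w)) 0 0 <= sqsum M * (w^T *m w) 0 0.
Proof.
rewrite !dotE /sqsum mulr_suml; apply: ler_sum => i _; rewrite mxE.
exact: cauchy_schwarz.
Qed.

(** With S the root of A, v = S^-1 (S v) and |S v|^2 = v^T A v, so the Frobenius norm of S^-1 gives
    the constant. *)
Lemma spd_lower_bound m (A : 'M[R]_m) : spd A ->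
  exists2 c, 0 < c & forall v : 'cV[R]_m, c * (v^T *m v) 0 0 <= (v^T *m A *m v) 0 0.
Proof.
move=> /spd_sqrt[S [pS <- _]]; have uS := spd_unitmx pS.
(* The summand 1 keeps the constant invertible, even for matrices of size 0. *)
have k0 : 0 < sqsum (invmx S) + 1 by rewrite ltr_wpDl // sqsum_ge0.
exists (sqsum (invmx S) + 1)^-1; first by rewrite invr_gt0.
move=> v; rewrite ler_pdivrMl //.
have -> : v^T *m (S *m S) *m v = (S *m v)^T *m (S *m v).
  by case: pS => sS _; rewrite trmx_mul sS !mulmxA.
rewrite -{1 2}(mulKmx uS v); apply: le_trans (dot_mulmx_le _ _) _.
by rewrite ler_wpM2r ?dot_ge0 // lerDl.
Qed.

Lemma mxtrace_congr m (D X : 'M[R]_m) :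
  \tr (D^T *m X *m D) = \sum_j ((col j D)^T *m X *m col j D) 0 0.
Proof.
apply: eq_bigr => j _; rewrite mxE [RHS]mxE; apply: eq_bigr => k _.
rewrite [col _ _ k 0]mxE; congr (_ * _); rewrite !mxE.
by apply: eq_bigr => l _; rewrite !mxE.
Qed.

Lemma sqsum_col m (D : 'M[R]_m) : sqsum D = \sum_j ((col j D)^T *m col j D) 0 0.
Proof.
rewrite /sqsum exchange_big; apply: eq_bigr => j _; rewrite dotE.
by apply: eq_bigr => i _; rewrite mxE.
Qed.

(* With [D = X - Y], [tr (D (X + Y) D) = tr (D (X^2 - Y^2))]. *)
Lemma sqsum_sub_sqrt m (X Y : 'M[R]_m) c : 0 < c ->
  (forall v : 'cV[R]_m, c * (v^T *m v) 0 0 <= (v^T *m X *m v) 0 0) ->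
  X^T = X -> spd Y ->
  sqsum (X - Y) <= sqsum (X *m X - Y *m Y) / c ^+ 2.
Proof.
move=> c0 cX sX [sY pY]; set D := X - Y; set E := X *m X - Y *m Y.
have sD : D^T = D by rewrite /D linearB /= sX sY.
have psdY (v : 'cV[R]_m) : 0 <= (v^T *m Y *m v) 0 0.
  have [->|v0] := eqVneq v 0; first by rewrite mulmx0 mxE.
  exact: ltW (pY _ v0).
have trDE : \tr (D^T *m X *m D) + \tr (D^T *m Y *m D) = \tr (D *m E).
  rewrite sD [\tr (D *m Y *m D)]mxtrace_mulC -linearD /=; congr (\tr _).
  rewrite /E -mulmxA -mulmxDr; congr (_ *m _).
  by rewrite /D mulmxBr mulmxBl addrA subrK.
have lo : c * sqsum D <= \tr (D *m E).
  rewrite -trDE -[leLHS]addr0 lerD //.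
    by rewrite sqsum_col mxtrace_congr mulr_sumr; apply: ler_sum => j _; exact: cX.
  by rewrite mxtrace_congr sumr_ge0 // => j _; exact: psdY.
(* Young's inequality, from (c D_kj - E_kj)^2 >= 0, weighted so that half of the lower bound c |D|^2
   absorbs the first term. *)
have hi : \tr (D *m E) <= c / 2 * sqsum D + sqsum E / (2 * c).
  rewrite -{1}sD /sqsum [\sum_i _]exchange_big [X in X / (2 * c)]exchange_big.
  rewrite mulr_sumr mulr_suml -big_split /=; apply: ler_sum => j _.
  rewrite mxE mulr_sumr mulr_suml -big_split /=; apply: ler_sum => k _.
  rewrite [D^T j k]mxE -subr_ge0.
  have -> : c / 2 * D k j ^+ 2 + E k j ^+ 2 / (2 * c) - D k j * E k j =
    (c * D k j - E k j) ^+ 2 / (2 * c) by field; rewrite gt_eqF.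
  by rewrite divr_ge0 ?sqr_ge0 // mulr_ge0 // ltW.
have := le_trans lo hi.
have -> : sqsum E / (2 * c) = c / 2 * (sqsum E / c ^+ 2) by field; rewrite gt_eqF.
have : 0 < c / 2 by rewrite divr_gt0.
by move: (sqsum D) (sqsum E / c ^+ 2) => u w c2; nra.
Qed.

Lemma spd_sqrt_unique m (X Y : 'M[R]_m) : spd X -> spd Y -> X *m X = Y *m Y -> X = Y.
Proof.
move=> pX pY XY; have [c c0 cX] := spd_lower_bound pX.
have := sqsum_sub_sqrt c0 cX pX.1 pY.
have -> : sqsum (X *m X - Y *m Y) = 0.
  by rewrite XY subrr /sqsum big1 // => i _; rewrite big1 // => j _; rewrite mxE expr0n.
rewrite mul0r => le0; apply/eqP; rewrite -subr_eq0; apply/eqP/matrixP => i j.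
rewrite [RHS]mxE; apply/eqP; rewrite -sqrf_eq0 eq_le sqr_ge0 andbT.
exact: le_trans (sqr_le_sqsum _ _ _) le0.
Qed.

(** In [sqsum_sub_sqrt] the bound c is needed for one of the two roots only. Taking it at x0 gives a
    constant independent of x, hence a local Hölder-free estimate |Q x0 - Q x| <= |Q x0^2 - Q x^2| /
    c. *)
Lemma cmx_sqrt (T : topologicalType) m (Q : T -> 'M[R]_m) :
  (forall x, spd (Q x)) -> cmx (fun x => Q x *m Q x) -> cmx Q.
Proof.
move=> pQ cQ i j x0; have [c c0 cX] := spd_lower_bound (pQ x0).
pose g x := sqsum (Q x0 *m Q x0 - Q x *m Q x) / c ^+ 2.
have cg : continuous g.
  apply: ctsM; last exact: ctsC.
  apply: continuous_bigsum => k _; apply: continuous_bigsum => l _.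
  rewrite [X in continuous X](_ : _ = fun x =>
    ((Q x0 *m Q x0) k l - (Q x *m Q x) k l) * ((Q x0 *m Q x0) k l - (Q x *m Q x) k l)); last first.
    by apply/funext => x; rewrite !mxE expr2.
  by apply: ctsM; apply: ctsB; [exact: ctsC | exact: cQ | exact: ctsC | exact: cQ].
have g0 : g x0 = 0.
  rewrite /g subrr /sqsum big1 ?mul0r // => k _.
  by rewrite big1 // => l _; rewrite mxE expr0n.
apply/cvgrPdist_lt => e e0.
have : \forall x \near x0, g x < e ^+ 2.
  by apply: (cvgr_lt (g x0) (cg x0)); rewrite g0 exprn_gt0.
apply: filterS => x gx.
have := sqr_le_sqsum (Q x0 - Q x) i j.
rewrite [X in X ^+ 2]mxE [in (- Q x) _ _]mxE => h.
have h2 : (Q x0 i j - Q x i j) ^+ 2 < e ^+ 2.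
  exact: le_lt_trans (le_trans h (sqsum_sub_sqrt c0 cX (pQ x0).1 (pQ x))) gx.
rewrite -real_normK ?num_real // in h2.
by rewrite -(ltr_pXn2r (ltn0Sn 1)) ?nnegrE // ltW.
Qed.

Lemma spd1 m : spd (1%:M : 'M[R]_m).
Proof. by split => [|v v0]; [exact: trmx1 | rewrite mulmx1 dot_gt0]. Qed.

Lemma spdV m (P : 'M[R]_m) : spd P -> spd (invmx P).
Proof.
move=> pP; have uP := spd_unitmx pP; have [sP posP] := pP.
split => [|v v0]; first by rewrite trmx_inv sP.
have -> : v^T *m invmx P *m v = (invmx P *m v)^T *m P *m (invmx P *m v).
  by rewrite trmx_mul trmx_inv sP -!mulmxA mulKVmx.
apply: posP; apply: contra v0 => /eqP /(congr1 (mulmx P)).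
by rewrite mulKVmx // mulmx0 => ->.
Qed.

Lemma spd_congr m (P A : 'M[R]_m) : A \in unitmx -> spd P -> spd (A^T *m P *m A).
Proof.
move=> uA [sP posP]; split => [|v v0]; first by rewrite !trmx_mul trmxK sP mulmxA.
have -> : v^T *m (A^T *m P *m A) *m v = (A *m v)^T *m P *m (A *m v).
  by rewrite trmx_mul !mulmxA.
apply: posP; apply: contra v0 => /eqP /(congr1 (mulmx (invmx A))).
by rewrite mulKmx // mulmx0 => ->.
Qed.

Definition sqrtmx m (A : 'M[R]_m) : 'M[R]_m := xget 0 [set Q | spd Q /\ Q *m Q = A].

Lemma sqrtmxP m (A : 'M[R]_m) : spd A -> spd (sqrtmx A) /\ sqrtmx A *m sqrtmx A = A.
Proof.
move=> /spd_sqrt[Q [pQ QQ _]].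
by apply: (@xgetPex _ 0 [set Q | spd Q /\ Q *m Q = A]); exists Q.
Qed.

Lemma cmx_sqrtmx (T : topologicalType) m (A : T -> 'M[R]_m) :
  (forall x, spd (A x)) -> cmx A -> cmx (fun x => sqrtmx (A x)).
Proof.
move=> pA cA; apply: cmx_sqrt => [x|]; first by have [] := sqrtmxP (pA x).
rewrite [X in cmx X](_ : _ = A) //; apply/funext => x.
by have [] := sqrtmxP (pA x).
Qed.

Lemma sqrtmx1 m : sqrtmx (1%:M : 'M[R]_m) = 1%:M.
Proof.
have [p1 e1] := sqrtmxP (spd1 m).
by apply: spd_sqrt_unique => //; [exact: spd1 | rewrite e1 mulmx1].
Qed.

End SquareRoot.

(** * Polar decomposition of symplectic matrices *)

Section Polar.
Variables (R : realType) (n : nat).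
Local Notation M2 := 'M[R]_(n + n).
Local Notation J := (Jmat R n).
Implicit Types (X : M2).

Lemma trmx_mul_spd X : X \in unitmx -> spd (X^T *m X).
Proof. by move=> uX; rewrite -{1}(mulmx1 X^T); apply: spd_congr => //; exact: spd1. Qed.

(** Both J P J^T and P^-1 are positive definite roots of A^-1, so they coincide by uniqueness, and
    this equality says that P is symplectic. *)
Lemma sqrtmx_symplectic (A : M2) : spd A -> symplectic A -> symplectic (sqrtmx A).
Proof.
move=> pA sA; have [pP PP] := sqrtmxP pA; set P := sqrtmx A in pP PP *.
have uJ : J^T \in unitmx.
  have e : J^T *m J = 1%:M by rewrite trmx_Jmat mulNmx JmatK opprK.
  by have [] := mulmx1_unit e.
have JJ : J^T *m J = 1%:M by rewrite trmx_Jmat mulNmx JmatK opprK.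
have pJ : spd (J *m P *m J^T) by rewrite -{1}(trmxK J); exact: spd_congr.
have e : J *m P *m J^T = invmx P.
  apply: spd_sqrt_unique pJ (spdV pP) _.
  have uP := spd_unitmx pP.
  rewrite -invmx_mul // PP.
  have sAA : A^T = A by case: pA.
  rewrite !mulmxA -(mulmxA _ J^T J) JJ mulmx1 -(mulmxA J P P) PP mul_symplectic_J //.
  by rewrite trmx_inv sAA -mulmxA (mulmx1C JJ) mulmx1.
have sP : P^T = P by case: pP.
rewrite /symplectic sP.
have -> : P *m J *m P = P *m (J *m P *m J^T) *m J.
  by rewrite -!mulmxA JJ mulmx1.
by rewrite e mulmxV ?mul1mx // spd_unitmx.
Qed.

Lemma symplectic_polar X : symplectic X ->
  let P := sqrtmx (X^T *m X) in
  [/\ spd P, symplectic P & unitary (X *m invmx P)].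
Proof.
move=> sX P; have uX := symplectic_unitmx sX.
have pA := trmx_mul_spd uX.
have [pP PP] := sqrtmxP pA.
have sP : symplectic P.
  by apply: sqrtmx_symplectic => //; apply: symplecticM => //; exact: symplecticT.
have uP := spd_unitmx pP.
split => //; apply: symplectic_unitary; last first.
  by apply: symplecticM => //; exact: symplecticV.
have tP : P^T = P by case: pP.
by rewrite trmx_mul trmx_inv tP mulmxA -(mulmxA _ X^T) -PP -/P mulKmx // mulmxV.
Qed.

End Polar.

(** * Paths in the diagonal torus *)

Section TorusPaths.
Variables (R : realType) (n : nat).
Local Notation M2 := 'M[R]_(n + n).
Local Notation J := (Jmat R n).
Implicit Types (X Y Z : R -> M2) (psi phi : 'I_n -> R).

Lemma torusE psi : torus psi =
  block_mx (diag_mx (\row_j cos (psi j))) (- diag_mx (\row_j sin (psi j)))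
           (diag_mx (\row_j sin (psi j))) (diag_mx (\row_j cos (psi j))).
Proof.
have e1 : map_mx (@complex.Re R) (diag_mx (\row_j cis (psi j))) = diag_mx (\row_j cos (psi j)).
  by apply/matrixP => i j; rewrite !mxE; case: eqP.
have e2 : map_mx (@complex.Im R) (diag_mx (\row_j cis (psi j))) = diag_mx (\row_j sin (psi j)).
  by apply/matrixP => i j; rewrite !mxE; case: eqP.
by rewrite /torus /rlm e1 e2.
Qed.

Lemma continuous_cos_comp (T : topologicalType) (f : T -> R) :
  continuous f -> continuous (fun x => cos (f x)).
Proof. by move=> cf x; apply: (continuous_comp (cf x)); exact: continuous_cos. Qed.

Lemma continuous_sin_comp (T : topologicalType) (f : T -> R) :
  continuous f -> continuous (fun x => sin (f x)).
Proof. by move=> cf x; apply: (continuous_comp (cf x)); exact: continuous_sin. Qed.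

Lemma cmx_diag (T : topologicalType) m (f : 'I_m -> T -> R) :
  (forall j, continuous (f j)) -> cmx (fun x => diag_mx (\row_j f j x)).
Proof.
move=> cf i j; under eq_fun do rewrite !mxE.
by case: (i == j); [under eq_fun do rewrite mulr1n; exact: cf | exact: ctsC].
Qed.

Lemma cmx_torus (T : topologicalType) (f : 'I_n -> T -> R) :
  (forall j, continuous (f j)) -> cmx (fun x => torus (fun j => f j x)).
Proof.
move=> cf; under eq_fun do rewrite torusE.
have cc := cmx_diag (fun j => continuous_cos_comp (cf j)).
have cs := cmx_diag (fun j => continuous_sin_comp (cf j)).
by apply: cmx_block => //; exact: cmxN.
Qed.

Lemma torus_symplectic psi : symplectic (torus psi).
Proof. by apply: unitary_symplectic; exact: torus_unitary. Qed.

Lemma torusN psi : torus (fun j => - psi j) = invmx (torus psi).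
Proof.
have u := symplectic_unitmx (torus_symplectic psi).
apply: (can_inj (mulKmx u)); rewrite mulmxV // -torusD.
by under eq_fun do rewrite subrr; exact: torus0.
Qed.

Lemma is_derive_mulrb (b : bool) (f : R -> R) (t df : R) :
  is_derive t 1 f df -> is_derive t 1 (fun s => f s *+ b) (df *+ b).
Proof.
case: b => // _; rewrite mulr0n; under eq_fun do rewrite mulr0n; exact: is_derive_cst.
Qed.

Definition tpath psi : R -> M2 := fun t => torus (fun j => t * psi j).

Definition rpath (a : R) : R -> M2 := tpath (fun=> a).

Lemma tpath0 psi : tpath psi 0 = 1%:M.
Proof. by rewrite /tpath; under eq_fun do rewrite mul0r; exact: torus0. Qed.

Lemma tpath_1 psi : tpath psi 1 = torus psi.
Proof. by rewrite /tpath; under eq_fun do rewrite mul1r. Qed.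

Lemma cts_id : continuous (id : R -> R).
Proof. by move=> t; exact: cvg_id. Qed.

Lemma cmx_tpath psi : cmx (tpath psi).
Proof.
apply: cmx_torus => j; apply: ctsM; [exact: cts_id | exact: ctsC].
Qed.

Lemma is_path_tpath psi : is_path (tpath psi).
Proof.
apply: is_pathI; [exact: tpath0 | by move=> t; exact: torus_symplectic | exact: cmx_tpath].
Qed.

Lemma tpathD psi phi : tpath (fun j => psi j + phi j) = pmul (tpath psi) (tpath phi).
Proof.
by apply/funext => t; rewrite /pmul /tpath -torusD; under eq_fun do rewrite mulrDr.
Qed.

Lemma tpathN psi : tpath (fun j => - psi j) = pinv (tpath psi).
Proof.
by apply/funext => t; rewrite /Defs.pinv /tpath -torusN; under eq_fun do rewrite mulrN.
Qed.

Lemma rpathD a b : rpath (a + b) = pmul (rpath a) (rpath b).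
Proof. exact: tpathD. Qed.

Lemma rpathN a : rpath (- a) = pinv (rpath a).
Proof. exact: tpathN. Qed.

(** J is multiplication by i; this makes it the endpoint of the rotation R_(pi/2). *)
Lemma JE : J = torus (fun=> pi / 2).
Proof.
rewrite torusE cos_pihalf sin_pihalf /Jmat.
have -> : diag_mx (\row_(j < n) (0 : R)) = 0.
  by apply/matrixP => i j; rewrite !mxE mul0rn.
by have -> : diag_mx (\row_(j < n) (1 : R)) = 1%:M by apply/matrixP => i j; rewrite !mxE.
Qed.

(** The Hamiltonian is the constant diagonal matrix K carrying psi on both blocks. *)
Lemma psd_tpath psi : (forall j, 0 <= psi j) -> psd_hamiltonian_path (tpath psi).
Proof.
move=> psi0; split; first exact: is_path_tpath.
pose d := diag_mx (\row_j psi j); pose K := block_mx d 0 0 d.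
exists (fun t => J *m K *m tpath psi t) => t tI; split.
  move=> i j; rewrite /tpath torusE /J /K !mulmx_block.
  rewrite !(mulmx0, mul0mx, mulmx1, mul1mx, mulNmx, mulmxN, add0r, addr0, opprK).
  have dl k : is_derive t 1 (fun s : R => s * psi k) (psi k).
    apply: (is_derive_eq (is_derive_mul (is_derive_id t 1) (is_derive_cst (psi k) t 1))).
    by rewrite mul1r mulr0 addr0.
  have dc k : is_derive t 1 (fun s : R => cos (s * psi k)) (- (psi k * sin (t * psi k))).
    have h := @is_derive1_comp R cos _ t _ _ (is_derive_cos (t * psi k)) (dl k).
    by apply: (is_derive_eq h); rewrite mulNr mulrC.
  have ds k : is_derive t 1 (fun s : R => sin (s * psi k)) (psi k * cos (t * psi k)).
    have h := @is_derive1_comp R sin _ t _ _ (is_derive_sin (t * psi k)) (dl k).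
    by apply: (is_derive_eq h); rewrite mulrC.
  under eq_fun do rewrite torusE.
  case: (split_ordP i) => i' ->; case: (split_ordP j) => j' ->.
  - rewrite block_mxEul mulmx_diag !mxE.
    rewrite [X in is_derive _ _ X _](_ : _ = fun s => (cos (s * psi i')) *+ (i' == j')); last first.
      by apply/funext => s; rewrite block_mxEul !mxE ?mulNrn.
    by apply: (is_derive_eq (is_derive_mulrb _ (dc i'))); rewrite ?mulNrn.
  - rewrite block_mxEur mulmx_diag !mxE.
    rewrite [X in is_derive _ _ X _](_ : _ = fun s => (- sin (s * psi i')) *+ (i' == j')); last first.
      by apply/funext => s; rewrite block_mxEur !mxE ?mulNrn.
    by apply: (is_derive_eq (is_derive_mulrb _ (is_deriveN (ds i')))); rewrite ?mulNrn.
  - rewrite block_mxEdl mulmx_diag !mxE.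
    rewrite [X in is_derive _ _ X _](_ : _ = fun s => (sin (s * psi i')) *+ (i' == j')); last first.
      by apply/funext => s; rewrite block_mxEdl !mxE ?mulNrn.
    by apply: (is_derive_eq (is_derive_mulrb _ (ds i'))); rewrite ?mulNrn.
  - rewrite block_mxEdr mulmx_diag !mxE.
    rewrite [X in is_derive _ _ X _](_ : _ = fun s => (cos (s * psi i')) *+ (i' == j')); last first.
      by apply/funext => s; rewrite block_mxEdr !mxE ?mulNrn.
    by apply: (is_derive_eq (is_derive_mulrb _ (dc i'))); rewrite ?mulNrn.
have u := symplectic_unitmx (torus_symplectic (fun j => t * psi j)).
rewrite !mulmxA mulmxK // JmatK mulNmx mul1mx opprK.
have -> : K = diag_mx (row_mx (\row_j psi j) (\row_j psi j)) by rewrite diag_mx_row.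
split; first by rewrite tr_diag_mx.
move=> v; rewrite mxE sumr_ge0 // => k _; rewrite mul_mx_diag !mxE.
rewrite mulrAC -expr2 mulr_ge0 ?sqr_ge0 //.
by case: splitP => l _; rewrite mxE.
Qed.

Lemma in_cone_tpath psi : (forall j, 0 <= psi j) -> in_cone (tpath psi).
Proof. by move=> /psd_tpath; exact: in_coneI. Qed.

Lemma in_cone_rpath a : 0 <= a -> in_cone (rpath a).
Proof. by move=> a0; exact: in_cone_tpath. Qed.

Lemma is_path_rpath a : is_path (rpath a).
Proof. exact: is_path_tpath. Qed.

Lemma cisDpi2 (k : int) x : cis (x + 2 * pi * k%:~R) = cis x :> R[i].
Proof.
have cis2pi : cis (2 * pi) = 1 :> R[i].
  have e : 2 * pi = pi *+ 2 :> R by rewrite mulr_natl.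
  by rewrite /cis e cos2pi sin2pi.
have P (m : nat) : cis (2 * pi * m%:R) = 1 :> R[i].
  elim: m => [|m IH]; first by rewrite mulr0 cis0.
  by rewrite -[m.+1%:R]natr1 mulrDr mulr1 cisD IH cis2pi mulr1.
rewrite cisD; suff -> : cis (2 * pi * k%:~R) = 1 :> R[i] by rewrite mulr1.
case: k => m; first exact: P.
by rewrite NegzE mulrNz mulrN cisN P conjc1.
Qed.

Lemma torus_2pi psi (k : 'I_n -> int) :
  torus (fun j => psi j + 2 * pi * (k j)%:~R) = torus psi.
Proof.
have e : \row_j cis (psi j + 2 * pi * (k j)%:~R) = \row_j cis (psi j).
  by apply/rowP => j; rewrite !mxE cisDpi2.
by rewrite /torus e.
Qed.

(** exp (i pi k) is real: this is why the comparison rotations have angles in pi Z. *)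
Lemma torus_pi_scalar (k : int) : exists c : R, torus (fun _ : 'I_n => pi * k%:~R) = c%:M.
Proof.
exists (cos (pi * k%:~R)).
have s0 : sin (pi * k%:~R) = 0 :> R.
  have P (m : nat) : sin (pi * m%:R) = 0 :> R.
    elim: m => [|m IH]; first by rewrite mulr0 sin0.
    by rewrite -[m.+1%:R]natr1 mulrDr mulr1 sinDpi IH oppr0.
  case: k => m; first exact: P.
  by rewrite NegzE mulrNz mulrN sinN P oppr0.
rewrite torusE s0 (scalar_mx_block n n).
have -> : diag_mx (\row_(j < n) (0 : R)) = 0.
  by apply/matrixP => i j; rewrite !mxE mul0rn.
have -> : diag_mx (\row_(j < n) cos (pi * k%:~R)) = (cos (pi * k%:~R))%:M :> 'M[R]_n.
  by apply/matrixP => i j; rewrite !mxE.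
by rewrite oppr0.
Qed.

(** Sliding Z to its endpoint turns Z X Z^-1 into conjugation by a scalar matrix, which is
    trivial. *)
Lemma homotopic_central X Z c : is_path X -> is_path Z -> Z 1 = c%:M ->
  homotopic (pmul Z X) (pmul X Z).
Proof.
move=> pX pZ Z1.
have uZ : Z 1 \in unitmx by apply: (is_path_unit pZ); rewrite ler01 lexx.
have h := homotopic_conj pX pZ.
have e : (fun t => Z 1 *m X t *m invmx (Z 1)) = X.
  by apply/funext => t; rewrite {1}Z1 -scalar_mxC -Z1 mulmxK.
rewrite e in h; have := homotopic_pmul h (homotopic_refl pZ).
apply: homotopic_trans; apply: homotopic_eq.
  by apply: is_path_pmul.
by move=> t t01; rewrite /pmul /Defs.pinv mulmxKV // (is_path_unit pZ).
Qed.

Lemma unitary_connected (V : M2) : unitary V -> exists Z, is_path Z /\ Z 1 = V.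
Proof.
move=> /unitary_diag[W [psi [uW ->]]].
exists (fun t => W *m tpath psi t *m W^T); split; last by rewrite tpath_1.
have [oW cW] := uW.
apply: is_pathI.
- by rewrite tpath0 mulmx1 unitaryVr.
- move=> t; have sW := unitary_symplectic uW.
  exact: (symplecticM (symplecticM sW (torus_symplectic _)) (symplecticT sW)).
- by apply: cmxM; [apply: cmxM; [exact: cmx_cst | exact: cmx_tpath] | exact: cmx_cst].
Qed.

(** Join 1 to V by a path Z: conjugation by V is homotopic to conjugation by Z, and loops are
    central up to homotopy. *)
Lemma homotopic_loop_conj X (V : M2) : unitary V -> is_path X -> X 1 = 1%:M ->
  homotopic (fun t => V *m X t *m V^T) X.
Proof.
move=> uV pX X1; have [Z [pZ Z1]] := unitary_connected uV.
have h := homotopic_conj pX pZ.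
rewrite Z1 (unitary_invmx uV) in h.
apply: (homotopic_trans (homotopic_sym h)).
have h2 := homotopic_pmul (homotopic_sym (homotopic_central pZ pX X1))
  (homotopic_refl (is_path_pinv pZ)).
apply: (homotopic_trans h2); apply: homotopic_sym; apply: homotopic_eq => // t t01.
by rewrite /pmul /Defs.pinv mulmxK // (is_path_unit pZ).
Qed.

(** V is the permutation matrix of the transposition, an involution; with [homotopic_loop_conj] it
    moves turns from one coordinate to another. *)
Lemma torus_swap (i j : 'I_n) : exists2 V : M2, unitary V &
  forall psi, torus (psi \o tperm i j) = V *m torus psi *m V^T.
Proof.
pose S : 'M[R[i]]_n := perm_mx (tperm i j).
have aS : adj S = S.
  rewrite /adj tr_perm_mx tpermV.
  by apply/matrixP => a b; rewrite !mxE conjc_nat.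
have SS : S *m S = 1%:M by rewrite -perm_mxM tperm2 perm_mx1.
exists (rlm S); first by apply: rlm_unitary; rewrite aS SS.
move=> psi; rewrite -rlm_adj aS /torus -!rlmM.
suff -> : diag_mx (\row_k cis ((psi \o tperm i j) k)) = S *m diag_mx (\row_k cis (psi k)) *m S by [].
rewrite /S -row_permE -[X in _ *m perm_mx X]tpermV -col_permE.
apply/matrixP => a b; rewrite !mxE (inj_eq perm_inj) /=.
by rewrite /row_perm.
Qed.

End TorusPaths.

(** * Paths of positive definite symplectic matrices *)

Section SpdPaths.
Variables (R : realType) (n : nat).
Local Notation M2 := 'M[R]_(n + n).
Local Notation J := (Jmat R n).
Implicit Types (X Y Z P : R -> M2).

(* If [P = Q^2] then [P = Q J Q^-1 J^-1], and sliding [J] along the rotation from the identity to [J]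
   shows that [P] times that rotation is homotopic to a conjugate of the rotation. *)
Lemma cone_spd_rpath P : cmx P -> P 0 = 1%:M -> (forall t, spd (P t)) ->
  (forall t, symplectic (P t)) -> in_cone (pmul P (@rpath R n (pi / 2))).
Proof.
move=> cP P0 pP sP.
pose Q t := sqrtmx (P t).
have QQ t : Q t *m Q t = P t by have [] := sqrtmxP (pP t).
have pQ t : spd (Q t) by have [] := sqrtmxP (pP t).
have sQ t : symplectic (Q t) by exact: sqrtmx_symplectic.
have uQ t : Q t \in unitmx by exact: symplectic_unitmx.
have cQ : cmx Q by exact: cmx_sqrtmx.
have Q0 : Q 0 = 1%:M by rewrite /Q P0 sqrtmx1.
have pathQ : is_path Q by exact: is_pathI.
pose c (p : R * R) : R := p.2 + (1 - p.1) * (1 - p.2).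
have cc : continuous c.
  have c1 := @continuous_fst2 R; have c2 := @continuous_snd2 R.
  apply: ctsD => //; apply: ctsM; apply: ctsB => //; exact: ctsC.
pose T (x : R) : M2 := rpath n (pi / 2) x.
have T1 : T 1 = J by rewrite /T /rpath tpath_1 -JE.
have uT x : T x \in unitmx by exact: symplectic_unitmx (torus_symplectic _).
have cT : cmx (T \o c) by apply: cmx_comp => //; exact: cmx_tpath.
have cQ2 : cmx (fun p : R * R => Q p.2) by exact: (cmx_comp (@continuous_snd2 R) cQ).
have cT2 : cmx (fun p : R * R => T p.2) by exact: (cmx_comp (@continuous_snd2 R) (@cmx_tpath R n _)).
have QJ t : Q t *m J *m invmx (Q t) = P t *m J.
  have sQt : (Q t)^T = Q t by case: (pQ t).
  have := mul_symplectic_J (symplecticV (sQ t)).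
  by rewrite invmxK sQt -mulmxA => ->; rewrite mulmxA QQ.
have key : homotopic (pmul P (rpath n (pi / 2))) (pmul (pmul Q (rpath n (pi / 2))) (pinv Q)).
  apply: (@homotopicI _ _ _ _ (fun s t => Q t *m T (c (s, t)) *m invmx (Q t) *m
     invmx (T (c (s, t))) *m T t)).
  - rewrite [X in cmx X](_ : _ = fun p => Q p.2 *m (T \o c) p *m invmx (Q p.2) *m
       invmx ((T \o c) p) *m T p.2); last by apply/funext => -[].
    apply: cmxM => //; apply: cmxM; last by apply: cmx_inv => // p; exact: uT.
    by apply: cmxM; [exact: cmxM | apply: cmx_inv].
  - move=> s t; have sT x : symplectic (T x) by exact: torus_symplectic.
    apply: symplecticM => //; apply: symplecticM; last exact: symplecticV.
    by apply: symplecticM; [exact: symplecticM | exact: symplecticV].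
  - by move=> s; rewrite Q0 invmx1 mul1mx mulmx1 mulmxV // mul1mx /T /rpath tpath0.
  - move=> s; rewrite /c /= subrr mulr0 addr0 T1 QJ /pmul -/(T 1) T1.
    by rewrite mulmxK // -T1.
  - move=> t t01; rewrite /c /= subr0 mul1r addrC subrK T1 QJ /pmul.
    by rewrite mulmxK // -T1.
  - move=> t t01; rewrite /c /= subrr mul0r addr0 /pmul /Defs.pinv -/(T t).
    by rewrite mulmxKV.
apply: (in_cone_homotopic key); apply: in_cone_conj => //.
by apply: in_cone_rpath; rewrite divr_ge0 // pi_ge0.
Qed.

End SpdPaths.

(** * Homotopy classes of diagonal loops *)

Section Loops.
Variables (R : realType) (n : nat).
Local Notation M2 := 'M[R]_(n + n).
Implicit Types (X Y Z : R -> M2) (psi phi : 'I_n -> R).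

Lemma tpath_loop (k : 'I_n -> int) : @tpath R n (fun j => 2 * pi * (k j)%:~R) 1 = 1%:M.
Proof.
rewrite tpath_1 -[RHS]torus0 -(@torus_2pi R n (fun=> 0) k).
by under [in RHS]eq_fun do rewrite add0r.
Qed.

Lemma unit_loop_homotopic (c : int) (i i0 : 'I_n) :
  homotopic (@tpath R n (fun j => 2 * pi * (c *+ (j == i))%:~R))
            (@tpath R n (fun j => 2 * pi * (c *+ (j == i0))%:~R)).
Proof.
have [V uV VP] := torus_swap R i i0.
have h := homotopic_loop_conj uV (is_path_tpath _)
  (tpath_loop (fun j => c *+ (j == i0))).
apply: homotopic_trans h; apply: homotopic_eq; first exact: is_path_tpath.
move=> t _; rewrite /tpath -VP; congr (@torus R n); apply/funext => j /=.
congr (_ * (_ * (_ *+ _)%:~R)); congr nat_of_bool.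
by rewrite -[in RHS](inj_eq (@perm_inj _ (tperm i i0))) tpermK tpermR.
Qed.

(** The loop is the product of its one-coordinate loops, each of which is moved onto coordinate i0,
    where the turns add up. *)
Lemma loop_sum (k : 'I_n -> int) (i0 : 'I_n) :
  homotopic (@tpath R n (fun j => 2 * pi * (k j)%:~R))
            (@tpath R n (fun j => 2 * pi * ((\sum_i k i) *+ (j == i0))%:~R)).
Proof.
have H (s : seq 'I_n) :
  homotopic (@tpath R n (fun j => 2 * pi * (\sum_(i <- s) (k i *+ (j == i)))%:~R))
            (@tpath R n (fun j => 2 * pi * ((\sum_(i <- s) k i) *+ (j == i0))%:~R)).
  elim: s => [|i s IH].
    rewrite [X in homotopic X _](_ : _ =
      @tpath R n (fun j => 2 * pi * ((\sum_(i <- [::]) k i) *+ (j == i0))%:~R)).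
      exact/homotopic_refl/is_path_tpath.
    by congr (@tpath R n); apply/funext => j; rewrite !big_nil mul0rn.
  under eq_fun do rewrite big_cons intrD mulrDr.
  rewrite big_cons; under [X in homotopic _ (tpath X)]eq_fun do rewrite mulrnDl intrD mulrDr.
  by rewrite !tpathD; apply: homotopic_pmul => //; exact: unit_loop_homotopic.
have := H (index_enum 'I_n).
rewrite [X in homotopic (tpath X) _](_ : _ = fun j => 2 * pi * (k j)%:~R) //.
apply/funext => j; congr (_ * _%:~R); rewrite (bigD1 j) //= eqxx mulr1n big1 ?addr0 //.
by move=> i ij; rewrite eq_sym (negbTE ij) mulr0n.
Qed.

Lemma loop_homotopic (k k' : 'I_n -> int) : (0 < n)%N -> \sum_i k i = \sum_i k' i ->
  homotopic (@tpath R n (fun j => 2 * pi * (k j)%:~R))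
            (@tpath R n (fun j => 2 * pi * (k' j)%:~R)).
Proof.
move=> n0 kk; apply: (homotopic_trans (loop_sum k (Ordinal n0))).
by apply: homotopic_sym; rewrite kk; exact: loop_sum.
Qed.

End Loops.

(** * Unitary paths *)

Section CayleyChart.
Variables (R : realType) (n : nat).
Local Notation M2 := 'M[R]_(n + n).
Local Notation J := (Jmat R n).
Implicit Types (U V W K : M2) (X Y : R -> M2) (psi : 'I_n -> R).

(** The complex scalar exp (i a), central among the complex-linear matrices. *)
Definition scal (a : R) : M2 := torus (fun=> a).

Lemma scalE a : scal a = cos a *: 1%:M + sin a *: J.
Proof.
rewrite /scal torusE /Jmat (scalar_mx_block n n) !scale_block_mx add_block_mx.
have e (x : R) : diag_mx (\row_(j < n) x) = x *: 1%:M.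
  by apply/matrixP => i j; rewrite !mxE mulr_natr.
by rewrite !e !scaler0 !addr0 !add0r scalerN.
Qed.

Lemma scal_comm a V : commJ V -> scal a *m V = V *m scal a.
Proof.
move=> cV; rewrite scalE mulmxDl mulmxDr -!scalemxAl -!scalemxAr cV.
by rewrite mul1mx mulmx1.
Qed.

Lemma scalK a : scal a *m scal (- a) = 1%:M.
Proof.
rewrite /scal -torusD; under eq_fun do rewrite subrr.
exact: torus0.
Qed.

(* [- exp (i a)] is not an eigenvalue of [U]; on this set the Cayley transform gives a continuous
   choice [chart_path a U] of a path from the identity to [U]. *)
Definition chart a U : Prop := scal (- a) *m U + 1%:M \in unitmx.

Definition cayK a U : M2 :=
  (scal (- a) *m U - 1%:M) *m invmx (scal (- a) *m U + 1%:M).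

Definition cay K : M2 := (1%:M + K) *m invmx (1%:M - K).

Definition chart_path a U (s : R) : M2 := scal (s * a) *m cay (s *: cayK a U).

(** The quadratic form of a skew matrix vanishes, so that of 1 - K is |v|^2. *)
Lemma skew_unitmx K : K^T = - K -> 1%:M - K \in unitmx.
Proof.
move=> sK; apply: posdef_unitmx => v v0.
have k0 : (v^T *m K *m v) 0 0 = 0.
  have : (v^T *m K *m v)^T = - (v^T *m K *m v).
    by rewrite !trmx_mul trmxK sK mulNmx mulmxN mulmxA.
  by move=> /matrixP /(_ 0 0); rewrite !mxE; move: (\sum_j _) => x; lra.
by rewrite mulmxBr mulmx1 mulmxBl mxE [in X in _ + X]mxE k0 subr0 dot_gt0.
Qed.

Lemma cay_unitary K : K^T = - K -> commJ K -> unitary (cay K).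
Proof.
move=> sK cK; have u1 := skew_unitmx sK.
have u2 : 1%:M + K \in unitmx.
  by rewrite -[K]opprK; apply: skew_unitmx; rewrite linearN /= sK.
split; last first.
  apply: commJM; first by apply: commJD => //; exact: commJ1.
  by apply: commJV; apply: commJD; [exact: commJ1 | exact: commJN].
have t1 : (1%:M + K)^T = 1%:M - K by rewrite linearD /= trmx1 sK.
have t2 : (1%:M - K)^T = 1%:M + K by rewrite linearB /= trmx1 sK opprK.
rewrite /cay trmx_mul trmx_inv t1 t2 mulmxA -(mulmxA (invmx _)).
have -> : (1%:M - K) *m (1%:M + K) = (1%:M + K) *m (1%:M - K).
  rewrite [LHS]mulmxDr [RHS]mulmxBr !mulmx1 mulmxBl mulmxDl !mul1mx.
  by rewrite addrA subrK opprD addrA addrK.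
by rewrite mulKmx // mulmxV.
Qed.

Lemma cayK_mul a U : chart a U ->
  cayK a U *m (scal (- a) *m U + 1%:M) = scal (- a) *m U - 1%:M.
Proof. by move=> cU; rewrite /cayK mulmxKV. Qed.

Lemma unitary_scal a : unitary (scal a). Proof. exact: torus_unitary. Qed.

Lemma cayK_skew a U : unitary U -> chart a U -> (cayK a U)^T = - cayK a U.
Proof.
move=> uU cU; have := unitaryM (unitary_scal (- a)) uU.
move: cU; rewrite /chart /cayK; set W := scal (- a) *m U => cW uW.
have [oW _] := uW; have uu := unitary_unitmx uW.
have cWT : W^T + 1%:M \in unitmx.
  by rewrite -unitmx_tr linearD /= trmxK trmx1.
have t1 : (W + 1%:M)^T = W^T + 1%:M by rewrite linearD /= trmx1.
have t2 : (W - 1%:M)^T = W^T - 1%:M by rewrite linearB /= trmx1.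
rewrite trmx_mul trmx_inv t1 t2.
apply: (can_inj (mulKmx cWT)); rewrite mulKVmx //.
have -> : (W^T + 1%:M) *m - ((W - 1%:M) *m invmx (W + 1%:M)) =
  - ((W^T + 1%:M) *m (W - 1%:M) *m invmx (W + 1%:M)) by rewrite mulmxN mulmxA.
have -> : (W^T + 1%:M) *m (W - 1%:M) = - ((W^T - 1%:M) *m (W + 1%:M)).
  rewrite [LHS]mulmxDl [in RHS]mulmxBl !mul1mx mulmxBr mulmxDr oW !mulmx1.
  by rewrite addrC addrA subrK opprB opprD addrA addrK.
by rewrite mulNmx mulmxK // opprK.
Qed.

Lemma cayK_commJ a U : unitary U -> commJ (cayK a U).
Proof.
move=> uU; have [_ cW] := unitaryM (unitary_scal (- a)) uU.
apply: commJM; first by apply: commJD => //; apply: commJN; exact: commJ1.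
by apply: commJV; apply: commJD => //; exact: commJ1.
Qed.

Lemma chart_path_unitary a U s : unitary U -> chart a U -> unitary (chart_path a U s).
Proof.
move=> uU cU; apply: unitaryM; first exact: unitary_scal.
apply: cay_unitary; last by apply: commJZ; exact: cayK_commJ.
by rewrite linearZ /= cayK_skew // scalerN.
Qed.

Lemma chart_path0 a U : chart_path a U 0 = 1%:M.
Proof.
rewrite /chart_path mul0r scale0r /cay addr0 subr0 invmx1 mulmx1 mulmx1.
exact: torus0.
Qed.

Lemma cay_eq K W : 1%:M - K \in unitmx -> W *m (1%:M - K) = 1%:M + K -> cay K = W.
Proof. by move=> u e; rewrite /cay -e mulmxK. Qed.

Lemma chart_path1 a U : unitary U -> chart a U -> chart_path a U 1 = U.
Proof.
move=> uU cU; rewrite /chart_path mul1r scale1r.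
have -> : cay (cayK a U) = scal (- a) *m U.
  apply: cay_eq; first by apply: skew_unitmx; exact: cayK_skew.
  apply: (can_inj (mulmxK (cU : _ \in unitmx))).
  rewrite -(mulmxA (scal (- a) *m U)) mulmxBl [in RHS]mulmxDl cayK_mul // !mul1mx.
  move: (scal (- a) *m U) => W.
  by rewrite opprD opprK addrACA subrr add0r mulmxDr mulmx1 addrACA subrr addr0.
by rewrite mulmxA scalK mul1mx.
Qed.

Lemma chart_conj a U V : unitary V -> chart a (V *m U *m V^T) = chart a U.
Proof.
move=> uV; rewrite /chart; have [oV cV] := uV.
have e : scal (- a) *m (V *m U *m V^T) + 1%:M = V *m (scal (- a) *m U + 1%:M) *m V^T.
  by rewrite mulmxDr mulmxDl mulmx1 unitaryVr // !mulmxA scal_comm.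
rewrite e !unitmx_mul unitmx_tr unitary_unitmx // andbT.
by [].
Qed.

Lemma cayK_conj a U V : unitary V -> chart a U ->
  cayK a (V *m U *m V^T) = V *m cayK a U *m V^T.
Proof.
move=> uV cU; have [oV cV] := uV.
have cVU : chart a (V *m U *m V^T) by rewrite chart_conj.
apply: (can_inj (mulmxK (cVU : _ \in unitmx))); rewrite cayK_mul //.
have -> : scal (- a) *m (V *m U *m V^T) + 1%:M = V *m (scal (- a) *m U + 1%:M) *m V^T.
  by rewrite mulmxDr mulmxDl mulmx1 unitaryVr // !mulmxA scal_comm.
have := cayK_mul cU; move: (cayK a U) => K eK.
rewrite !mulmxA -(mulmxA _ V^T V) oV mulmx1 -(mulmxA V K) eK.
by rewrite mulmxBr mulmxBl mulmx1 unitaryVr // !mulmxA scal_comm.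
Qed.

(** Naturality of the chart under unitary conjugation, which reduces its computation to diagonal
    matrices. *)
Lemma chart_path_conj a U V s : unitary V -> unitary U -> chart a U ->
  chart_path a (V *m U *m V^T) s = V *m chart_path a U s *m V^T.
Proof.
move=> uV uU cU; have [oV cV] := uV; rewrite /chart_path cayK_conj //.
set K := cayK a U.
have u1 : 1%:M - s *: K \in unitmx.
  by apply: skew_unitmx; rewrite linearZ /= cayK_skew // scalerN.
have -> : cay (s *: (V *m K *m V^T)) = V *m cay (s *: K) *m V^T.
  have e (x : R) : 1%:M + x *: (V *m K *m V^T) = V *m (1%:M + x *: K) *m V^T.
    by rewrite mulmxDr mulmxDl mulmx1 unitaryVr // -scalemxAr -scalemxAl.
  have e' : 1%:M - s *: (V *m K *m V^T) = V *m (1%:M - s *: K) *m V^T.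
    by rewrite -!scaleNr e.
  apply: cay_eq.
    by rewrite e' !unitmx_mul unitmx_tr u1 (unitary_unitmx uV).
  have eC : cay (s *: K) *m (1%:M - s *: K) = 1%:M + s *: K by rewrite /cay mulmxKV.
  move: (cay (s *: K)) eC => C eC.
  by rewrite e' e !mulmxA -(mulmxA _ V^T V) oV mulmx1 -(mulmxA V C) eC.
move: (cay (s *: K)) => C; by rewrite !mulmxA scal_comm.
Qed.

Lemma rlmD (A B : 'M[R[i]]_n) : rlm (A + B) = rlm A + rlm B.
Proof.
have eRe : map_mx (@complex.Re R) (A + B) = map_mx (@complex.Re R) A + map_mx (@complex.Re R) B.
  by apply/matrixP => i j; rewrite !mxE; case: (A i j) => ? ?; case: (B i j).
have eIm : map_mx (@complex.Im R) (A + B) = map_mx (@complex.Im R) A + map_mx (@complex.Im R) B.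
  by apply/matrixP => i j; rewrite !mxE; case: (A i j) => ? ?; case: (B i j).
by rewrite /rlm add_block_mx eRe eIm opprD.
Qed.

Lemma rlmZ (x : R) (A : 'M[R[i]]_n) : rlm ((x%:C)%C *: A) = x *: rlm A.
Proof.
have eRe : map_mx (@complex.Re R) ((x%:C)%C *: A) = x *: map_mx (@complex.Re R) A.
  by apply/matrixP => i j; rewrite !mxE; case: (A i j) => ? ? /=; ring.
have eIm : map_mx (@complex.Im R) ((x%:C)%C *: A) = x *: map_mx (@complex.Im R) A.
  by apply/matrixP => i j; rewrite !mxE; case: (A i j) => ? ? /=; ring.
by rewrite /rlm scale_block_mx eRe eIm scalerN.
Qed.

Lemma rlmN (A : 'M[R[i]]_n) : rlm (- A) = - rlm A.
Proof. by rewrite -scaleN1r -[RHS]scaleN1r -rlmZ rmorphN1. Qed.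

(** The scalar Cayley transform of i x is exp (2 i atan x). *)
Lemma cis_atan (x : R) : cis (2 * atan x) * (1 - Complex 0 x) = 1 + Complex 0 x.
Proof.
have c0 : cos (atan x) != 0 by rewrite gt_eqF // cos_gt0_pihalf // atan_gtNpi2 atan_ltpi2.
have s : sin (atan x) = x * cos (atan x).
  by rewrite -{2}(atanK x) /tan divfK.
have cs := cos2Dsin2 (atan x); rewrite s in cs.
rewrite mulrDl !mul1r cisD /cis s; move: (cos _) c0 cs => c c0 cs.
apply/eqP; rewrite eq_complex /=; apply/andP; split; apply/eqP.
  transitivity (c ^+ 2 + (x * c) ^+ 2); [ring | by rewrite cs addr0].
transitivity (x * (c ^+ 2 + (x * c) ^+ 2)); [ring | by rewrite cs; ring].
Qed.

Lemma cayley_imaginary (w : R[i]) : w * w^*%C = 1 -> w + 1 != 0 ->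
  exists b : R, (Complex 0 b) * (w + 1) = w - 1.
Proof.
case: w => x y /eqP; rewrite eq_complex /= => /andP[/eqP e _].
rewrite eq_complex /= addr0 => w1.
have e2 : x ^+ 2 + y ^+ 2 = 1 by rewrite -e; ring.
have x1 : x + 1 != 0.
  apply: contra w1 => /eqP x1; rewrite x1 eqxx /=.
  have xm : x = -1 by lra.
  by rewrite -sqrf_eq0; apply/eqP; rewrite xm in e2; lra.
have y2 : y ^+ 2 = 1 - x ^+ 2 by rewrite -e2; ring.
(* This is the tangent of half the argument of x + i y. *)
exists (y / (x + 1)); apply/eqP; rewrite eq_complex /=; apply/andP; split; apply/eqP.
  rewrite !addr0 mul0r sub0r mulrAC -expr2.
  have -> : y ^+ 2 = (1 - x) * (x + 1) by rewrite y2; ring.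
  by rewrite mulfK //; ring.
by rewrite !addr0 mul0r add0r oppr0 addr0 divfK.
Qed.

(** On a diagonal matrix the Cayley path stays in the torus, with explicit angles that can then be
    straightened. *)
Lemma torus_chart_path a psi : chart a (torus psi) ->
  exists b : 'I_n -> R,
    forall s, chart_path a (torus psi) s = torus (fun j => s * a + 2 * atan (s * b j)).
Proof.
move=> cU; pose w j : R[i] := cis (- a + psi j).
have WE : scal (- a) *m torus psi = rlm (diag_mx (\row_j w j)) by rewrite /scal -torusD.
have diag1 : (1%:M : 'M[R[i]]_n) = diag_mx (\row_j 1).
  by apply/matrixP => i j; rewrite !mxE.
have diagD (c d : 'I_n -> R[i]) : diag_mx (\row_j c j) + diag_mx (\row_j d j) =
    diag_mx (\row_j (c j + d j)).
  by apply/matrixP => i j; rewrite !mxE -mulrnDl.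
have diagM (c d : 'I_n -> R[i]) : diag_mx (\row_j c j) *m diag_mx (\row_j d j) =
    diag_mx (\row_j (c j * d j)).
  rewrite mulmx_diag; apply/matrixP => i j; by rewrite !mxE.
have W1 : scal (- a) *m torus psi + 1%:M = rlm (diag_mx (\row_j (w j + 1))).
  by rewrite WE -rlm1 -rlmD diag1 diagD.
have w1 j : w j + 1 != 0.
  have u : rlm (diag_mx (\row_j (w j + 1))) \in unitmx by rewrite -W1.
  have := mulmxV u; set D := diag_mx _ in u * => e.
  have : D *m cxm (invmx (rlm D)) = 1%:M.
    by rewrite -[X in X *m _](rlmK D) -cxmM ?e ?cxm1 //; exact: rlm_commJ.
  move=> /mulmx1_unit[]; rewrite unitmxE unitfE det_diag => /prodf_neq0 /(_ j isT).
  by rewrite mxE.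
have /choice[b bP] : forall j, exists b : R, (Complex 0 b) * (w j + 1) = w j - 1.
  by move=> j; apply: cayley_imaginary => //; exact: cisNr.
exists b => s.
have KE : cayK a (torus psi) = rlm (diag_mx (\row_j Complex 0 (b j))).
  have e : diag_mx (\row_j Complex 0 (b j)) *m diag_mx (\row_j (w j + 1)) =
      diag_mx (\row_j w j) + diag_mx (\row_j -1).
    by rewrite diagM diagD; apply/matrixP => k l; rewrite !mxE bP.
  apply: (can_inj (mulmxK (cU : _ \in unitmx))); rewrite cayK_mul // W1 WE -rlmM e.
  rewrite rlmD; congr (_ + _).
  rewrite -[in LHS]rlm1 -rlmN diag1.
  suff -> : - diag_mx (\row_j 1) = diag_mx (\row_j -1) :> 'M[R[i]]_n by [].
  by apply/matrixP => k l; rewrite !mxE mulNrn.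
have sKE (x : R) : x *: cayK a (torus psi) = rlm (diag_mx (\row_j Complex 0 (x * b j))).
  rewrite KE -rlmZ.
  suff -> : (x%:C)%C *: diag_mx (\row_j Complex 0 (b j)) = diag_mx (\row_j Complex 0 (x * b j)) by [].
  apply/matrixP => k l; rewrite !mxE; case: (k == l); last by rewrite !mulr0n mulr0.
  by rewrite !mulr1n; apply/eqP; rewrite eq_complex /=; apply/andP; split; apply/eqP; ring.
rewrite /chart_path.
have -> : cay (s *: cayK a (torus psi)) = torus (fun j => 2 * atan (s * b j)).
  apply: cay_eq.
    by apply: skew_unitmx; rewrite linearZ /= cayK_skew ?scalerN //; exact: torus_unitary.
  rewrite -scaleNr !sKE -rlm1 -!rlmD diag1 !diagD /torus -rlmM diagM.
  suff -> : \row_j (cis (2 * atan (s * b j)) * (1 + Complex 0 (- s * b j))) =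
            \row_j (1 + Complex 0 (s * b j)) by [].
  apply/rowP => j; rewrite !mxE -(cis_atan (s * b j)).
  suff -> : Complex 0 (- s * b j) = - Complex 0 (s * b j) :> R[i] by [].
  by apply/eqP; rewrite eq_complex /= oppr0 eqxx mulNr eqxx.
by rewrite /scal -torusD.
Qed.

End CayleyChart.

(** Near every t the property passes between any two points, in both directions, so [P] and its
    negation are both relatively open and connectedness concludes. *)
Lemma segment_locally_constant (R : realType) (P : R -> Prop) (a b : R) : a <= b -> P a ->
  (forall t, a <= t <= b -> exists2 e, 0 < e & forall u v,
     `|u - t| < e -> `|v - t| < e -> a <= u <= b -> a <= v <= b -> P u -> P v) ->
  forall t, a <= t <= b -> P t.
Proof.
move=> ab Pa loc.
pose A := [set t | a <= t <= b]; pose B := A `&` [set t | P t].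
have cA : connected A.
  have -> : A = `[a, b]%classic by apply/seteqP; split => t; rewrite /A /= in_itv.
  exact: segment_connected.
have nearP (t e : R) : 0 < e -> \forall u \near t, `|u - t| < e.
  by move=> e0; near=> u; rewrite distrC; near: u; exact: nbhsx_ballx.
have AB : B = A.
  apply: cA.
  - by exists a; split => //; rewrite /A /= lexx ab.
  - exists ([set u | A u -> P u]^°)%classic; first exact: open_interior.
    apply/seteqP; split => [t [At Pt]|t [At /interior_subset Pt]]; split => //; last exact: Pt.
    have [e e0 h] := loc t At; apply: filterS (nearP t e e0) => u ut Au.
    by apply: (h t u) => //; rewrite subrr normr0.
  - exists (~` [set u | A u -> ~ P u]^°)%classic; first by apply: open_closedC; exact: open_interior.
    apply/seteqP; split => [t [At Pt]|t [At nPt]]; split => //.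
      by move=> /interior_subset /(_ At).
    apply: contrapT => Pt; apply: nPt.
    have [e e0 h] := loc t At; apply: filterS (nearP t e e0) => u ut Au Pu; apply: Pt.
    by apply: (h u t) => //; rewrite subrr normr0.
by move=> t At; have : A t by []; rewrite -AB => -[].
Unshelve. all: by end_near. Qed.

(** * Normal form of unitary paths *)

Section UnitaryPaths.
Variables (R : realType) (n : nat).
Local Notation M2 := 'M[R]_(n + n).
Implicit Types (U V W K : M2) (X Y : R -> M2) (psi alpha : 'I_n -> R).

Lemma cis_inj2pi (x y : R) : cis x = cis y -> exists k : int, x = y + 2 * pi * k%:~R.
Proof.
move=> e; have c1 : cis (x - y) = 1.
  by rewrite cisD cisN e cisNr.
pose k := Num.floor ((x - y) / (2 * pi)).
have pi0 := @pi_gt0 R.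
have p0 : 0 < 2 * pi :> R by rewrite mulr_gt0.
exists k; set z := x - y - 2 * pi * k%:~R.
suff : z = 0 by rewrite /z => h; lra.
have z0 : 0 <= z < 2 * pi.
  have /andP[h1 h2] := mem_rg1_floor ((x - y) / (2 * pi)).
  rewrite -/k ler_pdivlMr // in h1; rewrite -/k ltr_pdivrMr // in h2.
  by apply/andP; split; rewrite /z; lra.
have cz : cis z = 1.
  by rewrite -(cisDpi2 k) /z subrK.
have /andP[z1 z2] := z0.
have cz1 : cos z = 1 by case: cz.
(* Halving the angle brings z / 2 into [0, pi[, where the sine vanishes only at 0. *)
have s2 : sin (z / 2) = 0.
  have : cos (z / 2 + z / 2) = 1 by rewrite -splitr.
  rewrite cosD -!expr2 => h; have := cos2Dsin2 (z / 2) => h2.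
  by apply/eqP; rewrite -sqrf_eq0; apply/eqP; lra.
apply/eqP; rewrite eq_le z1 andbT leNgt; apply/negP => zp.
have : 0 < sin (z / 2).
  by apply: sin_gt0_pi; rewrite divr_gt0 //= ltr_pdivrMr // mulrC.
by rewrite s2 ltxx.
Qed.

Lemma torus_inj2pi psi alpha : torus psi = torus alpha ->
  exists k : 'I_n -> int, psi = fun j => alpha j + 2 * pi * (k j)%:~R.
Proof.
move=> /(congr1 (@cxm R n)); rewrite /torus !rlmK => /matrixP e.
have /choice[k kP] : forall j, exists k : int, psi j = alpha j + 2 * pi * k%:~R.
  by move=> j; apply: cis_inj2pi; have := e j j; rewrite !mxE eqxx !mulr1n.
by exists k; apply/funext.
Qed.

(** With x = tan (a / 2), the angle a is bad for the eigenvalue exp (i psi_j) exactly when cos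
    (psi_j / 2) + x sin (psi_j / 2) = 0. The product of these factors is a nonzero polynomial, so
    some integer x is not a root. *)
Lemma exists_chart U : unitary U -> exists a, chart a U.
Proof.
move=> /unitary_diag[V [psi [uV ->]]].
pose p : {poly R} := \prod_j ((cos (psi j / 2))%:P + (sin (psi j / 2)) *: 'X).
have p0 : p != 0.
  apply/prodf_neq0 => j _; apply/eqP => /polyP e.
  have := e 0%N; rewrite !coefE /= mulr0 addr0 => c0.
  have := e 1%N; rewrite !coefE /= mulr1 add0r => s0.
  by have := cos2Dsin2 (psi j / 2); rewrite c0 s0 !expr0n /= addr0 => /esym/eqP; rewrite oner_eq0.
have [x px] : exists x, ~~ root p x.
  have us : uniq [seq (i%:R : R) | i <- iota 0 (size p)].
    by rewrite map_inj_uniq ?iota_uniq //; apply: mulrIn; rewrite oner_eq0.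
  have := contraNN (fun x => max_poly_roots p0 x us).
  rewrite size_map size_iota ltnn => /(_ isT) /allPn[x _ xp].
  by exists x.
exists (2 * atan x); rewrite chart_conj // /chart /scal -torusD.
pose w j : R[i] := cis (- (2 * atan x) + psi j) + 1.
have w0 j : w j != 0.
  apply/eqP => /eqP; rewrite eq_complex /= => /andP[/eqP h _].
  move: px; rewrite /root /p horner_prod => /prodf_neq0 /(_ j isT).
  rewrite !hornerE => /eqP; apply.
  have c0 : cos (atan x) != 0 by rewrite gt_eqF // cos_gt0_pihalf // atan_gtNpi2 atan_ltpi2.
  have s : sin (atan x) = x * cos (atan x) by rewrite -{2}(atanK x) /tan divfK.
  apply: (mulfI c0); rewrite mulr0.
  have -> : cos (atan x) * (cos (psi j / 2) + sin (psi j / 2) * x) = cos (psi j / 2 - atan x).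
    by rewrite cosB s; ring.
  apply/eqP; rewrite -sqrf_eq0; apply/eqP; move: h.
  have -> : - (2 * atan x) + psi j = (psi j / 2 - atan x) + (psi j / 2 - atan x) by field.
  rewrite cosD; have := cos2Dsin2 (psi j / 2 - atan x).
  by move: (cos _) (sin _) => c s' h1 h2; lra.
have diag1 : (1%:M : 'M[R[i]]_n) = diag_mx (\row_j 1).
  by apply/matrixP => i j; rewrite !mxE.
have -> : torus (fun j => - (2 * atan x) + psi j) + 1%:M = rlm (diag_mx (\row_j w j)).
  rewrite /torus -rlm1 -rlmD diag1.
  suff -> : diag_mx (\row_j w j) = diag_mx (\row_j cis (- (2 * atan x) + psi j)) + diag_mx (\row_j 1) by [].
  by apply/matrixP => k l; rewrite !mxE -mulrnDl.
have e : rlm (diag_mx (\row_j w j)) *m rlm (diag_mx (\row_j (w j)^-1)) = 1%:M.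
  rewrite -rlmM mulmx_diag -rlm1 diag1.
  suff -> : \row_j ((\row_j w j) 0 j * (\row_j (w j)^-1) 0 j) = \row_j (1 : R[i]) by [].
  by apply/rowP => j; rewrite !mxE mulfV.
by have [] := mulmx1_unit e.
Qed.

Lemma conj_tpath_is_path V psi : unitary V -> is_path (fun s => V *m tpath psi s *m V^T).
Proof.
move=> uV; have [oW cW] := uV; have sV := unitary_symplectic uV.
apply: is_pathI.
- by rewrite tpath0 mulmx1 unitaryVr.
- by move=> t; exact: (symplecticM (symplecticM sV (torus_symplectic _)) (symplecticT sV)).
- by apply: cmxM; [apply: cmxM; [exact: cmx_cst | exact: cmx_tpath] | exact: cmx_cst].
Qed.

Lemma conj_tpathD V psi phi : unitary V ->
  (fun s => V *m tpath (fun j => psi j + phi j) s *m V^T) =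
  pmul (fun s => V *m tpath psi s *m V^T) (fun s => V *m tpath phi s *m V^T).
Proof.
move=> [oV cV]; apply/funext => s; rewrite tpathD /pmul.
by rewrite !mulmxA -(mulmxA _ V^T V) oV mulmx1.
Qed.

(** The angles s a + 2 atan (s b_j) are interpolated with linear ones having the same end values.
    These agree with psi only modulo 2 pi, whence the new vector [beta]. *)
Lemma chart_path_homotopic a V psi : unitary V -> chart a (V *m torus psi *m V^T) ->
  exists2 beta, torus beta = torus psi &
    homotopic (chart_path a (V *m torus psi *m V^T)) (fun s => V *m tpath beta s *m V^T).
Proof.
move=> uV; rewrite chart_conj // => ca.
have [b bP] := torus_chart_path ca.
have ut := torus_unitary psi.
exists (fun j => a + 2 * atan (b j)).
  rewrite -[RHS](chart_path1 ut ca) bP; congr (@torus R n); apply/funext => j.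
  by rewrite !mul1r.
have sV := unitary_symplectic uV.
pose f (j : 'I_n) (p : R * R) : R := (1 - p.1) * (p.2 * a + 2 * atan (p.2 * b j)) +
  p.1 * (p.2 * (a + 2 * atan (b j))).
apply: (@homotopicI _ _ _ _ (fun s t => V *m torus (fun j => f j (s, t)) *m V^T)).
- apply: cmxM; last exact: cmx_cst.
  apply: cmxM; first exact: cmx_cst.
  rewrite [X in cmx X](_ : _ = fun p => torus (fun j => f j p)); last by apply/funext => -[].
  have c1 := @continuous_fst2 R; have c2 := @continuous_snd2 R.
  apply: cmx_torus => j; apply: ctsD.
    apply: ctsM; first by apply: ctsB => //; exact: ctsC.
    apply: ctsD; first by apply: ctsM => //; exact: ctsC.
    apply: ctsM; first exact: ctsC.
    move=> p; apply: (@continuous_comp _ _ _ (fun p : R * R => p.2 * b j) (@atan R)).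
      by apply: ctsM => //; exact: ctsC.
    exact: continuous_atan.
  by apply: ctsM => //; apply: ctsM => //; exact: ctsC.
- by move=> s t; exact: (symplecticM (symplecticM sV (torus_symplectic _)) (symplecticT sV)).
- move=> s; rewrite [X in torus X](_ : _ = fun=> 0); last first.
    by apply/funext => j; rewrite /f /= !mul0r atan0; ring.
  by rewrite torus0 mulmx1 unitaryVr.
- move=> s; rewrite chart_path_conj // bP; congr (V *m torus _ *m V^T).
  by apply/funext => j; rewrite /f /= !mul1r; ring.
- move=> t _; rewrite chart_path_conj // bP; congr (V *m torus _ *m V^T).
  by apply/funext => j; rewrite /f /=; ring.
- move=> t _; congr (V *m torus _ *m V^T).
  by apply/funext => j; rewrite /f /=; ring.
Qed.

Lemma cmx_chart_path (T : topologicalType) a (U : T -> M2) (s : T -> R) :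
  (forall x, unitary (U x)) -> (forall x, chart a (U x)) -> cmx U -> continuous s ->
  cmx (fun x => chart_path a (U x) (s x)).
Proof.
move=> uU cU cont cs; apply: cmxM.
  by apply: cmx_torus => j; apply: ctsM => //; exact: ctsC.
have cW : cmx (fun x => scal n (- a) *m U x) by apply: cmxM => //; exact: cmx_cst.
have cK : cmx (fun x => s x *: cayK a (U x)).
  apply: cmxZ => //; apply: cmxM; first by apply: cmxB => //; exact: cmx_cst.
  by apply: cmx_inv => //; apply: cmxD => //; exact: cmx_cst.
apply: cmxM; first by apply: cmxD => //; exact: cmx_cst.
apply: cmx_inv; last by apply: cmxB => //; exact: cmx_cst.
by move=> x; apply: skew_unitmx; rewrite linearZ /= cayK_skew // scalerN.
Qed.

Definition restr X (t : R) : R -> M2 := fun s => X (t * s).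

Lemma restr_path X t : cmx X -> X 0 = 1%:M -> (forall t, unitary (X t)) ->
  is_path (restr X t).
Proof.
move=> cX X0 uX; apply: is_pathI; first by rewrite /restr mulr0.
  by move=> s; exact: (unitary_symplectic (uX _)).
by apply: (cmx_comp _ cX); apply: ctsM; [exact: ctsC | exact: cts_id].
Qed.

(* As long as [X] stays in the chart, [X|[0,t]] differs from the Cayley path
   to [X t] by a fixed homotopy class of loops. *)
Lemma restr_chart_homotopic X a u v : cmx X -> X 0 = 1%:M ->
  (forall t, unitary (X t)) ->
  (forall s, 0 <= s <= 1 -> chart a (X (u + s * (v - u)))) ->
  homotopic (pmul (restr X u) (pinv (chart_path a (X u))))
            (pmul (restr X v) (pinv (chart_path a (X v)))).
Proof.
move=> cX X0 uX cha.
pose tau (s : R) := u + clamp s * (v - u).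
have ctau : continuous tau.
  apply: ctsD; first exact: ctsC.
  by apply: ctsM; [exact: clamp_continuous | exact: ctsC].
have chtau s : chart a (X (tau s)) by apply: cha; exact: clamp_in.
have c1 := @continuous_fst2 R; have c2 := @continuous_snd2 R.
have ctau1 : continuous (fun p : R * R => tau p.1).
  by move=> p; apply: (@continuous_comp _ _ _ fst tau); [exact: c1 | exact: ctau].
have u0 s t : unitary (chart_path a (X (tau s)) t) by exact: chart_path_unitary.
have t0 : tau 0 = u by rewrite /tau clamp0 mul0r addr0.
have t1 : tau 1 = v by rewrite /tau clamp1 mul1r addrC subrK.
apply: (@homotopicI _ _ _ _ (fun s t => X (tau s * t) *m invmx (chart_path a (X (tau s)) t))).
- apply: cmxM.
    by apply: (cmx_comp _ cX); exact: ctsM.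
  apply: cmx_inv; first by move=> p; exact: (unitary_unitmx (u0 _ _)).
  by apply: cmx_chart_path => //; exact: (cmx_comp ctau1 cX).
- move=> s t; apply: symplecticM; first exact: (unitary_symplectic (uX _)).
  by apply: symplecticV; exact: (unitary_symplectic (u0 _ _)).
- by move=> s; rewrite mulr0 X0 chart_path0 invmx1 mulmx1.
- move=> s; rewrite mulr1 chart_path1 // mulmxV ?unitary_unitmx //.
  by rewrite /pmul /Defs.pinv /restr mulr1 chart_path1 -?t0 // mulmxV ?unitary_unitmx.
- by move=> t _; rewrite t0.
- by move=> t _; rewrite t1.
Qed.

End UnitaryPaths.

(** * Sandwiching a path between central rotations *)

Section Sandwich.
Variables (R : realType) (n : nat).
Local Notation M2 := 'M[R]_(n + n).
Implicit Types (U V : M2) (X Y Z : R -> M2) (psi alpha : 'I_n -> R).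

Lemma pmulA X Y Z : pmul X (pmul Y Z) = pmul (pmul X Y) Z.
Proof. by apply/funext => t; rewrite /pmul mulmxA. Qed.

Lemma homotopic_mulKV X Y : is_path X -> is_path Y ->
  homotopic (pmul (pmul X (pinv Y)) Y) X.
Proof.
move=> pX pY; apply: homotopic_eq.
  by apply: is_path_pmul => //; apply: is_path_pmul => //; exact: is_path_pinv.
by move=> t t01; rewrite /pmul /Defs.pinv mulmxKV // (is_path_unit pY).
Qed.

Lemma homotopic_mulK X Y : is_path X -> is_path Y ->
  homotopic (pmul (pmul X Y) (pinv Y)) X.
Proof.
move=> pX pY; apply: homotopic_eq.
  by apply: is_path_pmul; [exact: is_path_pmul | exact: is_path_pinv].
by move=> t t01; rewrite /pmul /Defs.pinv mulmxK // (is_path_unit pY).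
Qed.

Lemma homotopic_pinvM X Y : is_path X -> is_path Y ->
  homotopic (pinv (pmul X Y)) (pmul (pinv Y) (pinv X)).
Proof.
move=> pX pY; apply: homotopic_eq; first by apply: is_path_pinv; exact: is_path_pmul.
by move=> t t01; rewrite /pmul /Defs.pinv invmx_mul // (is_path_unit pX, is_path_unit pY).
Qed.

Lemma loop_central X Z : is_path X -> is_path Z -> Z 1 = 1%:M ->
  homotopic (pmul Z X) (pmul X Z).
Proof. by move=> pX pZ Z1; exact: homotopic_central pX pZ Z1. Qed.

(** Diagonalizations need not vary continuously where eigenvalues collide, so only the existence of
    a normal form for X on [0, t] is propagated; V and alpha may jump with t. *)
Lemma unitary_path_normal_form X : cmx X -> X 0 = 1%:M -> (forall t, unitary (X t)) ->
  exists V alpha, unitary V /\ homotopic X (fun s => V *m tpath alpha s *m V^T).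
Proof.
move=> cX X0 uX.
pose P t := exists V alpha, unitary V /\ homotopic (restr X t) (fun s => V *m tpath alpha s *m V^T).
suff : P 1 by move=> [V [alpha [uV h]]]; exists V, alpha; split => //; move: h;
  rewrite [restr X 1](_ : _ = X) //; apply/funext => s; rewrite /restr mul1r.
have pr t : is_path (restr X t) by exact: restr_path.
apply: (@segment_locally_constant R P 0 1); rewrite ?ler01 ?lexx //.
  exists 1%:M, (fun=> 0); split; first exact: unitary1.
  rewrite [X in homotopic _ X](_ : _ = restr X 0); first exact: homotopic_refl.
  apply/funext => s; rewrite /restr mul0r X0 trmx1 mulmx1 mul1mx /tpath.
  by under eq_fun do rewrite mulr0; exact: torus0.
move=> t0 _; have [a ca] := exists_chart (uX t0).
pose f t := \det (scal n (- a) *m X t + 1%:M).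
have cf : continuous f.
  apply: continuous_det; apply: cmxD; last exact: cmx_cst.
  by apply: cmxM => //; exact: cmx_cst.
have f0 : f t0 != 0 by move: ca; rewrite /chart unitmxE unitfE.
have : \forall t \near t0, f t != 0.
  have := cvgr_neq0 (f t0) (cf t0) f0; exact.
move=> /nbhs_ballP[e /= e0 be].
have cha t : `|t - t0| < e -> chart a (X t).
  by move=> h; rewrite /chart unitmxE unitfE; apply: be; rewrite /ball /= distrC.
exists e => // u v hu hv _ _ [V [alpha [uV hV]]].
have Xu : X u = V *m torus alpha *m V^T.
  by have := homotopic_end hV; rewrite /restr mulr1 tpath_1.
have chs s : 0 <= s <= 1 -> chart a (X (u + s * (v - u))).
  move=> /andP[s0 s1]; apply: cha.
  rewrite (_ : _ - t0 = (1 - s) * (u - t0) + s * (v - t0)); last by ring.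
  apply: le_lt_trans (ler_normD _ _) _; rewrite !normrM (ger0_norm s0).
  rewrite ger0_norm ?subr_ge0 //.
  move: (`|u - t0|) (`|v - t0|) hu hv => x y hx hy.
  have [s2|s2] := leP s (1 / 2); nra.
have key := restr_chart_homotopic cX X0 uX chs.
have cu : chart a (V *m torus alpha *m V^T) by rewrite -Xu; exact: cha.
have [beta eb hb] := chart_path_homotopic uV cu.
rewrite -Xu in hb.
have [k kE] := torus_inj2pi eb.
(* At u, the Cayley path to X u equals the known normal form times the loop L up to homotopy; the
   chart carries this discrepancy unchanged to v. *)
pose L := @tpath R n (fun j => 2 * pi * (k j)%:~R).
have L1 : L 1 = 1%:M by exact: tpath_loop.
have pL : is_path L by exact: is_path_tpath.
pose C (W : M2) (g : 'I_n -> R) := fun s : R => W *m @tpath R n g s *m W^T.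
have pC W g : unitary W -> is_path (C W g) by exact: conj_tpath_is_path.
have CL W : unitary W -> homotopic (C W (fun j => 2 * pi * (k j)%:~R)) L.
  by move=> uW; exact: homotopic_loop_conj.
have hb' : homotopic (chart_path a (X u)) (pmul (C V alpha) L).
  apply: (homotopic_trans hb); rewrite kE conj_tpathD //.
  by apply: homotopic_pmul; [exact/homotopic_refl/pC | exact: CL].
have h1 : homotopic (pmul (restr X v) (pinv (chart_path a (X v)))) (pinv L).
  apply: (homotopic_trans (homotopic_sym key)).
  apply: (homotopic_trans (homotopic_pmul hV (homotopic_pinv hb'))).
  have pCV := pC V alpha uV.
  have pLi := is_path_pinv pL.
  apply: (homotopic_trans (homotopic_pmul (homotopic_refl pCV) (homotopic_pinvM pCV pL))).
  rewrite pmulA.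
  have Li1 : pinv L 1 = 1%:M by rewrite /Defs.pinv L1 invmx1.
  apply: (homotopic_trans (homotopic_pmul (homotopic_sym (loop_central pCV pLi Li1))
     (homotopic_refl (is_path_pinv pCV)))).
  exact: homotopic_mulK.
have [V' [psi [uV' Xv]]] := unitary_diag (uX v).
have cv : chart a (V' *m torus psi *m V'^T) by rewrite -Xv; exact: cha.
have [beta' _ hb2] := chart_path_homotopic uV' cv.
rewrite -Xv in hb2.
have pcv : is_path (chart_path a (X v)) by exact: homotopic_path hb2.
(* The inverse of L is homotopic to its conjugate by V', so it can be absorbed in the angles at
   v. *)
exists V', (fun j => - (2 * pi * (k j)%:~R) + beta' j); split => //.
apply: (homotopic_trans (homotopic_sym (homotopic_mulKV (pr v) pcv))).
apply: (homotopic_trans (homotopic_pmul h1 hb2)).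
have pC' : is_path (C V' beta') by exact: pC.
rewrite (conj_tpathD (fun j => - (2 * pi * (k j)%:~R)) beta' uV').
apply: homotopic_pmul; last exact: homotopic_refl pC'.
apply: homotopic_sym; rewrite -(tpathN (fun j => 2 * pi * (k j)%:~R)).
apply: homotopic_loop_conj => //; first exact: is_path_tpath.
by rewrite (tpathN (fun j => 2 * pi * (k j)%:~R)) -/L /Defs.pinv L1 invmx1.
Qed.

Lemma path_polar X : is_path X -> exists U P : R -> M2,
  [/\ cmx U, U 0 = 1%:M & forall t, unitary (U t)] /\
  [/\ cmx P, P 0 = 1%:M, (forall t, spd (P t)) & forall t, symplectic (P t)] /\
  homotopic X (pmul U P).
Proof.
move=> pX; have /is_path_clamp[X0 sX cX] := pX.
pose Xc t := X (clamp t); pose P t := sqrtmx ((Xc t)^T *m Xc t).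
have H t := symplectic_polar (sX t).
have pP t : spd (P t) by have [] := H t.
have sP t : symplectic (P t) by have [] := H t.
have cP : cmx P.
  apply: cmx_sqrtmx; last by apply: cmxM => //; exact: cmxT.
  by move=> t; apply: trmx_mul_spd; exact: symplectic_unitmx (sX t).
have P0 : P 0 = 1%:M by rewrite /P /Xc X0 trmx1 mulmx1 sqrtmx1.
exists (fun t => Xc t *m invmx (P t)), P; split; [split|split].
- by apply: cmxM => //; apply: cmx_inv => // t; exact: spd_unitmx.
- by rewrite P0 /Xc X0 invmx1 mulmx1.
- by move=> t; have [] := H t.
- by split.
apply: (homotopic_trans (homotopic_clamp pX)).
apply: homotopic_eq; first exact: homotopic_path (homotopic_sym (homotopic_clamp pX)).
by move=> t _; rewrite /pmul /= mulmxKV // spd_unitmx.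
Qed.

Lemma rpath_central (m : int) X : is_path X ->
  homotopic (pmul (rpath n (pi * m%:~R)) X) (pmul X (rpath n (pi * m%:~R))).
Proof.
move=> pX; have [c cE] := torus_pi_scalar R n m.
by apply: (@homotopic_central _ _ _ _ c) => //; [exact: is_path_rpath | rewrite /rpath tpath_1].
Qed.

Lemma sum_ord_lt (m r : nat) : \sum_(j < m) ((j < r)%N : nat)%:Z = (minn m r)%:Z.
Proof.
elim: m => [|m IH]; first by rewrite big_ord0 min0n.
rewrite big_ord_recr /= IH -PoszD; congr Posz.
by case: (ltnP m r) => h; rewrite ?addn1 ?addn0; [rewrite !(minn_idPl _) ?(ltnW h) | rewrite !(minn_idPr _) ?(leqW h)].
Qed.

(** Divide the total number of turns by n: q turns in every coordinate, plus one more in the first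
    r, have the same total. The first part is the central R_(2 pi q). *)
Lemma loop_decomposition (k : 'I_n -> int) : (0 < n)%N -> exists (q : int) (r : nat),
  homotopic (@tpath R n (fun j => 2 * pi * (k j)%:~R))
            (@tpath R n (fun j => 2 * pi * (q + ((j < r)%N : nat)%:Z)%:~R)).
Proof.
move=> n0; set K := \sum_i k i.
have n0' : n%:Z != 0 by rewrite eqz_nat -lt0n.
have [r rE] : exists r : nat, (K %% n)%Z = r%:Z.
  by case: (modz_ge0 K n0') => h; exists `|(K %% n)%Z|%N; rewrite gez0_abs.
exists (K %/ n)%Z, r; apply: loop_homotopic => //.
rewrite big_split /= sumr_const card_ord sum_ord_lt -/K.
have rn : (r < n)%N by rewrite -ltz_nat -rE ltz_pmod // ltz_nat.
by rewrite (minn_idPr (ltnW rn)) -rE {1}(divz_eq K n) pmulrn mulrzz.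
Qed.

(* The width 6 collects 1/2 + 1/2 from the positive definite part (rounded up to 1 + 1), 2 from the
   angles in [0, 2pi[, and 2 from the remainder of the loop modulo the full rotation. *)
Lemma rpath_sandwich X : (0 < n)%N -> is_path X -> exists q : int,
  in_cone (pmul X (rpath n (pi * (- q)%:~R))) /\
  in_cone (pmul (rpath n (pi * (q + 6)%:~R)) (pinv X)).
Proof.
move=> n0 pX; have [U [P [[cU U0 uU] [[cP P0 pP sP] hX]]]] := path_polar pX.
have pathP : is_path P by exact: is_pathI.
have pi0 := @pi_ge0 R.
have pi2 : 0 <= 2 * pi :> R by rewrite mulr_ge0.
have [V [alpha [uV hU]]] := unitary_path_normal_form cU U0 uU.
(* Whole turns are split off: the remaining angles give A between 1 and R_(2 pi), and the turns form
   a loop whose class depends only on their total. *)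
pose k j := Num.floor (alpha j / (2 * pi)).
pose al j := alpha j - 2 * pi * (k j)%:~R.
have al_ge0 j : 0 <= al j /\ al j <= 2 * pi.
  have p0 : 0 < 2 * pi :> R by rewrite mulr_gt0 // pi_gt0.
  have /andP[h1 h2] := mem_rg1_floor (alpha j / (2 * pi)).
  rewrite -/(k j) ler_pdivlMr // in h1; rewrite -/(k j) ltr_pdivrMr // in h2.
  by rewrite /al; split; lra.
have [q [r hL]] := loop_decomposition k n0.
pose A s := V *m @tpath R n al s *m V^T.
pose A' s := V *m @tpath R n (fun j => 2 * pi - al j) s *m V^T.
pose B := @tpath R n (fun j => 2 * pi * (q + ((j < r)%N : nat)%:Z)%:~R).
have pathA : is_path A by exact: conj_tpath_is_path.
have pathB : is_path B by exact: is_path_tpath.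
have sV := unitary_symplectic uV.
have VT : V^T = invmx V by rewrite unitary_invmx.
have coneA : in_cone A.
  rewrite /A VT; apply: in_coneI; apply: psd_hamiltonian_conj => //.
  by apply: psd_tpath => j; have [] := al_ge0 j.
have coneA' : in_cone A'.
  rewrite /A' VT; apply: in_coneI; apply: psd_hamiltonian_conj => //.
  by apply: psd_tpath => j; have [_ ?] := al_ge0 j; rewrite subr_ge0.
have hX2 : homotopic X (pmul (pmul A B) P).
  apply: (homotopic_trans hX); apply: homotopic_pmul; last exact: homotopic_refl.
  apply: (homotopic_trans hU).
  have -> : alpha = fun j => al j + 2 * pi * (k j)%:~R.
    by apply/funext => j; rewrite /al subrK.
  rewrite conj_tpathD //; apply: homotopic_pmul; first exact: homotopic_refl.
  apply: homotopic_trans hL; apply: homotopic_loop_conj => //; first exact: is_path_tpath.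
  exact: tpath_loop.
pose z (m : int) := rpath n (pi * m%:~R : R).
have pz m : is_path (z m) by exact: is_path_rpath.
have zD m m' : z (m + m') = pmul (z m) (z m') by rewrite /z intrD mulrDr rpathD.
(* R_(pi/2) ends at J, which is not scalar; a second quarter turn is appended to reach a central
   rotation. *)
have coneP : in_cone (pmul P (z 1)).
  have -> : z 1 = pmul (rpath n (pi / 2)) (rpath n (pi / 2)).
    by rewrite -rpathD /z mulr1 -splitr.
  rewrite pmulA; apply: in_cone_pmul; first exact: cone_spd_rpath.
  by apply: in_cone_rpath; rewrite divr_ge0.
have coneP' : in_cone (pmul (pinv P) (z 1)).
  have -> : z 1 = pmul (rpath n (pi / 2)) (rpath n (pi / 2)).
    by rewrite -rpathD /z mulr1 -splitr.
  rewrite pmulA; apply: in_cone_pmul; last by apply: in_cone_rpath; rewrite divr_ge0.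
  apply: cone_spd_rpath.
  - by apply: cmx_inv => // t; exact: spd_unitmx.
  - by rewrite /Defs.pinv P0 invmx1.
  - by move=> t; exact: spdV.
  - by move=> t; exact: symplecticV.
have coneB : in_cone (pmul B (z (- 2 * q))).
  rewrite /B /z -tpathD; apply: in_cone_tpath => j.
  by rewrite intrD !intrM /=; case: (_ < _)%N => /=; rewrite ?mulr1z ?mulr0z; lra.
have coneB' : in_cone (pmul (z (2 * q + 2)) (pinv B)).
  rewrite /B /z -tpathN -tpathD; apply: in_cone_tpath => j.
  by rewrite !intrD !intrM /=; case: (_ < _)%N => /=; rewrite ?mulr1z ?mulr0z; lra.
have coneA2 : in_cone (pmul (z 2) (pinv A)).
  rewrite (_ : pmul _ _ = A') //; apply/funext => s; rewrite /pmul /Defs.pinv /A /A'.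
  have uVm := unitary_unitmx uV; have [_ cV] := uV.
  have uT : tpath al s \in unitmx := symplectic_unitmx (torus_symplectic _).
  have -> : invmx (V *m tpath al s *m V^T) = V *m tpath (fun j => - al j) s *m V^T.
    rewrite tpathN !invmx_mul ?unitmx_mul ?unitmx_tr ?uVm // VT invmxK.
    by rewrite -VT mulmxA.
  rewrite (tpathD (fun=> 2 * pi) (fun j => - al j)) /pmul.
  have -> : z 2 s = scal n (s * (2 * pi)) by rewrite /z /rpath /tpath /scal [pi * _]mulrC.
  have -> : tpath (fun=> 2 * pi) s = scal n (s * (2 * pi)) by [].
  by rewrite !mulmxA scal_comm.
(* Lower bounds: A >= 1, B >= R_(2 q pi), P >= R_(-pi). Upper bounds: A <= R_(2 pi), B <= R_((2 q +
   2) pi), P <= R_pi, with total 2 q + 5 = (2 q - 1) + 6. *)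
exists (2 * q - 1); split.
  have -> : - (2 * q - 1) = (- 2 * q) + 1 by ring.
  rewrite -/(z _).
  apply: (in_cone_homotopic (Y := pmul (pmul A (pmul B (z (- 2 * q)))) (pmul P (z 1)))).
    apply: (homotopic_trans (homotopic_pmul hX2 (homotopic_refl (pz _)))).
    have pAB := is_path_pmul pathA pathB.
    have -> : pmul (pmul (pmul A B) P) (z (- 2 * q + 1)) =
      pmul (pmul (pmul A B) (pmul P (z (- 2 * q)))) (z 1) by rewrite (zD (- 2 * q) 1) !pmulA.
    have -> : pmul (pmul A (pmul B (z (- 2 * q)))) (pmul P (z 1)) =
      pmul (pmul (pmul A B) (pmul (z (- 2 * q)) P)) (z 1) by rewrite !pmulA.
    apply: homotopic_pmul; last exact: homotopic_refl (pz _).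
    apply: homotopic_pmul; first exact: homotopic_refl pAB.
    by apply: homotopic_sym; exact: rpath_central.
  by apply: in_cone_pmul => //; exact: in_cone_pmul.
have -> : 2 * q - 1 + 6 = 1 + (2 * q + 2) + 2 by ring.
rewrite -/(z _).
apply: (in_cone_homotopic (Y := pmul (pmul (pmul (pinv P) (z 1)) (pmul (z (2 * q + 2)) (pinv B)))
   (pmul (z 2) (pinv A)))); last by apply: in_cone_pmul => //; exact: in_cone_pmul.
have pP' := is_path_pinv pathP; have pA' := is_path_pinv pathA; have pB' := is_path_pinv pathB.
have pAB := is_path_pmul pathA pathB.
set zb := z (2 * q + 2).
have h1 : homotopic (pinv X) (pmul (pinv P) (pmul (pinv B) (pinv A))).
  apply: (homotopic_trans (homotopic_pinv hX2)).
  apply: (homotopic_trans (homotopic_pinvM pAB pathP)).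
  by apply: homotopic_pmul; [exact: homotopic_refl | exact: homotopic_pinvM].
apply: (homotopic_trans (homotopic_pmul (homotopic_refl (pz _)) h1)).
have pPB : is_path (pmul (pinv P) (pinv B)) by exact: is_path_pmul.
have rf Y : is_path Y -> homotopic Y Y := @homotopic_refl R n Y.
have -> : pmul (z (1 + (2 * q + 2) + 2)) (pmul (pinv P) (pmul (pinv B) (pinv A))) =
  pmul (pmul (z 1) zb) (pmul (pmul (z 2) (pmul (pinv P) (pinv B))) (pinv A)).
  by rewrite (zD (1 + (2 * q + 2)) 2) (zD 1 (2 * q + 2)) !pmulA.
have zc m Y : is_path Y -> homotopic (pmul (z m) Y) (pmul Y (z m)) := @rpath_central m Y.
have pzb : is_path zb := pz _.
have pR : is_path (pmul (pinv B) (pmul (z 2) (pinv A))) :=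
  is_path_pmul pB' (is_path_pmul (pz 2) pA').
(* Three central moves bring R_(2 pi) next to A^-1, [zb] next to B^-1 and R_pi next to P^-1. *)
have e1 := homotopic_pmul (rf _ (is_path_pmul (pz 1) pzb))
  (homotopic_pmul (zc 2 _ pPB) (rf _ pA')).
apply: (homotopic_trans e1).
have -> : pmul (pmul (z 1) zb) (pmul (pmul (pmul (pinv P) (pinv B)) (z 2)) (pinv A)) =
  pmul (z 1) (pmul (pmul zb (pinv P)) (pmul (pinv B) (pmul (z 2) (pinv A)))).
  by rewrite !pmulA.
have e2 := homotopic_pmul (rf _ (pz 1)) (homotopic_pmul (zc (2 * q + 2) _ pP') (rf _ pR)).
apply: (homotopic_trans e2).
have -> : pmul (z 1) (pmul (pmul (pinv P) zb) (pmul (pinv B) (pmul (z 2) (pinv A)))) =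
  pmul (pmul (z 1) (pinv P)) (pmul zb (pmul (pinv B) (pmul (z 2) (pinv A)))).
  by rewrite !pmulA.
have e3 := homotopic_pmul (zc 1 _ pP') (rf _ (is_path_pmul pzb pR)).
by rewrite -[X in homotopic _ X]pmulA -(pmulA zb).
Qed.

End Sandwich.

(** * Arguments of complex-valued paths *)

Section Lifts.
Variables (R : realType).

Definition ccts (T : topologicalType) (f : T -> R[i]) : Prop :=
  continuous (fun x => complex.Re (f x)) /\ continuous (fun x => complex.Im (f x)).

Section ComplexContinuity.
Variable T : topologicalType.
Implicit Types f g : T -> R[i].

Lemma cctsC (c : R[i]) : ccts (fun _ : T => c).
Proof. by split; exact: ctsC. Qed.

Lemma cctsD f g : ccts f -> ccts g -> ccts (fun x => f x + g x).
Proof.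
move=> [f1 f2] [g1 g2]; split.
  rewrite [X in continuous X](_ : _ = fun x => complex.Re (f x) + complex.Re (g x)).
    exact: ctsD.
  by apply/funext => x; case: (f x) => ? ?; case: (g x).
rewrite [X in continuous X](_ : _ = fun x => complex.Im (f x) + complex.Im (g x)).
  exact: ctsD.
by apply/funext => x; case: (f x) => ? ?; case: (g x).
Qed.

Lemma cctsM f g : ccts f -> ccts g -> ccts (fun x => f x * g x).
Proof.
move=> [f1 f2] [g1 g2]; split.
  rewrite [X in continuous X](_ : _ = fun x =>
    complex.Re (f x) * complex.Re (g x) - complex.Im (f x) * complex.Im (g x)).
    by apply: ctsB; exact: ctsM.
  by apply/funext => x; case: (f x) => ? ?; case: (g x).
rewrite [X in continuous X](_ : _ = fun x =>
  complex.Re (f x) * complex.Im (g x) + complex.Im (f x) * complex.Re (g x)).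
  by apply: ctsD; exact: ctsM.
by apply/funext => x; case: (f x) => ? ?; case: (g x).
Qed.

Lemma cctsJ f : ccts f -> ccts (fun x => (f x)^*%C).
Proof.
move=> [f1 f2]; split.
  rewrite [X in continuous X](_ : _ = fun x => complex.Re (f x)) //.
  by apply/funext => x; case: (f x).
rewrite [X in continuous X](_ : _ = fun x => - complex.Im (f x)); first exact: ctsN.
by apply/funext => x; case: (f x).
Qed.

Lemma ccts_sum (I : Type) (s : seq I) (P : pred I) (f : I -> T -> R[i]) :
  (forall i, ccts (f i)) -> ccts (fun x => \sum_(i <- s | P i) f i x).
Proof.
move=> cf; elim: s => [|i s IH].
  by under eq_fun do rewrite big_nil; exact: cctsC.
rewrite [X in ccts X](_ : _ = fun x =>
  (if P i then f i x else 0) + \sum_(j <- s | P j) f j x); last first.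
  by apply/funext => x; rewrite big_cons; case: ifP => //; rewrite add0r.
apply: cctsD => //; case: (P i) => //; exact: cctsC.
Qed.

Lemma ccts_prod (I : Type) (s : seq I) (f : I -> T -> R[i]) :
  (forall i, ccts (f i)) -> ccts (fun x => \prod_(i <- s) f i x).
Proof.
move=> cf; elim: s => [|i s IH].
  by under eq_fun do rewrite big_nil; exact: cctsC.
by under eq_fun do rewrite big_cons; exact: cctsM.
Qed.

Lemma ccts_detC n (A : T -> 'M[R]_(n + n)) : cmx A -> ccts (fun x => detC (A x)).
Proof.
move=> cA; rewrite /detC /determinant; apply: ccts_sum => s.
apply: cctsM; first exact: cctsC.
apply: ccts_prod => i; split => /=.
  rewrite [X in continuous X](_ : _ = fun x => A x (lshift n i) (lshift n (s i))); first exact: cA.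
  by apply/funext => x; rewrite !mxE.
rewrite [X in continuous X](_ : _ = fun x => A x (rshift n i) (lshift n (s i))); first exact: cA.
by apply/funext => x; rewrite !mxE.
Qed.

End ComplexContinuity.

Lemma ccts_comp (S T : topologicalType) (h : S -> T) (f : T -> R[i]) :
  continuous h -> ccts f -> ccts (f \o h).
Proof.
move=> ch [f1 f2]; split => x.
  by apply: (@continuous_comp _ _ _ h (fun y => complex.Re (f y))); [exact: ch | exact: f1].
by apply: (@continuous_comp _ _ _ h (fun y => complex.Im (f y))); [exact: ch | exact: f2].
Qed.

Lemma conjcM (x y : R[i]) : (x * y)^*%C = x^*%C * y^*%C.
Proof. exact: rmorphM. Qed.

(** The modulus is left free because [rho] is not unimodular. *)
Definition is_lift (g : R -> R[i]) (theta : R -> R) : Prop :=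
  continuous theta /\ forall t, exists2 r : R, 0 < r & g t = (r%:C)%C * cis (theta t).

Lemma atan_arg (x y : R) : 0 < x ->
  exists2 r : R, 0 < r & Complex x y = (r%:C)%C * cis (atan (y / x)).
Proof.
move=> x0; set a := atan (y / x).
have c0 : 0 < cos a by rewrite cos_gt0_pihalf // atan_gtNpi2 atan_ltpi2.
exists (x / cos a); first exact: divr_gt0.
have cn : cos a != 0 by rewrite gt_eqF.
have xn : x != 0 by rewrite gt_eqF.
have s : sin a = (y / x) * cos a by rewrite -(atanK (y / x)) -/a /tan divfK.
apply/eqP; rewrite eq_complex /= s; apply/andP; split; apply/eqP.
  by field; rewrite ?cn ?xn.
by field; rewrite ?cn ?xn.
Qed.

(** When g' / g stays in the right half-plane, its argument is a continuous arctangent, which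
    corrects a lift of g into one of g'. *)
Lemma lift_near (g g' : R -> R[i]) theta : ccts g -> ccts g' ->
  (forall t, 0 < complex.Re (g' t * (g t)^*%C)) -> is_lift g theta ->
  is_lift g' (fun t => theta t +
    atan (complex.Im (g' t * (g t)^*%C) / complex.Re (g' t * (g t)^*%C))).
Proof.
move=> cg cg' pos [ct lt]; have [w1 w2] := cctsM cg' (cctsJ cg); split.
  apply: ctsD => // t.
  apply: (@continuous_comp _ _ _ (fun t => complex.Im (g' t * (g t)^*%C) /
    complex.Re (g' t * (g t)^*%C)) (@atan R)); last exact: continuous_atan.
  by apply: ctsM => //; apply: ctsV => // u; rewrite gt_eqF.
move=> t; have [r r0 gt] := lt t.
have [r' r'0 e] := atan_arg (complex.Im (g' t * (g t)^*%C)) (pos t).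
have gg : g' t * (g t)^*%C = (r'%:C)%C *
  cis (atan (complex.Im (g' t * (g t)^*%C) / complex.Re (g' t * (g t)^*%C))).
  by rewrite -e; case: (g' t * _).
exists (r' / r); first exact: divr_gt0.
have rc : (r%:C)%C != 0 :> R[i] by rewrite (inj_eq (@complexI R)) gt_eqF.
rewrite cisD.
set a := atan _ in gg *.
have gJ : (g t)^*%C = (r%:C)%C * (cis (theta t))^*%C by rewrite gt conjcM conjc_real.
have : g' t * (g t)^*%C * cis (theta t) = (r%:C)%C * g' t.
  rewrite gJ mulrA -mulrA [X in _ * X]mulrC cisNr mulr1 mulrC; by [].
rewrite gg => h.
apply: (mulfI rc); rewrite -h rmorphM fmorphV mulrACA mulrA.
rewrite [_ * cis a]mulrC.
by field.
Qed.

(** The difference of two lifts is continuous with values in 2 pi Z, hence constant. *)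
Lemma lift_unique (g : R -> R[i]) theta theta' : is_lift g theta -> is_lift g theta' ->
  theta 1 - theta 0 = theta' 1 - theta' 0.
Proof.
move=> [ct lt] [ct' lt'].
have pi0 := @pi_gt0 R.
have dk t : exists k : int, theta t - theta' t = 2 * pi * k%:~R.
  have [r r0 e] := lt t; have [r' r'0 e'] := lt' t.
  have ec : (r%:C)%C * cis (theta t) = (r'%:C)%C * cis (theta' t) by rewrite -e.
  have rr : r = r'.
    have : (r%:C)%C * cis (theta t) * ((r%:C)%C * cis (theta t))^*%C =
           (r'%:C)%C * cis (theta' t) * ((r'%:C)%C * cis (theta' t))^*%C by rewrite ec.
    rewrite !conjcM !conjc_real mulrACA cisNr mulr1 mulrACA cisNr mulr1 -!rmorphM.
    move=> /complexI; rewrite -!expr2 => /eqP; rewrite eqrXn2 ?ltW // => /eqP; by [].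
  have rc : (r%:C)%C != 0 :> R[i] by rewrite (inj_eq (@complexI R)) gt_eqF.
  move: ec; rewrite -rr => /(mulfI rc) /cis_inj2pi[k kE]; exists k; rewrite kE; ring.
pose d t := theta t - theta' t.
suff : d 1 = d 0 by rewrite /d => h; lra.
have cd : continuous d by exact: ctsB.
apply: (@segment_locally_constant R (fun t => d t = d 0) 0 1); rewrite ?ler01 ?lexx //.
move=> t _; have : \forall u \near t, `|d t - d u| < pi.
  by apply: (@cvgr_dist_lt _ _ _ _ _ d (d t) (cd t)).
move=> /nbhs_ballP[e /= e0 be]; exists e => // u v hu hv _ _ du.
have hu' := be u; have hv' := be v.
have : `|d v - d u| < 2 * pi.
  rewrite (_ : d v - d u = (d t - d u) - (d t - d v)); last by ring.
  apply: le_lt_trans (ler_normB _ _) _.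
  have := hu' _; have := hv' _; rewrite /ball /= ![`|t - _|]distrC.
  by move=> /(_ hv) h1 /(_ hu) h2; lra.
have [k kE] := dk v; have [l lE] := dk u.
rewrite -du /d kE lE -mulrBr -intrB normrM gtr0_norm ?mulr_gt0 //.
rewrite -[ltRHS]mulr1 ltr_pM2l ?mulr_gt0 // -intr_norm -[1]/(1%:~R) ltr_int => kl.
have kl0 : `|k - l| <= 0 by rewrite -ltzD1 add0r.
by rewrite normr_le0 subr_eq0 in kl0; rewrite (eqP kl0).
Qed.

(** Tube lemma: at s = s0 the real part is |G s0 t|^2 > 0, and compactness of [0, 1] makes the
    neighbourhood of s0 uniform in t. *)
Lemma lift_tube (G : R -> R -> R[i]) (s0 : R) :
  ccts (fun p : R * R => G p.1 p.2) -> (forall s t, G s t != 0) ->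
  exists2 e, 0 < e & forall s, `|s - s0| < e -> forall t, 0 <= t <= 1 ->
    0 < complex.Re (G s t * (G s0 t)^*%C).
Proof.
move=> cG G0.
pose H (p : R * R) := complex.Re (G p.1 p.2 * (G s0 p.2)^*%C).
have cH : continuous H.
  have cs : ccts (fun p : R * R => G s0 p.2).
    apply: (ccts_comp (h := fun p : R * R => (s0, p.2)) _ cG).
    by apply: continuous_pair; [exact: ctsC | exact: continuous_snd2].
  by have [] := cctsM cG (cctsJ cs).
have := @segment_compact R 0 1; rewrite compact_near_coveringP => cov.
have := cov R (nbhs s0) (fun s t => 0 < H (s, t)) _.
have Hp t : 0 < H (s0, t).
  rewrite /H /=; case: (G s0 t) (G0 s0 t) => x y; rewrite eq_complex /= => xy.
  rewrite mulrN opprK -!expr2 lt_neqAle eq_sym addr_ge0 ?sqr_ge0 // andbT.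
  by rewrite paddr_eq0 ?sqr_ge0 // !sqrf_eq0.
move=> /(_ _)[].
  move=> t _; have := cvgr_gt (H (s0, t)) (cH (s0, t)) 0 (Hp t).
  move=> [[A B] /= [A0 Bt] AB]; exists (B, A) => //= -[t' s'] /= [Bt' As'].
  exact: (AB (s', t')).
move=> e /= e0 be; exists e => // s hs t t01.
have := be s; rewrite /ball /= distrC => /(_ hs) /(_ t).
by apply; rewrite /= in_itv.
Qed.

End Lifts.

(** * The Maslov quasimorphism *)

Section Maslov.
Variables (R : realType) (n : nat).
Local Notation M2 := 'M[R]_(n + n).
Local Notation J := (Jmat R n).
Implicit Types (U V M P : M2) (X Y Z : R -> M2).

(** Twice the complex-linear part of M. *)
Definition lin M : M2 := M - J *m M *m J.

(* For [X = U P] polar, [lin X = U * lin P] with [lin P] positive definite, so the argument of the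
   polynomial [rho X] is that of [detC U]. *)
Definition rho M : R[i] := detC (lin M).

Lemma lin_commJ M : commJ (lin M).
Proof.
rewrite /commJ /lin mulmxBl mulmxBr -[J *m M *m J *m J]mulmxA JmatK mulmxN mulmx1 opprK.
by rewrite !mulmxA JmatK mulNmx mul1mx mulNmx opprK addrC.
Qed.

Lemma lin_mull U M : commJ U -> lin (U *m M) = U *m lin M.
Proof. by move=> cU; rewrite /lin mulmxBr !mulmxA cU. Qed.

Lemma lin_mulr U M : commJ U -> lin (M *m U) = lin M *m U.
Proof. by move=> cU; rewrite /lin mulmxBl -!mulmxA cU. Qed.

(** For symplectic M, - J M J = M^-T; the positive definite factor shows that [rho] never
    vanishes. *)
Lemma lin_symplectic M : symplectic M ->
  lin M = (1%:M + (invmx M)^T *m invmx M) *m M.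
Proof.
move=> sM; have uM := symplectic_unitmx sM.
rewrite /lin mul_symplectic_J // -mulmxA JmatK mulmxN opprK mulmx1.
by rewrite mulmxDl mul1mx mulmxKV.
Qed.

Lemma lin_factor_spd M : M \in unitmx -> spd (1%:M + (invmx M)^T *m invmx M).
Proof.
move=> uM; split => [|v v0]; first by rewrite linearD /= trmx1 trmx_mul trmxK.
rewrite mulmxDr mulmxDl mulmx1 mxE.
have -> : v^T *m ((invmx M)^T *m invmx M) *m v = (invmx M *m v)^T *m (invmx M *m v).
  by rewrite trmx_mul !mulmxA.
by rewrite ltr_pwDl ?dot_gt0 ?dot_ge0.
Qed.

Lemma lin_unitmx M : symplectic M -> lin M \in unitmx.
Proof.
move=> sM; have uM := symplectic_unitmx sM.
by rewrite lin_symplectic // unitmx_mul uM spd_unitmx //; exact: lin_factor_spd.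
Qed.

Lemma detC_neq0 M : commJ M -> M \in unitmx -> detC M != 0.
Proof.
move=> cM uM; have := detCM (invmx M) cM; rewrite mulmxV // detC1 => e.
by apply/eqP => z; move: e; rewrite z mul0r => /eqP; rewrite oner_eq0.
Qed.

Lemma rho_neq0 M : symplectic M -> rho M != 0.
Proof. by move=> sM; apply: detC_neq0; [exact: lin_commJ | exact: lin_unitmx]. Qed.

Lemma lin_spd P : spd P -> spd (lin P).
Proof.
move=> [sP pP].
have -> : lin P = P + J^T *m P *m J by rewrite trmx_Jmat !mulNmx.
split => [|v v0].
  by rewrite linearD /= !trmx_mul trmxK sP !mulmxA.
rewrite mulmxDr mulmxDl mxE ltr_pwDl ?pP //.
have -> : v^T *m (J^T *m P *m J) *m v = (J *m v)^T *m P *m (J *m v) by rewrite trmx_mul !mulmxA.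
have [->|Jv] := eqVneq (J *m v) 0; first by rewrite mulmx0 mxE.
exact: ltW (pP _ Jv).
Qed.

(** The root Q of P is symmetric and commutes with J, so its complex determinant is real and
    nonzero, and that of P is its square. *)
Lemma detC_spd P : spd P -> commJ P -> exists2 r : R, 0 < r & detC P = (r%:C)%C.
Proof.
move=> pP cP; have [Q [pQ QQ cQ]] := spd_sqrt pP; rewrite -QQ.
have cQJ : commJ Q by apply: cQ; exact: cP.
have uQ := spd_unitmx pQ; have sQ : Q^T = Q by case: pQ.
have := detCT cQJ; rewrite sQ => re.
have := detC_neq0 cQJ uQ; rewrite detCM //; move: re.
case: (detC Q) => x y /eqP; rewrite eq_complex /= => /andP[_ /eqP yy].
have -> : y = 0 by lra.
rewrite eq_complex /= eqxx andbT => x0.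
exists (x * x); first by rewrite -expr2 exprn_even_gt0.
by apply/eqP; rewrite eq_complex /=; apply/andP; split; apply/eqP; ring.
Qed.

Lemma rho_polar U P : commJ U -> spd P ->
  exists2 r : R, 0 < r & rho (U *m P) = (r%:C)%C * detC U.
Proof.
move=> cU pP; rewrite /rho lin_mull // detCM //.
have [r r0 ->] := detC_spd (lin_spd pP) (@lin_commJ P).
by exists r => //; rewrite mulrC.
Qed.

Lemma rho_mul_commJ M U : commJ U -> rho (M *m U) = rho M * detC U.
Proof. by move=> cU; rewrite /rho lin_mulr // detCM //; exact: lin_commJ. Qed.

(** The inverse is - J M^T J, whose complex-linear part is the transpose of that of M. *)
Lemma rho_inv M : symplectic M -> rho (invmx M) = (rho M)^*%C.
Proof.
move=> sM; rewrite /rho -detCT; last exact: lin_commJ.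
have -> : (lin M)^T = M^T - J *m M^T *m J.
  by rewrite /lin linearB /= !trmx_mul trmx_Jmat mulNmx !mulmxN opprK mulmxA.
rewrite symplectic_invmx // /lin mulmxN mulNmx opprK addrC.
by rewrite !mulmxA JmatK !mulNmx mul1mx -(mulmxA _ J J) JmatK mulmxN opprK mulmx1.
Qed.

Lemma cmx_lin (T : topologicalType) (X : T -> M2) : cmx X -> cmx (fun x => lin (X x)).
Proof.
move=> cX; apply: cmxB => //; apply: cmxM; last exact: cmx_cst.
by apply: cmxM => //; exact: cmx_cst.
Qed.

Lemma ccts_rho (T : topologicalType) (X : T -> M2) : cmx X -> ccts (fun x => rho (X x)).
Proof. by move=> cX; apply: ccts_detC; exact: cmx_lin. Qed.

Definition arg_variation X (m : R) : Prop :=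
  exists2 theta, is_lift (fun t => rho (X (clamp t))) theta & m = theta 1 - theta 0.

Lemma arg_variation_unique X m m' : arg_variation X m -> arg_variation X m' -> m = m'.
Proof. by move=> [th l ->] [th' l' ->]; exact: lift_unique l l'. Qed.

(** Transports a lift from s = 0 to s = 1. It serves twice: contracting a path gives existence of
    lifts, and fixed ends give invariance under homotopy. *)
Lemma lift_family (G : R -> R -> R[i]) theta0 :
  ccts (fun p : R * R => G p.1 p.2) -> (forall s t, G s t != 0) ->
  is_lift (fun t => G 0 (clamp t)) theta0 ->
  exists2 theta1, is_lift (fun t => G 1 (clamp t)) theta1 &
  ((forall s, G s 0 = G 0 0) -> (forall s, G s 1 = G 0 1) ->
     theta1 1 - theta1 0 = theta0 1 - theta0 0).
Proof.
move=> cG G0 l0.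
pose Q s := exists2 th, is_lift (fun t => G s (clamp t)) th &
  ((forall s, G s 0 = G 0 0) -> (forall s, G s 1 = G 0 1) ->
     th 1 - th 0 = theta0 1 - theta0 0).
suff : Q 1 by [].
have cGs s : ccts (fun t => G s (clamp t)).
  apply: (ccts_comp (h := fun t : R => (s, clamp t)) _ cG).
  by apply: continuous_pair; [exact: ctsC | exact: clamp_continuous].
apply: (@segment_locally_constant R Q 0 1); rewrite ?ler01 ?lexx //.
  by exists theta0.
move=> s0 _; have [e e0 he] := lift_tube s0 cG G0.
have step u v : (forall t, 0 < complex.Re (G v (clamp t) * (G u (clamp t))^*%C)) -> Q u -> Q v.
  move=> pos [th lth ends].
  have lth' := lift_near (cGs u) (cGs v) pos lth.
  refine (ex_intro2 _ _ _ lth' _) => e1 e2.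
  rewrite -(ends e1 e2) clamp0 clamp1 !(e1 v, e1 u, e2 v, e2 u).
  have im0 (z : R[i]) : complex.Im (z * z^*%C) = 0 by case: z => x y /=; ring.
  by rewrite !im0 !mul0r atan0 !addr0.
have reC (z w : R[i]) : complex.Re (z * w^*%C) = complex.Re (w * z^*%C).
  by case: z => x y; case: w => x' y' /=; ring.
exists e => // u v hu hv _ _ Qu.
(* The tube compares only with s0, so u reaches v through s0. *)
apply: (step s0 v) => [t|]; first by apply: he => //; exact: clamp_in.
by apply: (step u s0) => // t; rewrite reC; apply: he => //; exact: clamp_in.
Qed.

Lemma arg_variation_exists X : is_path X -> exists m, arg_variation X m.
Proof.
move=> /is_path_clamp[X0 sX cX].
(* The path is contracted to its origin, where [rho] is a positive constant and 0 is a lift. *)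
pose G s t := rho (X (clamp (clamp s * clamp t))).
have cG : ccts (fun p : R * R => G p.1 p.2).
  apply: ccts_rho; apply: (cmx_comp _ cX); apply: ctsM.
    by move=> p; apply: continuous_comp; [exact: continuous_fst2 | exact: clamp_continuous].
  by move=> p; apply: continuous_comp; [exact: continuous_snd2 | exact: clamp_continuous].
have l0 : is_lift (fun t => G 0 (clamp t)) (fun=> 0).
  split => [|t]; first exact: ctsC.
  rewrite /G clamp0 mul0r X0.
  have [r r0 e] := rho_polar (@commJ1 R n) (@spd1 R (n + n)).
  by exists r => //; rewrite cis0 mulr1; move: e; rewrite mulmx1 detC1 mulr1.
have [th lth _] := lift_family cG (fun s t => rho_neq0 (sX _)) l0.
exists (th 1 - th 0), th => //; case: lth => cth lth; split => // t.
by have := lth t; rewrite /G clamp1 mul1r !clamp_clamp.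
Qed.

Lemma arg_variation_homotopic X Y m : homotopic X Y -> arg_variation X m -> arg_variation Y m.
Proof.
move=> XY [th lth mE]; have [F [cF sF F0 F1 FXY]] := homotopicE XY.
pose G s t := rho (F s t).
have cG : ccts (fun p : R * R => G p.1 p.2) by exact: ccts_rho.
have l0 : is_lift (fun t => G 0 (clamp t)) th.
  case: lth => cth lth; split => // t; rewrite /G.
  by have [-> _] := FXY _ (clamp_in t); exact: lth.
have [th' lth' ends] := lift_family cG (fun s t => rho_neq0 (sF _ _)) l0.
exists th'.
  case: lth' => cth' lth'; split => // t; have := lth' t; rewrite /G.
  by have [_ ->] := FXY _ (clamp_in t).
by rewrite mE ends // /G => s; rewrite ?F0 ?F1.
Qed.

(** By [rho_polar] the arguments of [rho X] and [detC U] agree. Conversely, a lift of [rho] gives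
    [detC U] exactly because both sides have modulus 1. *)
Lemma is_maslovP X m : is_path X -> is_maslov X m <-> arg_variation X m.
Proof.
move=> pX; split.
  move=> [U [P [th [cth [H mE]]]]]; exists (th \o @clamp R).
    split.
      apply: (@continuous_comp_into R R R (@I01 R) (@clamp R) th) => //.
        exact: clamp_continuous.
      exact: clampI01.
    move=> t; have [-> [oU [sU [sP [pP dU]]]]] := H _ (clampI01 t).
    have [_ cU] := symplectic_unitary oU sU.
    have [r r0 e] := rho_polar cU (conj sP pP).
    by exists r => //; rewrite e dU.
  by rewrite /= clamp0 clamp1.
move=> [th [cth lth] mE].
pose P t := sqrtmx ((X t)^T *m X t).
exists (fun t => X t *m invmx (P t)), P, th; split; first exact: continuous_subspaceT.
split => // t tI.
have t01 : 0 <= t <= 1 by move: tI; rewrite /I01 /= in_itv.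
have sX := is_path_symplectic pX t01.
have [pP sP uU] := symplectic_polar sX.
have [oU cU] := uU.
split; first by rewrite mulmxKV // spd_unitmx.
split => //; split; first exact: unitary_symplectic.
split; first by case: pP.
split; first by case: pP.
have [r r0 e] := rho_polar cU pP.
move: e; rewrite -/(P t) mulmxKV ?spd_unitmx // => e.
have [r' r'0 e'] := lth t; rewrite (clamp_id t01) e in e'.
set d := detC _ in e e' *.
have dd : d * d^*%C = 1.
  by rewrite /d -detCT // -detCM // unitaryVr // detC1.
have rr : r = r'.
  have : (r%:C)%C * d * ((r%:C)%C * d)^*%C =
    (r'%:C)%C * cis (th t) * ((r'%:C)%C * cis (th t))^*%C by rewrite e'.
  rewrite !conjcM !conjc_real mulrACA dd mulr1 mulrACA cisNr mulr1 -!rmorphM.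
  by move=> /complexI; rewrite -!expr2 => /eqP; rewrite eqrXn2 ?ltW // => /eqP.
have rc : (r%:C)%C != 0 :> R[i] by rewrite (inj_eq (@complexI R)) gt_eqF.
by move: e'; rewrite -rr => /(mulfI rc).
Qed.

Lemma maslovP X : is_path X -> arg_variation X (maslov X).
Proof.
move=> pX; have [m hm] := arg_variation_exists pX.
apply/(is_maslovP _ pX).
by apply: (@xgetPex _ 0 [set m | is_maslov X m]); exists m; apply/(is_maslovP _ pX).
Qed.

Lemma maslovE X m : is_path X -> arg_variation X m -> maslov X = m.
Proof. by move=> pX; apply: arg_variation_unique; exact: maslovP. Qed.

Lemma maslov_homotopic X Y : homotopic X Y -> maslov X = maslov Y.
Proof.
move=> h; have pX := homotopic_path h; have pY := homotopic_path (homotopic_sym h).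
by symmetry; apply: maslovE => //; apply: (arg_variation_homotopic h); exact: maslovP.
Qed.

(** Additivity is exact here because a unitary factor on the right multiplies [rho] by its
    determinant. *)
Lemma maslov_rpath X a : is_path X -> maslov (pmul X (rpath n a)) = maslov X + n%:R * a.
Proof.
move=> pX; have pr := @is_path_rpath R n a.
apply: maslovE; first exact: is_path_pmul.
have [th [cth lth] ->] := maslovP pX.
exists (fun t => th t + n%:R * (clamp t * a)); last by rewrite clamp0 clamp1; ring.
split.
  apply: ctsD => //; apply: ctsM; first exact: ctsC.
  by apply: ctsM; [exact: clamp_continuous | exact: ctsC].
move=> t; have [r r0 e] := lth t; exists r => //.
rewrite /pmul rho_mul_commJ; last by have [] := @torus_unitary R n (fun=> clamp t * a).
rewrite e /rpath /tpath detC_torus cisD mulrA; congr (_ * cis _).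
by rewrite sumr_const card_ord mulr_natl.
Qed.

Lemma maslov_pinv X : is_path X -> maslov (pinv X) = - maslov X.
Proof.
move=> pX; apply: maslovE; first exact: is_path_pinv.
have [th [cth lth] ->] := maslovP pX.
exists (fun t => - th t); last by ring.
split; first exact: ctsN.
move=> t; have [r r0 e] := lth t; exists r => //.
rewrite /Defs.pinv rho_inv; last by apply: (is_path_symplectic pX); exact: clamp_in.
by rewrite e conjcM conjc_real cisN.
Qed.

End Maslov.

(** * Monotonicity along nonnegative paths *)

Section ComplexDerivative.
Variable R : realType.
Implicit Types (f g : R -> R[i]) (t : R) (d : R[i]).

Definition cder f t d : Prop :=
  is_derive t 1 (fun s => complex.Re (f s)) (complex.Re d) /\
  is_derive t 1 (fun s => complex.Im (f s)) (complex.Im d).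

Lemma cderC (c : R[i]) t : cder (fun=> c) t 0.
Proof. by split; exact: is_derive_cst. Qed.

Lemma cderD f g t d e : cder f t d -> cder g t e -> cder (fun s => f s + g s) t (d + e).
Proof.
move=> [f1 f2] [g1 g2]; split.
  rewrite [X in is_derive _ _ X _](_ : _ = fun s => complex.Re (f s) + complex.Re (g s)).
    by apply: (is_derive_eq (is_derive_add f1 g1)); case: d {f1 f2} => ? ?; case: e {g1 g2}.
  by apply/funext => s; case: (f s) => ? ?; case: (g s).
rewrite [X in is_derive _ _ X _](_ : _ = fun s => complex.Im (f s) + complex.Im (g s)).
  by apply: (is_derive_eq (is_derive_add f2 g2)); case: d {f1 f2} => ? ?; case: e {g1 g2}.
by apply/funext => s; case: (f s) => ? ?; case: (g s).
Qed.

Lemma cderM f g t d e : cder f t d -> cder g t e ->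
  cder (fun s => f s * g s) t (d * g t + f t * e).
Proof.
move=> [f1 f2] [g1 g2]; split.
  rewrite [X in is_derive _ _ X _](_ : _ = fun s =>
    complex.Re (f s) * complex.Re (g s) + (- 1) * (complex.Im (f s) * complex.Im (g s))).
    apply: (is_derive_eq (is_derive_add (is_derive_mul f1 g1)
      (is_derive_mul (is_derive_cst (-1 : R) t 1) (is_derive_mul f2 g2)))).
    by case: d {f1 f2} => ? ?; case: e {g1 g2} => ? ?; case: (f t) => ? ?; case: (g t) => ? ? /=; ring.
  by apply/funext => s; case: (f s) => ? ?; case: (g s) => ? ? /=; ring.
rewrite [X in is_derive _ _ X _](_ : _ = fun s =>
  complex.Re (f s) * complex.Im (g s) + complex.Im (f s) * complex.Re (g s)).
  apply: (is_derive_eq (is_derive_add (is_derive_mul f1 g2) (is_derive_mul f2 g1))).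
  by case: d {f1 f2} => ? ?; case: e {g1 g2} => ? ?; case: (f t) => ? ?; case: (g t) => ? ? /=; ring.
by apply/funext => s; case: (f s) => ? ?; case: (g s) => ? ? /=; ring.
Qed.

Lemma cder_eq f t d e : cder f t d -> d = e -> cder f t e.
Proof. by move=> h <-. Qed.

Lemma cder_sum (I : Type) (s : seq I) (f : I -> R -> R[i]) (d : I -> R[i]) t :
  (forall i, cder (f i) t (d i)) -> cder (fun x => \sum_(i <- s) f i x) t (\sum_(i <- s) d i).
Proof.
move=> hf; elim: s => [|i s IH].
  by rewrite big_nil; under eq_fun do rewrite big_nil; exact: cderC.
by rewrite big_cons; under eq_fun do rewrite big_cons; exact: cderD.
Qed.

(** Leibniz sum with values v and derivatives d, written recursively so that vanishing values cause
    no division. *)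
Fixpoint dprod (I : Type) (s : seq I) (v d : I -> R[i]) : R[i] :=
  if s is i :: s' then d i * (\prod_(j <- s') v j) + v i * dprod s' v d else 0.

Lemma cder_prod (I : Type) (s : seq I) (f : I -> R -> R[i]) (d : I -> R[i]) t :
  (forall i, cder (f i) t (d i)) ->
  cder (fun x => \prod_(i <- s) f i x) t (dprod s (fun i => f i t) d).
Proof.
move=> hf; elim: s => [|i s IH] /=.
  by under eq_fun do rewrite big_nil; exact: cderC.
by under eq_fun do rewrite big_cons; exact: cderM.
Qed.

Lemma dprod1 (I : Type) (s : seq I) (v d : I -> R[i]) :
  (forall i, v i = 1) -> dprod s v d = \sum_(i <- s) d i.
Proof.
move=> v1; elim: s => [|i s IH] /=; first by rewrite big_nil.
by rewrite big_cons IH v1 mul1r big1 ?mulr1.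
Qed.

(** Each Leibniz term omits one factor, so of two vanishing factors at least one remains. *)
Lemma dprod0 (I : Type) (s : seq I) (v d : I -> R[i]) :
  (1 < count (fun i => v i == 0%R) s)%N -> dprod s v d = 0.
Proof.
have prod0 (u : seq I) : (0 < count (fun i => v i == 0%R) u)%N -> \prod_(j <- u) v j = 0.
  elim: u => //= i u IH; rewrite big_cons; have [->|vi] := eqVneq (v i) 0; first by rewrite mul0r.
  by rewrite add0n => /IH ->; rewrite mulr0.
elim: s => //= i s IH; have [vi|vi] := eqVneq (v i) 0.
  by rewrite add1n ltnS vi mul0r addr0 => /prod0 ->; rewrite mulr0.
rewrite add0n => h; rewrite IH // mulr0 addr0 prod0 ?mulr0 //.
exact: ltn_trans h.
Qed.

(* At the identity only the identity permutation contributes: any other one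
   picks at least two off-diagonal, hence vanishing, factors. *)
Lemma cder_det_at1 n (A : R -> 'M[R[i]]_n) (D : 'M[R[i]]_n) t :
  (forall i j, cder (fun s => A s i j) t (D i j)) -> A t = 1%:M ->
  cder (fun s => \det (A s)) t (\tr D).
Proof.
move=> hA A1; rewrite /determinant.
apply: (cder_eq (d := \sum_(s : 'S_n) (0 * (\prod_i A t i (s i)) + (-1) ^+ s *
  dprod (index_enum 'I_n) (fun i => A t i (s i)) (fun i => D i (s i))))).
  apply: cder_sum => s; apply: cderM; first exact: cderC.
  exact: (cder_prod _ (fun i => hA i (s i))).
rewrite (bigD1 (1%g : 'S_n)) //= [X in _ + X]big1 ?addr0.
  rewrite mul0r add0r odd_perm1 expr0 mul1r dprod1; last by move=> i; rewrite A1 mxE perm1 eqxx.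
  by rewrite /mxtrace; apply: eq_bigr => i _; rewrite perm1.
move=> s s1; rewrite mul0r add0r dprod0 ?mulr0 //.
have -> : count (fun i => A t i (s i) == 0) (index_enum 'I_n) = #|[pred i | s i != i]|.
  rewrite -sum1_card -sum1_count; apply: eq_bigl => i.
  by rewrite A1 mxE inE [s i == i]eq_sym; case: (i == s i) => /=; rewrite ?oner_eq0 ?eqxx.
have [i si] : exists i, s i != i.
  apply/existsP; apply: contra_neqT s1 => /existsPn h.
  by apply/permP => i; rewrite perm1; apply/eqP; rewrite -[_ == _]negbK; exact: h.
apply/card_gt1P; exists i, (s i); split; rewrite ?inE //; last by rewrite eq_sym.
by rewrite (inj_eq perm_inj).
Qed.

(** Near t0, continuity keeps theta within pi / 2 of theta t0, so theta is theta t0 plus the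
    arctangent of Im w / Re w, which is differentiable at t0. *)
Lemma lift_derive (g : R -> R[i]) (theta : R -> R) (t0 : R) d :
  continuous theta ->
  (\forall t \near t0, exists2 r : R, 0 < r & g t = (r%:C)%C * cis (theta t)) ->
  cder g t0 d ->
  is_derive t0 1 theta (complex.Im (d * (g t0)^*%C) / complex.Re (g t0 * (g t0)^*%C)).
Proof.
move=> ct lt hg; have [r0 r0_gt0 g0] := nbhs_singleton lt.
pose w t := g t * (g t0)^*%C.
have [w1 w2] : cder w t0 (d * (g t0)^*%C).
  by apply: (cder_eq (cderM hg (cderC ((g t0)^*%C) t0))); rewrite mulr0 addr0.
have w0 : w t0 = ((r0 ^+ 2)%:C)%C.
  rewrite /w g0 conjcM conjc_real mulrACA cisNr mulr1 -rmorphM expr2; by [].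
have Re0 : complex.Re (w t0) != 0 by rewrite w0 /= gt_eqF // exprn_gt0.
have Im0 : complex.Im (w t0) = 0 by rewrite w0.
have dq : is_derive t0 1 (fun t => complex.Im (w t) * (complex.Re (w t))^-1)
   (complex.Im (d * (g t0)^*%C) / complex.Re (w t0)).
  apply: (is_derive_eq (is_derive_mul w2 (is_deriveV Re0 w1))).
  by rewrite Im0 mul0r addr0.
have dat : is_derive t0 1 (fun t => theta t0 + atan (complex.Im (w t) / complex.Re (w t)))
   (complex.Im (d * (g t0)^*%C) / complex.Re (w t0)).
  have h := @is_derive1_comp R (@atan R) _ t0 _ _ (is_derive1_atan _) dq.
  apply: (is_derive_eq (is_derive_add (is_derive_cst (theta t0) t0 1) h)).
  by rewrite Im0 mul0r expr0n /= addr0 invr1 mul1r add0r.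
apply: near_eq_is_derive dat.
have near_pi : \forall t \near t0, `|theta t0 - theta t| < pi / 2.
  by apply: (@cvgr_dist_lt _ _ _ _ _ theta (theta t0) (ct t0)); rewrite divr_gt0 // pi_gt0.
near=> t.
have [r r_gt0 gt] : exists2 r : R, 0 < r & g t = (r%:C)%C * cis (theta t) by near: t.
have : `|theta t0 - theta t| < pi / 2 by near: t.
rewrite distrC ltr_norml => /andP[x1 x2]; set x := theta t - theta t0 in x1 x2.
have wt : w t = ((r * r0)%:C)%C * cis x.
  by rewrite /w gt g0 conjcM conjc_real mulrACA -cisN -cisD -rmorphM.
have c0 : 0 < cos x by rewrite cos_gt0_pihalf // x1 x2.
have -> : complex.Im (w t) / complex.Re (w t) = tan x.
  rewrite wt /tan /=; field; rewrite !gt_eqF //.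
by rewrite tanK ?in_itv /= ?x1 ?x2 // /x addrC subrK.
Unshelve. all: by end_near. Qed.

End ComplexDerivative.

(** * The Maslov map and the order *)

Section MaslovOrder.
Variables (R : realType) (n : nat).
Local Notation M2 := 'M[R]_(n + n).
Local Notation J := (Jmat R n).
Implicit Types (K H S D A : M2) (X Y Z : R -> M2).

Lemma commJ_trace K : commJ K -> \tr (dlsubmx K) = - (\tr (J *m K) / 2).
Proof.
move=> /commJP ->; rewrite block_mxKdl /Jmat mulmx_block.
rewrite !(mulmx0, mul0mx, mulmx1, mul1mx, mulNmx, mulmxN, add0r, addr0).
by rewrite mxtrace_block !linearN /=; field.
Qed.

(** With Q the root of S, the trace is that of Q H Q, a sum of values of the form H on the columns
    of Q. *)
Lemma trace_psd_spd H S : psd H -> spd S -> 0 <= \tr (H *m S).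
Proof.
move=> [sH pH] /spd_sqrt[Q [[sQ _] <- _]].
rewrite mulmxA mxtrace_mulC mulmxA -{1}sQ mxtrace_congr.
by apply: sumr_ge0 => j _; exact: pH.
Qed.

(* The left-hand side is the speed of the argument of [rho] along a path through [A] with velocity [D];
   the right-hand side pairs the Hamiltonian with a positive definite matrix. *)
Lemma trace_lin_derivative A D : symplectic A ->
  \tr (dlsubmx (lin D *m invmx (lin A))) =
  \tr (- (J *m D *m invmx A) *m invmx (1%:M + (invmx A)^T *m invmx A)).
Proof.
move=> sA; have uA := symplectic_unitmx sA.
have cL : commJ (invmx (lin A)) by apply: commJV; exact: lin_commJ.
have uS : 1%:M + (invmx A)^T *m invmx A \in unitmx.
  by apply: spd_unitmx; exact: lin_factor_spd.
rewrite commJ_trace; last by apply: commJM => //; exact: lin_commJ.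
have -> : \tr (J *m (lin D *m invmx (lin A))) = \tr (J *m D *m invmx (lin A)) *+ 2.
  move: (invmx (lin A)) cL => L cL.
  have -> : J *m (lin D *m L) = J *m D *m L + D *m J *m L.
    by rewrite mulmxA /lin mulmxBr !mulmxA JmatK !mulNmx mul1mx opprK mulmxDl.
  by rewrite linearD /= -(mulmxA D J) -cL mulmxA [\tr (D *m L *m J)]mxtrace_mulC mulmxA mulr2n.
rewrite -[_ *+ 2]mulr_natr mulfK // mulNmx linearN /=; congr (- _).
by rewrite {1}lin_symplectic // invmx_mul // !mulmxA.
Qed.

Lemma cxm_Re K i j : complex.Re (cxm K i j) = K (lshift n i) (lshift n j).
Proof. by rewrite !mxE. Qed.

Lemma cxm_Im K i j : complex.Im (cxm K i j) = K (rshift n i) (lshift n j).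
Proof. by rewrite !mxE. Qed.

Lemma Im_trace_cxm K : complex.Im (\tr (cxm K)) = \tr (dlsubmx K).
Proof.
rewrite /mxtrace.
have imD (s : seq 'I_n) (f : 'I_n -> R[i]) :
    complex.Im (\sum_(i <- s) f i) = \sum_(i <- s) complex.Im (f i).
  elim: s => [|i s IH]; first by rewrite !big_nil.
  by rewrite !big_cons -IH; case: (f i) => ? ?; case: (\sum_(j <- s) f j).
by rewrite imD; apply: eq_bigr => i _; rewrite cxm_Im !mxE.
Qed.

Lemma maslov_psd_ge0 X : psd_hamiltonian_path X -> 0 <= maslov X.
Proof.
move=> [pX [D hD]]; have [th [cth lth] ->] := maslovP pX.
have key (t : R) : exists d : R, 0 < t < 1 -> 0 <= d /\ is_derive t 1 th d.
  have [t01|] := boolP (0 < t < 1); last by exists 0.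
  have tI : 0 <= t <= 1 by case/andP: t01 => t0 t1; rewrite !ltW.
  have sX := is_path_symplectic pX tI; have uX := symplectic_unitmx sX.
  have [dX pH] : (dmx X t (D t)) /\ psd (- (J *m D t *m invmx (X t))).
    by apply: hD; rewrite /I01 /= in_itv.
  have uL := lin_unitmx sX; have cL := @lin_commJ R n (X t).
  have cLV := commJV cL.
  (* Normalizing to the identity at time t makes the derivative of the determinant a trace. *)
  pose N s := lin (X s) *m invmx (lin (X t)).
  have dN : dmx N t (lin (D t) *m invmx (lin (X t))).
    have d1 := dmxM (dmxM (dmx_cst J t) dX) (dmx_cst J t).
    have d2 := dmxM (dmx_cst (-1%:M) t) d1.
    have d3 := dmxM (dmxD dX d2) (dmx_cst (invmx (lin (X t))) t).
    move=> i j; have := d3 i j.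
    rewrite !(mul0mx, mulmx0, add0r, addr0) mulNmx mul1mx -/(lin _).
    by under eq_fun do rewrite mulNmx mul1mx -/(lin _).
  have cdet : cder (fun s => detC (N s)) t (\tr (cxm (lin (D t) *m invmx (lin (X t))))).
    have Nt : cxm (N t) = 1%:M by rewrite /N mulmxV // cxm1.
    apply: (@cder_det_at1 R n (fun s => cxm (N s)) _ t _ Nt) => i j.
    split; [rewrite cxm_Re; under eq_fun do rewrite cxm_Re |
            rewrite cxm_Im; under eq_fun do rewrite cxm_Im]; exact: dN.
  have rhoE s : rho (X s) = detC (N s) * rho (X t).
    by rewrite /rho -detCM ?mulmxKV //; apply: commJM => //; exact: lin_commJ.
  have crho := cderM cdet (cderC (rho (X t)) t).
  set d := _ + _ in crho.
  (* The lift follows X only where [clamp] is the identity, hence the restriction to the open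
     interval; the mean value theorem needs just continuity at the ends. *)
  have lift : \forall s \near t, exists2 r : R, 0 < r & rho (X s) = (r%:C)%C * cis (th s).
    have : t \in `]0, 1[%R by rewrite in_itv /=.
    move=> /near_in_itvoo h01; near=> s; have : s \in `]0, 1[%R by near: s.
    rewrite in_itv /= => /andP[s0 s1].
    by have := lth s; rewrite clamp_id // !ltW.
  have crho' : cder (fun s => rho (X s)) t d by under eq_fun do rewrite rhoE.
  exists (complex.Im (d * (rho (X t))^*%C) / complex.Re (rho (X t) * (rho (X t))^*%C)).
  move=> _; split; last exact: (lift_derive cth lift crho').
  have tr0 : 0 <= complex.Im (\tr (cxm (lin (D t) *m invmx (lin (X t))))).
    rewrite Im_trace_cxm trace_lin_derivative //; apply: trace_psd_spd => //.
    by apply: spdV; exact: lin_factor_spd.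
  rewrite /d mulr0 addr0.
  move: (\tr _) (rho (X t)) tr0 => [a b] [x y] /= b0.
  rewrite divr_ge0 //; last by rewrite mulrN opprK -!expr2 addr_ge0 // sqr_ge0.
  have -> : (a * x - b * y) * - y + (a * y + b * x) * x = b * (x ^+ 2 + y ^+ 2) by ring.
  by rewrite mulr_ge0 // addr_ge0 // sqr_ge0.
have /choice[df dfP] := key.
have [c] := @MVT R th df 0 1 ltr01 (fun x xI => (dfP x (xI : 0 < x < 1)).2) (continuous_subspaceT cth).
rewrite in_itv /= => c01 ->; rewrite subr0 mulr1.
by have [] := dfP c c01.
Unshelve. all: by end_near. Qed.

Lemma maslov_cone_ge0 X : in_cone X -> 0 <= maslov X.
Proof.
move=> [_ [Y [hY XY]]]; rewrite (maslov_homotopic XY); exact: maslov_psd_ge0.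
Qed.

(** The increase of mu under R_(6 pi), the width of the sandwich. *)
Definition mbound : R := n%:R * pi * 6.

Lemma mbound_ge0 : 0 <= mbound.
Proof. by rewrite /mbound !mulr_ge0 // pi_ge0. Qed.

Lemma maslov_sandwich X : (0 < n)%N -> is_path X -> exists q : int,
  in_cone (pmul X (rpath n (pi * (- q)%:~R))) /\
  0 <= maslov X - n%:R * pi * q%:~R <= mbound.
Proof.
move=> n0 pX; have [q [c1 c2]] := rpath_sandwich n0 pX; exists q; split => //.
have := maslov_cone_ge0 c1; rewrite maslov_rpath // rmorphN /= => h1.
have := maslov_cone_ge0 c2.
rewrite (maslov_homotopic (rpath_central _ (is_path_pinv pX))).
rewrite maslov_rpath; last exact: is_path_pinv.
rewrite maslov_pinv // intrD => h2.
by rewrite /mbound; apply/andP; split; lra.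
Qed.

Lemma cone_of_maslov X : (0 < n)%N -> is_path X -> mbound <= maslov X -> in_cone X.
Proof.
move=> n0 pX mX; have [q [c1 /andP[_ h]]] := maslov_sandwich n0 pX.
have q0 : 0 <= q.
  have : 0 <= n%:R * pi * q%:~R :> R by lra.
  by rewrite pmulr_rge0 ?ler0z // mulr_gt0 ?pi_gt0 // ltr0n.
have pr := @is_path_rpath R n (pi * (- q)%:~R).
apply: (in_cone_homotopic (homotopic_sym (homotopic_mulK pX pr))).
apply: in_cone_pmul => //; rewrite -rpathN; apply: in_cone_rpath.
by rewrite rmorphN /= mulrN opprK mulr_ge0 ?pi_ge0 // ler0z.
Qed.

(** Multiply X >= R_(q pi) by Y >= R_(r pi) and apply mu; each lower rotation loses at most
    [mbound]. The reverse inequality in [maslov_pmul] comes from the inverses. *)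
Lemma maslov_pmul_ge X Y : (0 < n)%N -> is_path X -> is_path Y ->
  maslov X + maslov Y - 2 * mbound <= maslov (pmul X Y).
Proof.
move=> n0 pX pY.
have [q [c1 /andP[_ h1]]] := maslov_sandwich n0 pX.
have [r [c2 /andP[_ h2]]] := maslov_sandwich n0 pY.
pose z (m : int) := rpath n (pi * m%:~R : R).
have pz m : is_path (z m) by exact: is_path_rpath.
have pXY := is_path_pmul pX pY.
have h : homotopic (pmul (pmul X Y) (z (- q - r))) (pmul (pmul X (z (- q))) (pmul Y (z (- r)))).
  have -> : z (- q - r) = pmul (z (- q)) (z (- r)) by rewrite /z intrD mulrDr rpathD.
  have -> : pmul (pmul X Y) (pmul (z (- q)) (z (- r))) =
    pmul X (pmul (pmul Y (z (- q))) (z (- r))) by rewrite !pmulA.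
  have -> : pmul (pmul X (z (- q))) (pmul Y (z (- r))) =
    pmul X (pmul (pmul (z (- q)) Y) (z (- r))) by rewrite !pmulA.
  apply: homotopic_pmul; first exact: homotopic_refl.
  apply: homotopic_pmul; last exact: homotopic_refl (pz _).
  by apply: homotopic_sym; exact: rpath_central.
have := maslov_cone_ge0 (in_cone_homotopic h (in_cone_pmul c1 c2)).
rewrite maslov_rpath // intrD !rmorphN /= => h3.
lra.
Qed.

Lemma maslov_pmul X Y : (0 < n)%N -> is_path X -> is_path Y ->
  `|maslov (pmul X Y) - maslov X - maslov Y| <= 2 * mbound.
Proof.
move=> n0 pX pY; have h1 := maslov_pmul_ge n0 pX pY.
have := maslov_pmul_ge n0 (is_path_pinv pY) (is_path_pinv pX).
rewrite -(maslov_homotopic (homotopic_pinvM pX pY)) !maslov_pinv //; last exact: is_path_pmul.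
move=> h2; rewrite ler_norml; apply/andP; split; lra.
Qed.

End MaslovOrder.

(** * Relative growth *)

Section QuasiAdditive.
Variable R : realType.
Implicit Types (a u : nat -> R) (h D : R).

Lemma limn_bounded_dist u h D : (forall k, `|u k - k%:R * h| <= D) ->
  limn (fun k => u k / k%:R) = h.
Proof.
move=> hu; apply: cvg_lim => //.
have D0 : 0 <= D by apply: le_trans (hu 0%N).
apply/cvgrPdist_le => e e0.
near=> k.
have k0 : (0 < k)%N by near: k; exact: nbhs_infty_gt.
have kR : 0 < k%:R :> R by rewrite ltr0n.
apply: (@le_trans _ _ (D / k%:R)).
  rewrite distrC -[X in `|_ - X|](mulfK (lt0r_neq0 kR)) -mulrBl normrM normfV.
  by rewrite (ger0_norm (ltW kR)) ler_pM2r ?invr_gt0 // [h * _]mulrC.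
have : D / e <= k%:R by near: k; exact: nbhs_infty_ger.
by rewrite ler_pdivrMr // [_ * e]mulrC -ler_pdivrMr.
Unshelve. all: by end_near. Qed.

(** Computing a (k l) from a k and from a l shows that (a l - D) / l never exceeds (a k + D) / k;
    the supremum of the former lies between both families. *)
Lemma quasi_additive_limit a D :
  (forall k l, `|a (k + l)%N - a k - a l| <= D) ->
  exists h, forall k, `|a k - k%:R * h| <= D.
Proof.
move=> qa.
have a0 : `|a 0%N| <= D by have := qa 0%N 0%N; rewrite addn0 subrr sub0r normrN.
have mult k m : `|a (m.+1 * k)%N - m.+1%:R * a k| <= m%:R * D.
  elim: m => [|m IH]; first by rewrite mul1n !mul1r subrr normr0 mul0r.
  rewrite mulSn -[m.+2%:R]natr1 -[m.+1%:R in X in _ <= X]natr1.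
  rewrite (_ : _ - _ = (a (k + m.+1 * k)%N - a k - a (m.+1 * k)%N) +
     (a (m.+1 * k)%N - m.+1%:R * a k)); last by ring.
  by apply: le_trans (ler_normD _ _) _; rewrite mulrDl mul1r addrC lerD.
have cmp k l : (0 < k)%N -> (0 < l)%N -> (a l - D) / l%:R <= (a k + D) / k%:R.
  move=> k0 l0; have kR : 0 < k%:R :> R by rewrite ltr0n.
  have lR : 0 < l%:R :> R by rewrite ltr0n.
  rewrite ler_pdivrMr // mulrAC ler_pdivlMr //.
  have D0 : 0 <= D by exact: le_trans (normr_ge0 _) a0.
  have := mult l k.-1; have := mult k l.-1; rewrite !prednK // [(l * k)%N]mulnC.
  rewrite !ler_norml => /andP[_ h1] /andP[h2 _].
  have e1 : (l.-1)%:R * D <= l%:R * D by rewrite ler_wpM2r // ler_nat leq_pred.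
  have e2 : (k.-1)%:R * D <= k%:R * D by rewrite ler_wpM2r // ler_nat leq_pred.
  by lra.
pose S : set R := [set x | exists2 l, (0 < l)%N & x = (a l - D) / l%:R].
have ubS k : (0 < k)%N -> ubound S ((a k + D) / k%:R).
  by move=> k0 x [l l0 ->]; exact: cmp.
have S0 : S !=set0 by exists ((a 1%N - D) / 1%:R), 1%N.
have hasS : has_sup S by split => //; exists ((a 1%N + D) / 1%:R); exact: ubS.
exists (sup S) => -[|k]; first by rewrite mul0r subr0.
have kR : 0 < k.+1%:R :> R by rewrite ltr0n.
have up : sup S <= (a k.+1 + D) / k.+1%:R by apply: ge_sup => //; exact: ubS.
have lo : (a k.+1 - D) / k.+1%:R <= sup S by apply: ub_le_sup; [case: hasS | exists k.+1].
rewrite ler_pdivlMr // in up; rewrite ler_pdivrMr // in lo.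
by rewrite ler_norml; apply/andP; split; lra.
Qed.

End QuasiAdditive.

(** * Homogenization and relative growth *)

Section RelativeGrowth.
Variables (R : realType) (n : nat) (n_gt0 : (0 < n)%N).
Implicit Types (f g X : R -> Mat R n).
Local Notation D := (2 * mbound R n).

Lemma is_path_ppow f p : is_path f -> is_path (ppow f p).
Proof.
move=> pf.
have pos k : is_path (ppow f (Posz k)).
  elim: k => [|k IH].
    rewrite [X in is_path X](_ : _ = @rpath R n 0); first exact: is_path_rpath.
    apply/funext => t; rewrite /ppow expr0 /rpath /tpath.
    by under eq_fun do rewrite mulr0; rewrite torus0.
  rewrite [X in is_path X](_ : _ = pmul f (ppow f (Posz k))); first exact: is_path_pmul.
  by apply/funext => t; rewrite /ppow exprS.
by case: p => k; [exact: pos | exact: is_path_pinv (pos k.+1)].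
Qed.

Lemma maslov_hom_bound f : is_path f ->
  forall p : int, `|maslov (ppow f p) - p%:~R * maslov_hom f| <= D.
Proof.
move=> pf; pose a k := maslov (ppow f (Posz k)).
have qa k l : `|a (k + l)%N - a k - a l| <= D.
  rewrite /a (_ : ppow f (Posz (k + l)) = pmul (ppow f (Posz k)) (ppow f (Posz l))).
    by apply: maslov_pmul => //; exact: is_path_ppow.
  by apply/funext => t; rewrite /ppow /pmul exprD.
have [h hP] := quasi_additive_limit qa.
have -> : maslov_hom f = h by apply: limn_bounded_dist; exact: hP.
case=> k; first exact: hP.
rewrite (_ : ppow f (Negz k) = Defs.pinv (ppow f (Posz k.+1))) //.
rewrite maslov_pinv; last exact: is_path_ppow.
by rewrite NegzE rmorphN /= mulNr -opprD normrN; exact: hP.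
Qed.

Lemma maslov_hom_gt0 f : dominant f -> 0 < maslov_hom f.
Proof.
move=> [pf [_ [_ df]]].
have pi0 := @pi_gt0 R.
have nR : 0 < n%:R :> R by rewrite ltr0n.
(* The value n x of mu on this rotation exceeds the error D of [maslov_hom_bound], so f^k >= R_x
   leaves k mu~ f positive. *)
pose x := (3 * D + 1) / n%:R.
have := df (rpath n x) (is_path_rpath _ _) => -[k hk].
have := maslov_cone_ge0 hk; rewrite -rpathN maslov_rpath; last exact: is_path_ppow.
have e : n%:R * - x = - (3 * D + 1) by rewrite /x mulrN mulrC divfK // gt_eqF.
rewrite e => h1; have := maslov_hom_bound pf k.
have D0 := mbound_ge0 R n.
rewrite ler_norml => /andP[_ h2].
have : 0 < k%:R * maslov_hom f by rewrite -[k%:R]/((Posz k)%:~R); lra.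
by apply: contraTT; rewrite -!leNgt => h3; rewrite mulr_ge0_le0.
Qed.

(** One D is the defect of the product, the other two are the homogenization errors of f^p and
    g^k. *)
Lemma maslov_ge_quotient f g p k : is_path f -> is_path g ->
  `|maslov (pmul (ppow f p) (Defs.pinv (ppow g k))) -
    (p%:~R * maslov_hom f - k%:~R * maslov_hom g)| <= 3 * D.
Proof.
move=> pf pg; have pfp := is_path_ppow p pf; have pgk := is_path_ppow k pg.
have := maslov_pmul n_gt0 pfp (is_path_pinv pgk); rewrite maslov_pinv //.
have := maslov_hom_bound pf p; have := maslov_hom_bound pg k.
rewrite !ler_norml => /andP[? ?] /andP[? ?] /andP[? ?].
by apply/andP; split; lra.
Qed.

Lemma gamma_hom f g : is_path f -> is_path g -> 0 < maslov_hom f ->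
  gamma f g = maslov_hom g / maslov_hom f.
Proof.
move=> pf pg f0; set al := maslov_hom f in f0 *; set be := maslov_hom g.
have D0 := mbound_ge0 R n.
pose E := 3 * D + mbound R n.
have E0 : 0 <= E by rewrite /E; lra.
apply: (@limn_bounded_dist _ _ _ (E / al + 1)) => k.
rewrite /gamma_n; set S := (X in inf X).
have hq p := maslov_ge_quotient p (Posz k) pf pg.
have lb : lbound S ((k%:R * be - E) / al).
  move=> _ [p /= hp <-]; rewrite ler_pdivrMr //.
  have := maslov_cone_ge0 hp; have := hq p.
  rewrite ler_norml -/al -/be -[(Posz k)%:~R]/(k%:R) => /andP[h1 h2] h3.
  by rewrite /E; lra.
pose p := Num.ceil ((k%:R * be + E) / al).
have p1 : (k%:R * be + E) / al <= p%:~R by exact: real_ceil_ge (num_real _).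
have p2 : p%:~R < (k%:R * be + E) / al + 1 by rewrite -ltrBlDr -[1 in ltLHS]/(1%:~R) -intrB; exact: real_ceilB1_lt (num_real _).
have Sp : S p%:~R.
  exists p => //=; apply: cone_of_maslov => //.
    exact: (is_path_pmul (is_path_ppow p pf) (is_path_pinv (is_path_ppow (Posz k) pg))).
  have := hq p; rewrite ler_pdivrMr // in p1.
  rewrite ler_norml -/al -/be -[(Posz k)%:~R]/(k%:R) => /andP[h1 h2].
  by move: p1; rewrite /E; lra.
have h1 : (k%:R * be - E) / al <= inf S by apply: lb_le_inf => //; exists p%:~R.
have h2 : inf S <= p%:~R by apply: ge_inf => //; exists ((k%:R * be - E) / al).
have e1 : (k%:R * be - E) / al = k%:R * (be / al) - E / al by ring.
have e2 : (k%:R * be + E) / al = k%:R * (be / al) + E / al by ring.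
rewrite e1 in h1; rewrite e2 in p2.
by rewrite ler_norml; apply/andP; split; lra.
Qed.

Lemma Kdist_hom f g : dominant f -> dominant g ->
  Kdist f g = `|ln (maslov_hom f) - ln (maslov_hom g)|.
Proof.
move=> df dg; have f0 := maslov_hom_gt0 df; have g0 := maslov_hom_gt0 dg.
rewrite /Kdist !gamma_hom //; [|by case: dg|by case: df|by case: df|by case: dg].
rewrite !ln_div ?posrE //; move: (ln _) (ln _) => x y.
have [xy|xy] := leP x y.
  by rewrite ler0_norm ?subr_le0 // opprB max_l //; lra.
by rewrite gtr0_norm ?subr_gt0 // max_r //; lra.
Qed.

Lemma maslov_rpath1 a : maslov (@rpath R n a) = n%:R * a.
Proof.
have := maslov_rpath a (@is_path_rpath R n 0); rewrite -rpathD add0r => ->.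
have e : maslov (@rpath R n 0) = 0.
  have := maslov_rpath 0 (@is_path_rpath R n 0); rewrite -rpathD addr0 mulr0 addr0.
  have := maslov_pinv (@is_path_rpath R n 0); rewrite -rpathN oppr0 => h _; lra.
by rewrite e add0r.
Qed.

Lemma ppow_rpath a k : ppow (@rpath R n a) (Posz k) = rpath n (k%:R * a).
Proof.
elim: k => [|k IH].
  apply/funext => t; rewrite /ppow expr0 mul0r /rpath /tpath.
  by under eq_fun do rewrite mulr0; rewrite torus0.
rewrite -natr1 mulrDl mul1r addrC rpathD -IH; apply/funext => t.
by rewrite /ppow /pmul exprS.
Qed.

Lemma dominant_rpath a : 0 < a -> dominant (@rpath R n a).
Proof.
move=> a0; have nR : 0 < n%:R :> R by rewrite ltr0n.
split; first exact: is_path_rpath.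
split; first by apply: in_cone_rpath; exact: ltW.
split => [h|g pg].
  have := maslov_homotopic h; rewrite maslov_rpath1.
  have -> : @pone R n = rpath n 0.
    apply/funext => t; rewrite /pone /rpath /tpath.
    by under eq_fun do rewrite mulr0; rewrite torus0.
  by rewrite maslov_rpath1 mulr0 => /eqP; rewrite mulf_eq0 !gt_eqF.
have D0 := mbound_ge0 R n.
(* Of the three [mbound], two pay for the defect of mu on the product and one is the threshold for
   the cone. *)
pose m := Num.bound `|(maslov g + 3 * mbound R n) / (n%:R * a)|.
exists m; apply: cone_of_maslov => //.
  by apply: is_path_pmul; [exact: is_path_ppow (is_path_rpath _ _) | exact: is_path_pinv].
have := maslov_pmul n_gt0 (is_path_ppow m (is_path_rpath n a)) (is_path_pinv pg).
rewrite ppow_rpath maslov_rpath1 maslov_pinv // ler_norml => /andP[h _].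
have : (maslov g + 3 * mbound R n) / (n%:R * a) <= m%:R.
  by apply: le_trans (ler_norm _) _; exact/ltW/archi_boundP/normr_ge0.
rewrite ler_pdivrMr ?mulr_gt0 // => h2.
by lra.
Qed.

Lemma maslov_hom_rpath a : maslov_hom (@rpath R n a) = n%:R * a.
Proof.
apply: (@limn_bounded_dist _ _ _ 0) => k.
by rewrite ppow_rpath maslov_rpath1 mulrCA subrr normr0.
Qed.

End RelativeGrowth.

(** Positivity makes the logarithm meaningful, the formula for K shows that it descends to an
    isometric embedding of Z, and the last clause is surjectivity. *)
Theorem theorem1p2 (R : realType) (n : nat) (hn : (0 < n)%N) :
  (forall f : R -> Mat R n, dominant f -> 0 < maslov_hom f) /\
  (forall f g : R -> Mat R n, dominant f -> dominant g ->
     Kdist f g = `| ln (maslov_hom f) - ln (maslov_hom g) |) /\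
  (forall r : R, exists f : R -> Mat R n, dominant f /\ ln (maslov_hom f) = r).
Proof.
split; first by move=> f; exact: maslov_hom_gt0.
split; first by move=> f g; exact: Kdist_hom.
move=> r; have nR : 0 < n%:R :> R by rewrite ltr0n.
(* mu~ R_a = n a, so this angle gives mu~ = exp r. *)
exists (rpath n (expR r / n%:R)); split.
  by apply: dominant_rpath => //; rewrite divr_gt0 // expR_gt0.
by rewrite maslov_hom_rpath // mulrC divfK ?gt_eqF // expRK.
Qed.
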